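(* Every C*-algebra $A$ has a faithful C*-discretization. That is, for every C*-algebra $A$ there exist a C*-algebra $M$ and an injective homomorphism $\phi \colon A \to M$ such that for every commutative C*-subalgebra $C$ of $A$ there is an injective $*$-homomorphism $\phi_C \colon \ell^\infty(\mathrm{Spec}(C)) \to M$ whose restriction to $C$ (along the natural inclusion $C \to \ell^\infty(\mathrm{Spec}(C))$) equals $\phi|_C$.
   Context: All algebras and subalgebras are unital and all homomorphisms preserve units; C*-subalgebras of $A$ contain the unit of $A$. For a commutative C*-algebra $C$, $\mathrm{Spec}(C)$ is its Gelfand spectrum; $\ell^\infty(X)$ is the algebra of bounded complex-valued functions on the set $X$; the natural inclusion $C \to \ell^\infty(\mathrm{Spec}(C))$ is the Gelfand isomorphism $C \simeq C(\mathrm{Spec}(C))$ followed by the inclusion of continuous functions into all bounded functions. A C*-discretization of a C*-algebra $A$ is a homomorphism $\phi \colon A \to M$ to a C*-algebra $M$ whose restriction to each commutative C*-subalgebra $C$ of $A$ factors through the natural inclusion $C \to \ell^\infty(\mathrm{Spec}(C))$ via a $*$-homomorphism $\phi_C \colon \ell^\infty(\mathrm{Spec}(C)) \to M$. It is called faithful when $\phi$ is injective and all $\phi_C$ can be chosen injective. *)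

(* Defs.v *)
From HB Require Import structures.
From mathcomp Require Import all_boot all_order all_algebra.
From mathcomp Require Import complex ring.
From mathcomp Require Import all_classical all_reals all_analysis.

Set Implicit Arguments.
Unset Strict Implicit.
Unset Printing Implicit Defensive.

Import Order.TTheory GRing.Theory Num.Theory numFieldNormedType.Exports.

Local Open Scope classical_set_scope.
Local Open Scope ring_scope.
Local Open Scope complex_scope.

(* Unital complex C*-algebras, the zero algebra included: this is why the
   product is part of the mixin, since algType excludes the trivial ring and
   the hierarchy has no join of pzRingType and lmodType.  The norm of a
   normedModType R[i] takes its values in R[i] (in fact in its nonnegative
   reals). *)
HB.mixin Record NormedModule_isCStarAlgebra (R : realType) A
    of NormedModule R[i] A := {
  cstar_one : A;
  cstar_mul : A -> A -> A;
  adj : A -> A;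
  cstar_mulA : associative cstar_mul;
  cstar_mul1x : left_id cstar_one cstar_mul;
  cstar_mulx1 : right_id cstar_one cstar_mul;
  cstar_mulDl : left_distributive cstar_mul +%R;
  cstar_mulDr : right_distributive cstar_mul +%R;
  cstar_scaleAl : forall (a : R[i]) (x y : A),
    a *: cstar_mul x y = cstar_mul (a *: x) y;
  cstar_scaleAr : forall (a : R[i]) (x y : A),
    a *: cstar_mul x y = cstar_mul x (a *: y);
  adjK : involutive adj;
  adjD : {morph adj : x y / x + y};
  adjZ : forall (a : R[i]) (x : A), adj (a *: x) = a^*%C *: adj x;
  adjM : forall x y : A, adj (cstar_mul x y) = cstar_mul (adj y) (adj x);
  cstar_normM : forall x y : A, `|cstar_mul x y| <= `|x| * `|y|;
  cstar_identity : forall x : A, `|cstar_mul (adj x) x| = `|x| ^+ 2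
}.

#[short(type="cstarAlgType")]
HB.structure Definition CStarAlgebra (R : realType) :=
  {A of CompleteNormedModule R[i] A & NormedModule_isCStarAlgebra R A}.

#[non_forgetful_inheritance]
HB.instance Definition _ (R : realType) (A : cstarAlgType R) :=
  GRing.Zmodule_isPzRing.Build A (@cstar_mulA R A) (@cstar_mul1x R A)
    (@cstar_mulx1 R A) (@cstar_mulDl R A) (@cstar_mulDr R A).

(* [monoid_morphism] is multiplicativity together with [f 1 = 1]. *)
Definition star_hom (R : realType) (A B : cstarAlgType R) (f : A -> B) : Prop :=
  [/\ linear f, monoid_morphism f & {morph f : x / adj x}].

Record cstarSubalg (R : realType) (A : cstarAlgType R) := CStarSubalg {
  subalg_mem :> {pred A};
  subalg1 : 1 \in subalg_mem;
  subalgD : {in subalg_mem &, forall x y, x + y \in subalg_mem};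
  subalgM : {in subalg_mem &, forall x y, x * y \in subalg_mem};
  subalgZ : forall a : R[i], {in subalg_mem, forall x, a *: x \in subalg_mem};
  subalg_adj : {in subalg_mem, forall x, adj x \in subalg_mem};
  subalg_closed : closed [set x | x \in subalg_mem]
}.

Record subalg_type (R : realType) (A : cstarAlgType R) (S : cstarSubalg A) :=
  SubalgElt { subalg_val : A; _ : subalg_val \in S }.

Section SubalgCStar.
Context (R : realType) (A : cstarAlgType R) (S : cstarSubalg A).
Local Notation T := (subalg_type S).

HB.instance Definition _ := [isSub for @subalg_val R A S].
HB.instance Definition _ := [Choice of T by <:].

Fact subalg_submod : GRing.subsemimod_closed [pred x | x \in S].
Proof.
split=> [|a x Sx]; last exact: subalgZ.
split; last by move=> x y; apply: subalgD.
by rewrite -(scale0r (1 : A)); apply/subalgZ/subalg1.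
Qed.

HB.instance Definition _ :=
  GRing.SubChoice_isSubLmodule.Build R[i] A _ T subalg_submod.

Fact subalg_ler_normD (x y : T) : `|val (x + y)| <= `|val x| + `|val y|.
Proof. by rewrite raddfD ler_normD. Qed.

Fact subalg_normrZ (l : R[i]) (x : T) : `|val (l *: x)| = `|l| * `|val x|.
Proof. by rewrite linearZ normrZ. Qed.

Fact subalg_normr0_eq0 (x : T) : `|val x| = 0 -> x = 0.
Proof. by move=> /normr0_eq0 x0; apply/val_inj; rewrite raddf0. Qed.

HB.instance Definition _ := Lmodule_isNormed.Build R[i] T
  subalg_ler_normD subalg_normrZ subalg_normr0_eq0.

Lemma subalg_normE (x : T) : `|x| = `|val x|. Proof. by []. Qed.

Fact subalg_complete (F : set_system T) : ProperFilter F -> cauchy F -> cvg F.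
Proof.
move=> FF Fc.
have /cauchy_cvgP/cvg_ex[/= a] : cauchy (val @ F).
  apply/cauchyP => e e0; move/cauchyP : Fc => /(_ e e0)[x Fx].
  exists (val x); suff: F [set y | ball (val x) e (val y)] by [].
  apply: filterS Fx => y xy.
  have {}xy : `|x - y| < e by move: xy; rewrite -ball_normE.
  by rewrite -ball_normE /=; move: xy; rewrite subalg_normE raddfB.
move=> /cvgrPdist_lt Ga.
have Sa : a \in S.
  apply: (@subalg_closed _ _ S) => B /nbhs_ballP[e /= e0 eB].
  have [x /= xe] := filter_ex (Ga _ e0).
  exists (val x); split; first exact: valP.
  by apply: eB; rewrite -ball_normE.
apply/cvg_ex; exists (SubalgElt Sa); apply/fcvgrPdist_lt => e e0.
by apply: filterS (Ga _ e0) => x; rewrite subalg_normE raddfB.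
Qed.

HB.instance Definition _ := Uniform_isComplete.Build T subalg_complete.

Definition subalg_one : T := SubalgElt (subalg1 S).
Definition subalg_mul (x y : T) : T :=
  SubalgElt (subalgM (valP x) (valP y)).
Definition subalg_star (x : T) : T := SubalgElt (subalg_adj (valP x)).

Fact subalg_mulA : associative subalg_mul.
Proof. by move=> x y z; apply/val_inj; exact: mulrA. Qed.
Fact subalg_mul1x : left_id subalg_one subalg_mul.
Proof. by move=> x; apply/val_inj; exact: mul1r. Qed.
Fact subalg_mulx1 : right_id subalg_one subalg_mul.
Proof. by move=> x; apply/val_inj; exact: mulr1. Qed.
Fact subalg_mulDl : left_distributive subalg_mul +%R.
Proof. by move=> x y z; apply/val_inj; exact: mulrDl. Qed.
Fact subalg_mulDr : right_distributive subalg_mul +%R.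
Proof. by move=> x y z; apply/val_inj; exact: mulrDr. Qed.
Fact subalg_scaleAl (a : R[i]) (x y : T) :
  a *: subalg_mul x y = subalg_mul (a *: x) y.
Proof. by apply/val_inj; exact: cstar_scaleAl. Qed.
Fact subalg_scaleAr (a : R[i]) (x y : T) :
  a *: subalg_mul x y = subalg_mul x (a *: y).
Proof. by apply/val_inj; exact: cstar_scaleAr. Qed.
Fact subalg_adjK : involutive subalg_star.
Proof. by move=> x; apply/val_inj; exact: adjK. Qed.
Fact subalg_adjD : {morph subalg_star : x y / x + y}.
Proof. by move=> x y; apply/val_inj; exact: adjD. Qed.
Fact subalg_adjZ (a : R[i]) (x : T) :
  subalg_star (a *: x) = a^*%C *: subalg_star x.
Proof. by apply/val_inj; exact: adjZ. Qed.
Fact subalg_adjM (x y : T) :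
  subalg_star (subalg_mul x y) = subalg_mul (subalg_star y) (subalg_star x).
Proof. by apply/val_inj; exact: adjM. Qed.
Fact subalg_normM (x y : T) : `|subalg_mul x y| <= `|x| * `|y|.
Proof. by rewrite !subalg_normE; exact: cstar_normM. Qed.
Fact subalg_identity (x : T) : `|subalg_mul (subalg_star x) x| = `|x| ^+ 2.
Proof. by rewrite !subalg_normE; exact: cstar_identity. Qed.

HB.instance Definition _ := NormedModule_isCStarAlgebra.Build R T
  subalg_mulA subalg_mul1x subalg_mulx1 subalg_mulDl subalg_mulDr
  subalg_scaleAl subalg_scaleAr subalg_adjK subalg_adjD subalg_adjZ
  subalg_adjM subalg_normM subalg_identity.

End SubalgCStar.

Section ComplexComplete.
Context (R : realType).

Lemma normc_ge_Im (x : R[i]) : `|complex.Im x|%:C <= `|x|.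
Proof.
by case: x => a b; simpc; rewrite -sqrtr_sqr ler_wsqrtr // lerDr sqr_ge0.
Qed.

Lemma normc_le_ReIm (x : R[i]) : `|x| <= (`|complex.Re x| + `|complex.Im x|)%:C.
Proof.
case: x => a b; rewrite normc_def lecR /=.
rewrite -[leRHS]ger0_norm ?addr_ge0// -sqrtr_sqr ler_wsqrtr//.
rewrite sqrrD !real_normK ?num_real//.
by rewrite addrAC lerDl mulrn_wge0 // mulr_ge0.
Qed.

Lemma complex_complete (F : set_system R[i]) : ProperFilter F ->
  (forall e : R[i], 0 < e -> exists z, F [set w | `|z - w| < e]) ->
  exists a, forall e : R[i], 0 < e -> F [set w | `|a - w| < e].
Proof.
move=> FF Fc.
have cplx_cvg (h : R[i] -> R) : (forall z w, `|h z - h w|%:C <= `|z - w|) ->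
    exists a, forall e : R, 0 < e -> F [set w | `|a - h w| < e].
  move=> hle.
  have /cauchy_cvgP/cvg_ex[/= a /cvgrPdist_lt ha] : cauchy (h @ F).
    apply/cauchyP => e e0; have [|z Fz] := Fc e%:C; first by rewrite ltcR.
    exists (h z); suff: F [set w | ball (h z) e (h w)] by [].
    apply: filterS Fz => w /= zw.
    by rewrite -ball_normE /ball_/= -ltcR; exact: le_lt_trans zw.
  by exists a => e /ha.
have [a Fa] : exists a, forall e : R, 0 < e ->
    F [set w | `|a - complex.Re w| < e].
  by apply: cplx_cvg => z w; rewrite -raddfB normc_ge_Re.
have [b Fb] : exists b, forall e : R, 0 < e ->
    F [set w | `|b - complex.Im w| < e].
  by apply: cplx_cvg => z w; rewrite -raddfB normc_ge_Im.
exists (a +i* b) => e e0.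
have [r re] : exists r : R, e = r%:C.
  by exists (complex.Re e); rewrite RRe_real// gtr0_real.
move: e0; rewrite {}re ltcR => r0.
have r20 : 0 < r / 2 by rewrite divr_gt0.
apply: filterS (filterI (Fa _ r20) (Fb _ r20)) => -[u v] [/= au bv].
apply: le_lt_trans (normc_le_ReIm _) _; rewrite ltcR /= [ltRHS]splitr.
exact: ltrD.
Qed.

End ComplexComplete.

Definition linf_bounded (R : realType) (X : Type) : {pred X -> R[i]} :=
  fun f => `[< exists M : R[i], forall x, `|f x| <= M >].

Record linf (R : realType) (X : Type) := Linf {
  linf_fun :> X -> R[i];
  _ : linf_bounded linf_fun
}.

Section LinfCStar.
Context (R : realType) (X : Type).
Local Notation T := (linf R X).

HB.instance Definition _ := [isSub for @linf_fun R X].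
HB.instance Definition _ := [Choice of T by <:].

Fact linf_submod : GRing.subsemimod_closed (@linf_bounded R X).
Proof.
split=> [|a f /asboolP[M fM]]; last first.
  by apply/asboolP; exists (`|a| * M) => x; rewrite normrM ler_wpM2l.
split=> [|f g /asboolP[M fM] /asboolP[N gN]]; apply/asboolP.
  by exists 0 => x; rewrite normr0.
by exists (M + N) => x; rewrite (le_trans (ler_normD _ _))// lerD.
Qed.

HB.instance Definition _ :=
  GRing.SubChoice_isSubLmodule.Build R[i] (X -> R[i]) _ T linf_submod.

Lemma linfP (f g : T) : (forall x, f x = g x) -> f = g.
Proof. by move=> fg; apply/val_inj/funext. Qed.

Lemma linfDE (f g : T) x : (f + g) x = f x + g x. Proof. by []. Qed.
Lemma linfZE (a : R[i]) (f : T) x : (a *: f) x = a * f x. Proof. by []. Qed.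
Lemma linfNE (f : T) x : (- f) x = - f x.
Proof. by rewrite -scaleN1r linfZE mulN1r. Qed.

(* The supremum norm, viewed in R[i]; it is 0 when X is empty. *)
Definition linf_norm (f : T) : R[i] :=
  (sup (range (fun x => complex.Re `|f x|)))%:C.

Lemma linf_norm_ub (f : T) x : `|f x| <= linf_norm f.
Proof.
rewrite /linf_norm -[leLHS]RRe_real ?normr_real// lecR.
apply: ub_le_sup; last by exists x.
case: f => f /= /asboolP[M fM]; exists (complex.Re M) => _ [y _ <-].
by have := fM y; rewrite lecE => /andP[].
Qed.

Lemma linf_norm_empty (f : T) : ~ inhabited X -> linf_norm f = 0.
Proof.
move=> X0; rewrite /linf_norm.
have -> : range (fun x => complex.Re `|f x|) = set0.
  by apply/seteqP; split=> // y [x _ _]; case: X0; exists.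
by rewrite sup0.
Qed.

Lemma linf_norm_lub (f : T) (M : R[i]) : 0 <= M ->
  (forall x, `|f x| <= M) -> linf_norm f <= M.
Proof.
move=> M0 fM.
have [[x]|X0] := pselect (inhabited X); last by rewrite linf_norm_empty.
rewrite /linf_norm -[leRHS]RRe_real ?ger0_real// lecR.
apply: ge_sup; first by exists (complex.Re `|f x|), x.
by move=> _ [y _ <-]; have := fM y; rewrite lecE => /andP[].
Qed.

Lemma linf_norm_ge0 (f : T) : 0 <= linf_norm f.
Proof.
have [[x]|X0] := pselect (inhabited X); last by rewrite linf_norm_empty.
exact: le_trans (normr_ge0 _) (linf_norm_ub f x).
Qed.

Fact linf_ler_normD (f g : T) : linf_norm (f + g) <= linf_norm f + linf_norm g.
Proof.
apply: linf_norm_lub => [|x]; first by rewrite addr_ge0 ?linf_norm_ge0.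
by rewrite linfDE (le_trans (ler_normD _ _))// lerD ?linf_norm_ub.
Qed.

Fact linf_normrZ (a : R[i]) (f : T) : linf_norm (a *: f) = `|a| * linf_norm f.
Proof.
have le b (h : T) : linf_norm (b *: h) <= `|b| * linf_norm h.
  apply: linf_norm_lub => [|x]; first by rewrite mulr_ge0 ?linf_norm_ge0.
  by rewrite linfZE normrM ler_wpM2l ?linf_norm_ub.
apply/eqP; rewrite eq_le le /=; have [->|a0] := eqVneq a 0.
  by rewrite normr0 mul0r linf_norm_ge0.
rewrite mulrC -ler_pdivlMr ?normr_gt0// mulrC -normfV.
by apply: le_trans (le _ _); rewrite scalerA mulVf// scale1r.
Qed.

Fact linf_normr0_eq0 (f : T) : linf_norm f = 0 -> f = 0.
Proof.
move=> f0; apply: linfP => x; apply/normr0_eq0/eqP.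
by rewrite eq_le normr_ge0 andbT -f0 linf_norm_ub.
Qed.

HB.instance Definition _ := Lmodule_isNormed.Build R[i] T
  linf_ler_normD linf_normrZ linf_normr0_eq0.

Lemma linf_normE (f : T) : `|f| = linf_norm f. Proof. by []. Qed.

Fact linf_complete (F : set_system T) : ProperFilter F -> cauchy F -> cvg F.
Proof.
move=> FF /cauchyP Fc.
have {}Fc (e : R[i]) : 0 < e -> exists f : T, F [set h : T | `|f - h| < e].
  move=> /Fc[f Ff]; exists f; apply: filterS Ff => h.
  by rewrite -ball_normE.
have /choice[g Fg] (x : X) : exists a : R[i], forall e : R[i], 0 < e ->
    F [set h : T | `|a - h x| < e].
  have Fx : ProperFilter ((fun h : T => h x) @ F) by exact: fmap_proper_filter.
  apply: (complex_complete Fx) => e e0; have [f Ff] := Fc e e0; exists (f x).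
  suff: F [set h : T | `|f x - h x| < e] by [].
  apply: filterS Ff => h /=; apply: le_lt_trans.
  by have := linf_norm_ub (f - h) x; rewrite linfDE linfNE.
have gle (e : R[i]) (f : T) : 0 < e -> F [set h : T | `|f - h| < e] ->
    forall x, `|g x - f x| <= e + e.
  move=> e0 Ff x; have [h /= [fh gh]] := filter_ex (filterI Ff (Fg x e e0)).
  rewrite -(subrKA (h x)); apply: le_trans (ler_normD _ _) _.
  rewrite lerD ?(ltW gh)// distrC; apply: le_trans (ltW fh).
  by have := linf_norm_ub (f - h) x; rewrite linfDE linfNE.
have gP : linf_bounded g.
  apply/asboolP; have [f Ff] := Fc 1 ltr01; exists (1 + 1 + `|f|) => x.
  rewrite -[g x](subrK (f x)); apply: le_trans (ler_normD _ _) _.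
  by rewrite lerD ?linf_norm_ub// gle.
apply/cvg_ex; exists (Linf gP); apply/fcvgrPdist_lt => e e0.
pose d := e / 4%:R.
have d0 : 0 < d by rewrite divr_gt0.
have -> : e = (d + d) + (d + d) by rewrite /d; field.
have [f Ff] := Fc _ d0.
apply: filterS (Ff) => h /= fh; apply: (@le_lt_trans _ _ ((d + d) + d)); last first.
  by rewrite ltrD2l ltrDl.
apply: linf_norm_lub => [|x]; first by rewrite !addr_ge0// ltW.
rewrite linfDE linfNE -(subrKA (f x)); apply: le_trans (ler_normD _ _) _.
rewrite lerD//; first exact: gle.
apply: le_trans (ltW fh).
by have := linf_norm_ub (f - h) x; rewrite linfDE linfNE.
Qed.

HB.instance Definition _ := Uniform_isComplete.Build T linf_complete.

Fact linf_one_bounded : linf_bounded (fun _ : X => 1 : R[i]).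
Proof. by apply/asboolP; exists 1 => x; rewrite normr1. Qed.

Fact linf_mul_bounded (f g : T) : linf_bounded (fun x => f x * g x).
Proof.
apply/asboolP; exists (`|f| * `|g|) => x.
by rewrite normrM ler_pM ?linf_norm_ub.
Qed.

Fact linf_adj_bounded (f : T) : linf_bounded (fun x => (f x)^*%C).
Proof.
by apply/asboolP; exists `|f| => x; rewrite normcJ linf_norm_ub.
Qed.

Definition linf_one : T := Linf linf_one_bounded.
Definition linf_mul (f g : T) : T := Linf (linf_mul_bounded f g).
Definition linf_adj (f : T) : T := Linf (linf_adj_bounded f).

Fact linf_mulA : associative linf_mul.
Proof. by move=> f g h; apply: linfP => x; exact: mulrA. Qed.
Fact linf_mul1x : left_id linf_one linf_mul.
Proof. by move=> f; apply: linfP => x; exact: mul1r. Qed.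
Fact linf_mulx1 : right_id linf_one linf_mul.
Proof. by move=> f; apply: linfP => x; exact: mulr1. Qed.
Fact linf_mulDl : left_distributive linf_mul +%R.
Proof. by move=> f g h; apply: linfP => x; exact: mulrDl. Qed.
Fact linf_mulDr : right_distributive linf_mul +%R.
Proof. by move=> f g h; apply: linfP => x; exact: mulrDr. Qed.
Fact linf_scaleAl (a : R[i]) (f g : T) :
  a *: linf_mul f g = linf_mul (a *: f) g.
Proof. by apply: linfP => x; exact: mulrA. Qed.
Fact linf_scaleAr (a : R[i]) (f g : T) :
  a *: linf_mul f g = linf_mul f (a *: g).
Proof. by apply: linfP => x; exact: mulrCA. Qed.
Fact linf_adjK : involutive linf_adj.
Proof. by move=> f; apply: linfP => x; exact: conjcK. Qed.
Fact linf_adjD : {morph linf_adj : f g / f + g}.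
Proof. by move=> f g; apply: linfP => x; exact: rmorphD. Qed.
Fact linf_adjZ (a : R[i]) (f : T) : linf_adj (a *: f) = a^*%C *: linf_adj f.
Proof. by apply: linfP => x; exact: rmorphM. Qed.
Fact linf_adjM (f g : T) :
  linf_adj (linf_mul f g) = linf_mul (linf_adj g) (linf_adj f).
Proof. by apply: linfP => x /=; rewrite rmorphM mulrC. Qed.
Fact linf_normM (f g : T) : `|linf_mul f g| <= `|f| * `|g|.
Proof.
apply: linf_norm_lub => [|x]; first by rewrite mulr_ge0.
by rewrite normrM ler_pM ?linf_norm_ub.
Qed.
Fact linf_identity (f : T) : `|linf_mul (linf_adj f) f| = `|f| ^+ 2.
Proof.
apply/eqP; rewrite eq_le; apply/andP; split.
  apply: linf_norm_lub => [|x]; first by rewrite exprn_ge0.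
  by rewrite normrM normcJ -expr2 lerXn2r ?nnegrE ?linf_norm_ge0 ?linf_norm_ub.
rewrite -[leRHS]sqrtCK lerXn2r ?nnegrE ?sqrtC_ge0//.
apply: linf_norm_lub => [|x]; first by rewrite sqrtC_ge0.
rewrite -[leLHS]sqrCK// ler_sqrtC ?nnegrE ?exprn_ge0//.
by have := linf_norm_ub (linf_mul (linf_adj f) f) x; rewrite normrM normcJ.
Qed.

HB.instance Definition _ := NormedModule_isCStarAlgebra.Build R T
  linf_mulA linf_mul1x linf_mulx1 linf_mulDl linf_mulDr
  linf_scaleAl linf_scaleAr linf_adjK linf_adjD linf_adjZ
  linf_adjM linf_normM linf_identity.

End LinfCStar.

Definition is_character (R : realType) (C : cstarAlgType R) (chi : C -> R[i]) : Prop :=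
  scalar chi /\ monoid_morphism chi.

(* Only the underlying set of the spectrum is needed for l^oo(Spec C), so its
   topology is not defined; the multiplicative functionals are automatically
   contractive (character_norm below) and, when C is commutative, *-preserving. *)
Definition Spec (R : realType) (C : cstarAlgType R) : Type :=
  {chi : C -> R[i] | is_character chi}.

Section Gelfand.
Context (R : realType) (C : cstarAlgType R).

Lemma geometric_fixpoint (d : C) : `|d| < 1 -> exists b : C, b = d + d * b.
Proof.
move=> d1; pose q := complex.Re `|d|.
have qE : `|d| = q%:C by rewrite RRe_real.
have q0 : 0 <= q by rewrite -lecR -qE; exact: normr_ge0.
have q1 : q < 1 by rewrite -ltcR -qE; exact: d1.
pose s n := iter n (fun b => d + d * b) 0 : C.
have s_le m : `|s m| <= (q / (1 - q))%:C.
  elim: m => [|m IH]; first by rewrite normr0 lecR divr_ge0// subr_ge0 ltW.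
  rewrite /s iterS -/(s m); apply: le_trans (ler_normD _ _) _.
  apply: le_trans (lerD (lexx _) (cstar_normM _ _)) _.
  apply: le_trans (lerD (lexx _) (ler_wpM2l _ IH)) _ => //.
  rewrite qE -rmorphM -rmorphD lecR le_eqVlt; apply/orP; left; apply/eqP.
  by field; rewrite subr_eq0 gt_eqF.
have s_diff N m : `|s (N + m)%N - s N| <= (q ^+ N * (q / (1 - q)))%:C.
  elim: N => [|N IH]; first by rewrite subr0 expr0 mul1r s_le.
  rewrite addSn /s !iterS -/(s _) -/(s _) opprD addrACA subrr add0r -mulrBr.
  apply: le_trans (cstar_normM _ _) _.
  by rewrite exprS -mulrA rmorphM/= -qE ler_wpM2l.
have small (e : R[i]) : 0 < e -> exists N, forall m, `|s (N + m)%N - s N| < e.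
  move=> e0; have [r re] : exists r : R, e = r%:C.
    by exists (complex.Re e); rewrite RRe_real// gtr0_real.
  move: e0; rewrite re ltcR => r0.
  have : (fun n => q ^+ n * (q / (1 - q))) @ \oo --> (0 : R).
    by rewrite -[0](mul0r (q / (1 - q))); apply: cvgMl; apply: cvg_expr;
      rewrite ger0_norm.
  move=> /cvgrPdist_lt/(_ _ r0)[N _ /(_ N (leqnn N))/=].
  rewrite sub0r normrN => qN; exists N => m.
  apply: le_lt_trans (s_diff N m) _; rewrite ltcR.
  exact: le_lt_trans (ler_norm _) qN.
have /cauchy_cvgP/cvg_ex[/= b /cvgrPdist_lt sb] : cauchy (s @ \oo).
  apply/cauchyP => e /small[N sN]; exists (s N); exists N => // n /= Nn.
  by rewrite -ball_normE /= distrC -(subnKC Nn) sN.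
exists b; apply/eqP; rewrite -subr_eq0 -normr_le0; apply/ler_addgt0Pr => e e0.
rewrite add0r.
have e20 : 0 < e / 2 by rewrite divr_gt0.
have [N _ sN] := sb _ e20.
have -> : b - (d + d * b) = (b - s N.+1) + d * (s N - b).
  by rewrite /s iterS -/(s N) mulrBr opprD !addrA; congr (_ - _);
     rewrite opprD -!addrA addNr addr0.
apply: le_trans (ler_normD _ _) _; rewrite [leRHS]splitr lerD//.
  by rewrite ltW// sN//=.
apply: le_trans (cstar_normM _ _) _; rewrite -[leRHS]mul1r.
by apply: ler_pM => //; [exact: ltW | rewrite distrC ltW// sN/=].
Qed.

Lemma character_norm (chi : C -> R[i]) (c : C) :
  is_character chi -> `|chi c| <= `|c|.
Proof.
move=> [chi_lin [chi1 chiM]].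
rewrite real_leNgt ?normr_real//; apply/negP => lt_c.
have chi0 : chi c != 0 by rewrite -normr_gt0 (le_lt_trans _ lt_c).
have chiZ a x : chi (a *: x) = a * chi x.
  have chi00 : chi 0 = 0.
    by have := chi_lin (-1) 0 0; rewrite scaler0 addr0 mulN1r addNr.
  by rewrite -[a *: x]addr0 chi_lin chi00 addr0.
have [|b bE] := @geometric_fixpoint ((chi c)^-1 *: c).
  by rewrite normrZ normfV mulrC ltr_pdivrMr ?normr_gt0// mul1r.
have := congr1 chi bE; rewrite -[X in chi (X + _)]scale1r chi_lin mul1r chiM.
rewrite chiZ mulVf// mul1r => /eqP.
by rewrite eq_sym -subr_eq0 addrK oner_eq0.
Qed.

Fact gelfand_bounded (c : C) :
  linf_bounded (fun chi : Spec C => sval chi c).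
Proof.
by apply/asboolP; exists `|c| => chi; apply/character_norm/(svalP chi).
Qed.

(* For commutative C, this is the natural inclusion C -> l^oo(Spec C), that is
   c |-> (chi |-> chi c). *)
Definition gelfand (c : C) : linf R (Spec C) := Linf (gelfand_bounded c).

End Gelfand.

Section Discretization.
Context (R : realType) (A M : cstarAlgType R).

Definition factors_through (phi : A -> M) (C : cstarSubalg A)
    (phiC : linf R (Spec (subalg_type C)) -> M) : Prop :=
  star_hom phiC /\ forall c : subalg_type C, phiC (gelfand c) = phi (val c).

Definition commutative_subalg (C : cstarSubalg A) : Prop :=
  {in C &, commutative *%R}.

Definition cstar_discretization (phi : A -> M) : Prop :=
  star_hom phi /\
  forall C : cstarSubalg A, commutative_subalg C ->
    exists phiC, @factors_through phi C phiC.

Definition faithful_cstar_discretization (phi : A -> M) : Prop :=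
  [/\ cstar_discretization phi, injective phi &
      forall C : cstarSubalg A, commutative_subalg C ->
        exists2 phiC, @factors_through phi C phiC & injective phiC].

End Discretization.

(* Main.v *)
(* Realize A on the Hilbert space H which is the sum of the GNS spaces of all
   states, and take M = B(H).  For a commutative C, the *-homomorphism
   l^oo(Spec C) -> B(H) is obtained by Zorn's lemma, in the spirit of Gleason's
   projectivity theorem, from a maximal commutative *-subalgebra G of
   l^oo(Spec C) x B(H) which contains the pairs (gelfand c, c), is contractive
   (|T| <= |f| for (f, T) in G), and is such that T v = f(chi) v for every
   joint eigenvector v of C with character chi.  If (1_E, q) is missing from G
   one can adjoin it, q being the projection on the vectors that are killed by
   all T with (f, T) in G and f = 0 on E, and are orthogonal to the joint
   eigenvectors with character outside E.  As G is closed and contains an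
   (1_E, q) for every E, it is the graph of a total map.
   This map is injective because every character chi of C extends to a state of
   A, whose GNS vector is a joint eigenvector of C with character chi. *)

Require Import Defs.
From HB Require Import structures.
From mathcomp Require Import all_boot all_order all_algebra.
From mathcomp Require Import complex ring lra.
From mathcomp Require Import all_classical all_reals all_analysis.

Set Implicit Arguments.
Unset Strict Implicit.
Unset Printing Implicit Defensive.

Import Order.TTheory GRing.Theory Num.Theory numFieldNormedType.Exports.
Import Defs.

Local Open Scope classical_set_scope.
Local Open Scope ring_scope.
Local Open Scope complex_scope.

(** * Norms with values in the reals *)

(** The obstacle is multiplicativity on arbitrary sets of characters. Extension theorems of
    Hahn-Banach type give positive maps on l^oo(Spec C) rather than homomorphisms, and functional
    calculus in the weak closure of C reaches only Borel sets; hence sets E are adjoined one at a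
    time. Contractivity is the clause that keeps a graph usable: it makes the graph single-valued
    and, when the graph is closed, makes its domain closed. When q is adjoined, T q has to be
    bounded by the values of f on E alone. This dictates the range of q: it is killed by whatever is
    paired with a function vanishing on E, so the function of [adj T * T] may be truncated off E
    without changing [adj T * T * q]. Dually, 1 - q turns out to be killed by whatever is paired
    with a function vanishing off E. An extension may well annihilate the indicator of a point, so
    injectivity cannot be recovered afterwards; the eigenvector clause carries it through Zorn's
    lemma. The spectral theory behind states and characters is done with norms only. *)

Section InverseNat.
Context (R : realType).

Lemma invnS_gt0 n : 0 < n.+1%:R^-1 :> R.
Proof. by rewrite invr_gt0 ltr0n. Qed.

Lemma invnS_le n m : (n <= m)%N -> m.+1%:R^-1 <= n.+1%:R^-1 :> R.
Proof. by move=> nm; rewrite lef_pV2 ?posrE ?ltr0n// ler_nat. Qed.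

Lemma invnS_small (e : R) : 0 < e -> exists N : nat, N.+1%:R^-1 < e.
Proof.
move=> e0; exists (Num.bound e^-1).
rewrite -[ltRHS]invrK ltf_pV2 ?posrE ?ltr0n// ?invr_gt0//.
apply: lt_le_trans (archi_boundP _) _; first by rewrite invr_ge0 ltW.
by rewrite ler_nat.
Qed.

End InverseNat.

Section RealNorm.
Context (R : realType) (V : normedModType R[i]).
Implicit Types (x y : V) (e : R).

(** The norm of V is a nonnegative element of [R[i]]; its real part carries the same information and
    moves all estimates to the ordered field R. *)
Definition nrm (x : V) : R := complex.Re `|x|.

Lemma nrmE x : `|x| = (nrm x)%:C.
Proof. by rewrite /nrm RRe_real// normr_real. Qed.

Lemma nrm_ge0 x : 0 <= nrm x.
Proof. by rewrite -lecR -nrmE; exact: normr_ge0. Qed.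

Lemma nrmD x y : nrm (x + y) <= nrm x + nrm y.
Proof. by rewrite -lecR rmorphD/= -!nrmE ler_normD. Qed.

Lemma nrmN x : nrm (- x) = nrm x.
Proof. by rewrite /nrm normrN. Qed.

Lemma nrmC x y : nrm (x - y) = nrm (y - x).
Proof. by rewrite -nrmN opprB. Qed.

Lemma nrmB x y : nrm (x - y) <= nrm x + nrm y.
Proof. by rewrite -(nrmN y) nrmD. Qed.

Lemma nrm_triangle y x z : nrm (x - z) <= nrm (x - y) + nrm (y - z).
Proof. by rewrite (le_trans _ (nrmD _ _))// subrKA. Qed.

Lemma nrm0 : nrm 0 = 0.
Proof. by rewrite /nrm normr0. Qed.

Lemma nrm0_eq0 x : nrm x = 0 -> x = 0.
Proof. by move=> x0; apply/normr0_eq0; rewrite nrmE x0. Qed.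

Lemma nrmZ (a : R[i]) x : nrm (a *: x) = complex.Re `|a| * nrm x.
Proof.
apply: (fmorph_inj (@real_complex R)) => /=.
rewrite rmorphM/= -!nrmE normrZ; congr (_ * _).
Qed.

Lemma nrmZr (t : R) x : nrm (t%:C *: x) = `|t| * nrm x.
Proof. by rewrite nrmZ normc_def /= expr0n/= addr0 sqrtr_sqr. Qed.

Definition ncauchy (u : nat -> V) :=
  forall e, 0 < e -> exists N, forall n m, (N <= n)%N -> (N <= m)%N ->
    nrm (u n - u m) < e.

Definition ncvg (u : nat -> V) (l : V) :=
  forall e, 0 < e -> exists N, forall n, (N <= n)%N -> nrm (u n - l) < e.

Definition nclosed (D : set V) :=
  forall l, (forall e, 0 < e -> exists2 x, D x & nrm (l - x) < e) -> D l.

Lemma nclosed_ncvg (D : set V) u l :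
  nclosed D -> (forall n, D (u n)) -> ncvg u l -> D l.
Proof.
move=> Dc Du ul; apply: Dc => e /ul[N uN].
by exists (u N) => //; rewrite nrmC uN.
Qed.

Lemma nrm_small_eq0 x : (forall e, 0 < e -> nrm x <= e) -> x = 0.
Proof.
move=> xe; apply/nrm0_eq0/eqP; rewrite eq_le nrm_ge0 andbT.
by apply/ler_addgt0Pl => e /xe; rewrite addr0.
Qed.

End RealNorm.

Lemma ncauchy_ncvg (R : realType) (V : completeNormedModType R[i])
  (u : nat -> V) : ncauchy u -> exists l, ncvg u l.
Proof.
move=> uc.
have Ree (e : R[i]) : 0 < e -> 0 < complex.Re e /\ e = (complex.Re e)%:C.
  move=> e0; have eE : e = (complex.Re e)%:C by rewrite RRe_real// gtr0_real.
  by split=> //; rewrite -ltcR -eE.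
have /cauchy_cvgP/cvg_ex[/= b /cvgrPdist_lt ub] : cauchy (u @ \oo).
  apply/cauchyP => e /Ree[e0 ->]; have [N uN] := uc _ e0; exists (u N).
  exists N => // n /= Nn.
  by rewrite -ball_normE /= nrmE ltcR uN.
exists b => e e0; have [|N _ uN] := ub e%:C; first by rewrite ltcR.
by exists N => n Nn; have := uN n Nn; rewrite nrmE ltcR nrmC.
Qed.

(** * Elementary identities in a C*-algebra *)

Section CStarBasics.
Context (R : realType) (A : cstarAlgType R).
Implicit Types (x y h : A) (a : R[i]) (t : R).

Lemma cscaleAl a x y : a *: (x * y) = (a *: x) * y.
Proof. exact: cstar_scaleAl. Qed.
Lemma cscaleAr a x y : a *: (x * y) = x * (a *: y).
Proof. exact: cstar_scaleAr. Qed.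
Lemma cadjM x y : adj (x * y) = adj y * adj x.
Proof. exact: adjM. Qed.

Lemma adj_one : adj (1 : A) = 1.
Proof. by rewrite -[LHS]mulr1 -{2}[1 in LHS]adjK -cadjM mulr1 adjK. Qed.

Lemma adj0 : adj (0 : A) = 0.
Proof. by rewrite -(scale0r (1 : A)) adjZ rmorph0 !scale0r. Qed.

Lemma adjN x : adj (- x) = - adj x.
Proof. by rewrite -scaleN1r adjZ rmorphN rmorph1 scaleN1r. Qed.

Lemma adjB x y : adj (x - y) = adj x - adj y.
Proof. by rewrite adjD adjN. Qed.

Lemma adjZr t x : adj (t%:C *: x) = t%:C *: adj x.
Proof. by rewrite adjZ conjc_real. Qed.

Lemma nrmM x y : nrm (x * y) <= nrm x * nrm y.
Proof. by rewrite -lecR rmorphM/= -!nrmE; exact: cstar_normM. Qed.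

Lemma nrm_adjM x : nrm (adj x * x) = nrm x ^+ 2.
Proof.
apply: (fmorph_inj (@real_complex R)) => /=.
by rewrite rmorphXn/= -!nrmE; exact: cstar_identity.
Qed.

Lemma nrm_adj x : nrm (adj x) = nrm x.
Proof.
have le y : nrm y <= nrm (adj y).
  have := nrmM (adj y) y; rewrite nrm_adjM expr2.
  have := nrm_ge0 y; rewrite le_eqVlt => /orP[/eqP<- _|y0].
    exact: nrm_ge0.
  by rewrite ler_pM2r.
by apply/eqP; rewrite eq_le -{2}(adjK x) !le ?andbT.
Qed.

(** Only an inequality: in the zero algebra 1 = 0. *)
Lemma nrm1_le1 : nrm (1 : A) <= 1.
Proof.
have := nrm_adjM 1; rewrite adj_one mulr1 => n1.
have := nrm_ge0 (1 : A); rewrite le_eqVlt => /orP[/eqP<- //|n0].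
by rewrite -(ler_pM2r n0) mul1r -expr2 -n1.
Qed.

Definition sc t : A := t%:C *: (1 : A).

Lemma scD s t : sc (s + t) = sc s + sc t.
Proof. by rewrite /sc rmorphD scalerDl. Qed.
Lemma scN t : sc (- t) = - sc t.
Proof. by rewrite /sc rmorphN scaleNr. Qed.
Lemma scB s t : sc (s - t) = sc s - sc t.
Proof. by rewrite scD scN. Qed.
Lemma sc0 : sc 0 = 0. Proof. by rewrite /sc scale0r. Qed.
Lemma sc1 : sc 1 = 1. Proof. by rewrite /sc scale1r. Qed.
Lemma mul_scl t x : sc t * x = t%:C *: x.
Proof. by rewrite /sc -cscaleAl mul1r. Qed.
Lemma mul_scr t x : x * sc t = t%:C *: x.
Proof. by rewrite /sc -cscaleAr mulr1. Qed.
Lemma scM s t : sc (s * t) = sc s * sc t.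
Proof. by rewrite mul_scl /sc scalerA rmorphM. Qed.
Lemma sc_comm t x : sc t * x = x * sc t.
Proof. by rewrite mul_scl mul_scr. Qed.
Lemma scaleZsc s t : s%:C *: sc t = sc (s * t).
Proof. by rewrite scM mul_scl. Qed.
Lemma adj_sc t : adj (sc t) = sc t.
Proof. by rewrite /sc adjZr adj_one. Qed.
Lemma nrm_sc t : nrm (sc t) <= `|t|.
Proof. by rewrite /sc nrmZr -[leRHS]mulr1 ler_wpM2l// nrm1_le1. Qed.

(** The geometric series: a solution of b = d + d b gives the right inverse 1 + b. *)
Lemma geometric_inverse (d : A) : nrm d < 1 ->
  exists b, (1 - d) * b = 1.
Proof.
move=> d1; have [|b bE] := @geometric_fixpoint _ _ d.
  by rewrite nrmE -[1]/(1%:C) ltcR.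
exists (1 + b); rewrite mulrDr mulr1 mulrBl mul1r {1}bE addrK.
by rewrite subrK.
Qed.

End CStarBasics.

(** * Positive elements of a C*-algebra *)

Section SquareRoot.
Context (R : realType) (A : cstarAlgType R).
Implicit Types (x y h k : A) (t : R).

Lemma subr_sqr_nc x y : x * x - y * y = x * (x - y) + (x - y) * y.
Proof. by rewrite mulrBr mulrBl addrA subrK. Qed.

(** The noncommutative counterpart of r^2 - s^2 = (r + s) (r - s); with it a quadratic recursion in
    A is majorized by the same recursion in R. *)
Lemma nrm_sqrB x y (r s e : R) : nrm x <= r -> nrm y <= s ->
  nrm (x - y) <= e -> nrm (x * x - y * y) <= (r + s) * e.
Proof.
move=> xr ys xye; rewrite subr_sqr_nc [leRHS]mulrDl.
apply: le_trans (nrmD _ _) _; apply: lerD.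
  by apply: le_trans (nrmM _ _) _; rewrite ler_pM ?nrm_ge0.
by apply: le_trans (nrmM _ _) _; rewrite mulrC ler_pM ?nrm_ge0.
Qed.

Local Notation half := ((2^-1 : R)%:C).

Lemma nrm_half x : nrm (half *: x) = nrm x / 2.
Proof. by rewrite nrmZr ger0_norm ?invr_ge0// mulrC. Qed.

Lemma half_addr x : half *: (x + x) = x.
Proof.
rewrite -[X in X + X]scale1r -scalerDl scalerA.
have -> : half * (1 + 1) = 1 :> R[i]; last by rewrite scale1r.
rewrite -(rmorph1 (@real_complex R)) -rmorphD -rmorphM.
by congr (_%:C); field.
Qed.

(* The scalar recursion r |-> (1 + r^2) / 2 increases to 1 and majorizes the
   one in A, which gives convergence up to and including the case nrm d = 1. *)
Lemma sqrt_fixpoint d : nrm d <= 1 -> exists y, [/\ nrm y <= 1,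
  y = half *: (d + y * y) &
  forall D : set A, nclosed D -> D 0 ->
    (forall x, D x -> D (half *: (d + x * x))) -> D y].
Proof.
move=> d1.
pose f y := half *: (d + y * y).
pose u n := iter n f 0.
pose g (r : R) := (1 + r * r) / 2.
pose r n := iter n g 0.
have r01 n : 0 <= r n <= 1.
  elim: n => [|n /andP[r0 r1]]; first by rewrite lexx ler01.
  rewrite /r iterS -/(r n) /g.
  have rr : r n * r n <= 1 * 1 by rewrite ler_pM.
  have rr0 : 0 <= r n * r n by rewrite mulr_ge0.
  by apply/andP; split; lra.
have rS n : r n <= r n.+1.
  have -> : r n.+1 = (1 + r n * r n) / 2 by [].
  rewrite -subr_ge0.
  have -> : (1 + r n * r n) / 2 - r n = (1 - r n) ^+ 2 / 2 by field.
  by rewrite divr_ge0// sqr_ge0.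
have ur n : nrm (u n) <= r n.
  elim: n => [|n IH]; first by rewrite nrm0.
  rewrite /u iterS -/(u n) /f nrm_half.
  have -> : r n.+1 = (1 + r n * r n) / 2 by [].
  rewrite ler_pM2r ?invr_gt0//.
  apply: le_trans (nrmD _ _) _; apply: lerD => //.
  by apply: le_trans (nrmM _ _) _; rewrite ler_pM ?nrm_ge0.
(* By [nrm_sqrB] the differences of [u] are dominated by those of [r]; telescoping then makes [u]
   Cauchy because [r] is bounded and increasing. *)
have uS n : nrm (u n.+1 - u n) <= r n.+1 - r n.
  elim: n => [|n IH]; first by rewrite !subr0.
  have -> : u n.+2 - u n.+1 = half *: (u n.+1 * u n.+1 - u n * u n).
    have -> : u n.+2 - u n.+1 = f (u n.+1) - f (u n) by [].
    by rewrite /f -scalerBr opprD addrACA subrr add0r.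
  rewrite nrm_half.
  have -> : r n.+2 - r n.+1 = (r n.+1 + r n) * (r n.+1 - r n) / 2.
    have -> : r n.+2 = (1 + r n.+1 * r n.+1) / 2 by [].
    have {3}-> : r n.+1 = (1 + r n * r n) / 2 by [].
    by field.
  by rewrite ler_pM2r ?invr_gt0// nrm_sqrB.
have uD n (k : nat) : nrm (u (n + k)%N - u n) <= r (n + k)%N - r n.
  elim: k => [|k IH]; first by rewrite addn0 !subrr nrm0.
  rewrite addnS; apply: le_trans (nrm_triangle (u (n + k)%N) _ _) _.
  by have := uS (n + k)%N; lra.
have uc : ncauchy u.
  have : cvgn r.
    apply: nondecreasing_is_cvgn.
      by apply/nondecreasing_seqP.
    by exists 1 => _ [n _ <-]; have /andP[] := r01 n.
  move=> /cvg_ex[l /cvgrPdist_lt rl] e e0.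
  have e4 : 0 < e / 4 by rewrite divr_gt0.
  have [N _ rN] := rl _ e4; exists N.
  have NM n : (N <= n)%N -> nrm (u n - u N) < e / 2.
    move=> Nn; rewrite -(subnKC Nn); apply: le_lt_trans (uD _ _) _.
    have /(_ n Nn) := rN; rewrite /= ltr_norml.
    have /(_ N) := rN; rewrite /= leqnn ltr_norml => /(_ isT).
    by rewrite (subnKC Nn) => /andP[? ?] /andP[? ?]; lra.
  move=> n m Nn Nm; apply: le_lt_trans (nrm_triangle (u N) _ _) _.
  by have := NM n Nn; have := NM m Nm; rewrite (nrmC (u N)); lra.
have [y uy] := ncauchy_ncvg uc.
have y1 : nrm y <= 1.
  apply/ler_addgt0Pl => e e0; have [N /(_ N (leqnn N))] := uy e e0.
  have := nrmB (u N) (u N - y); rewrite opprB addrC subrK.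
  by have := ur N; have /andP[] := r01 N; lra.
exists y; split => //; last first.
  (* [y] is a limit of iterates started at 0, so closed properties stable under the recursion pass
     to it. *)
  move=> D Dc D0 Df; apply: (nclosed_ncvg Dc _ uy).
  by elim=> [|n IH] //; exact: Df.
apply/eqP; rewrite -subr_eq0; apply/eqP/nrm_small_eq0 => e e0.
have e2 : 0 < e / 2 by rewrite divr_gt0.
have [N uN] := uy _ e2.
have -> : y - half *: (d + y * y) =
    (y - u N.+1) + half *: (u N * u N - y * y).
  have -> : half *: (u N * u N - y * y) = u N.+1 - half *: (d + y * y).
    rewrite [u N.+1]iterS -/(u N) /f -scalerBr; congr (_ *: _).
    by rewrite opprD addrACA subrr add0r.
  by rewrite subrKA.
apply: le_trans (nrmD _ _) _; rewrite nrm_half nrmC.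
have := uN N.+1 (leqnSn _).
have : nrm (u N * u N - y * y) <= (1 + 1) * (e / 2).
  apply: nrm_sqrB => //; last by rewrite ltW ?uN.
  by apply: le_trans (ur _) _; have /andP[] := r01 N.
by lra.
Qed.

End SquareRoot.

Section Positivity.
Context (R : realType) (A : cstarAlgType R).
Implicit Types (x y z h k p q s : A) (t : R).
Local Notation half := ((2^-1 : R)%:C).

Lemma nclosed_fix (f : A -> A) (K : R) :
  (forall x y, nrm (f x - f y) <= K * nrm (x - y)) -> nclosed [set x | f x = x].
Proof.
move=> fK l lD /=; apply/eqP; rewrite -subr_eq0; apply/eqP/nrm_small_eq0 => e e0.
have K1 : 0 < `|K| + 1 by rewrite ltr_wpDl.
have [|x /= fx lx] := lD (e / (`|K| + 1)); first by rewrite divr_gt0.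
have -> : f l - l = (f l - f x) + (x - l) by rewrite fx subrKA.
apply: le_trans (nrmD _ _) _; rewrite (nrmC x).
have := fK l x; have := ler_wpM2r (nrm_ge0 (l - x)) (ler_norm K).
move: lx; rewrite ltr_pdivlMr// mulrDr mulr1 mulrC => lx.
by lra.
Qed.

Lemma nclosed_sa : nclosed [set x : A | adj x = x].
Proof.
by apply: (@nclosed_fix _ 1) => x y; rewrite -adjB nrm_adj mul1r.
Qed.

Lemma nclosed_comm x : nclosed [set y | x * y = y * x].
Proof.
move=> l lD /=; apply/eqP; rewrite -subr_eq0; apply/eqP/nrm_small_eq0 => e e0.
have K1 : 0 < nrm x * 2 + 1 by rewrite ltr_wpDl// mulr_ge0 ?nrm_ge0.
have [|y /= xy ly] := lD (e / (nrm x * 2 + 1)); first by rewrite divr_gt0.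
have -> : x * l - l * x = x * (l - y) - (l - y) * x.
  by rewrite mulrBr mulrBl xy opprB addrA subrK.
apply: le_trans (nrmB _ _) _.
have := nrmM x (l - y); have := nrmM (l - y) x.
move: ly; rewrite ltr_pdivlMr// mulrDr mulr1 (mulrC (nrm x)) mulrA.
by have := nrm_ge0 (l - y); lra.
Qed.

(** Positivity without spectra: for self-adjoint h the inequality places the spectrum in [0, 2t]. In
    this form it is visibly stable under sums and means the same in a subalgebra as in the whole
    algebra. *)
Definition pos h := adj h = h /\ exists t, nrm (sc A t - h) <= t.

Lemma pos_adj h : pos h -> adj h = h. Proof. by case. Qed.

Lemma pos_sc t : 0 <= t -> pos (sc A t).
Proof.
by move=> t0; split; [exact: adj_sc|exists t; rewrite subrr nrm0].
Qed.

Lemma pos0 : pos (0 : A). Proof. by rewrite -(sc0 A); apply: pos_sc. Qed.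
Lemma posD h k : pos h -> pos k -> pos (h + k).
Proof.
move=> [ha [s hs]] [ka [t kt]]; split; first by rewrite adjD ha ka.
exists (s + t); rewrite scD opprD addrACA.
by apply: le_trans (nrmD _ _) _; exact: lerD.
Qed.

Lemma posZ t h : 0 <= t -> pos h -> pos (t%:C *: h).
Proof.
move=> t0 [ha [s hs]]; split; first by rewrite adjZr ha.
exists (t * s); rewrite -scaleZsc -scalerBr nrmZr ger0_norm//.
by rewrite ler_wpM2l.
Qed.

Lemma pos_scB t x : adj x = x -> nrm x <= t -> pos (sc A t - x).
Proof.
move=> xa xt; split; first by rewrite adjB adj_sc xa.
by exists t; rewrite opprB addrC subrK.
Qed.

Lemma pos_scD t x : adj x = x -> nrm x <= t -> pos (sc A t + x).
Proof. by move=> xa xt; rewrite -[x]opprK; apply: pos_scB; rewrite ?adjN ?xa ?nrmN. Qed.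

Lemma fixD y z : y = half *: z -> y + y = z.
Proof. by move=> ->; rewrite -scalerDr half_addr. Qed.

(** With d = 1 - h/t, the fixed point y = (d + y^2)/2 satisfies (1 - y)^2 = h/t, so the root is 1 -
    y times the square root of t. The last two conjuncts replace functional calculus: the root
    commutes with whatever commutes with h, and it stays in every closed subspace that contains 1
    and h and is stable under squares. *)
Lemma pos_sqrt h : pos h -> exists s, [/\ pos s, s * s = h,
  (forall x, x * h = h * x -> x * s = s * x) &
  (forall D : set A, nclosed D -> D 1 -> (forall a x, D x -> D (a *: x)) ->
    (forall x y, D x -> D y -> D (x + y)) -> (forall x, D x -> D (x * x)) ->
    D h -> D s)].
Proof.
move=> [ha [t ht]]; have t0 : 0 <= t := le_trans (nrm_ge0 _) ht.
move: (t0); rewrite le_eqVlt => /orP[/eqP t0E|{}t0].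
  have h0 : h = 0.
    apply/nrm0_eq0/eqP; rewrite eq_le nrm_ge0 andbT.
    by move: ht; rewrite -t0E sc0 sub0r nrmN.
  exists 0; rewrite h0; split; [exact: pos0|exact: mulr0| |by []].
  by move=> x; rewrite mulr0 mul0r.
pose d := 1 - (t^-1)%:C *: h.
have dE : d = (t^-1)%:C *: (sc A t - h).
  by rewrite scalerBr scaleZsc mulVf ?gt_eqF// sc1.
have d1 : nrm d <= 1.
  rewrite dE nrmZr ger0_norm ?invr_ge0 1?(ltW t0)//.
  by rewrite mulrC ler_pdivrMr ?mul1r.
have [y [y1 yE yD]] := sqrt_fixpoint d1.
have sqr : (1 - y) * (1 - y) = (t^-1)%:C *: h.
  rewrite mulrBr mulr1 mulrBl mul1r opprB addrA addrAC -(addrA 1) -opprD.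
  by rewrite {1}(fixD yE) opprD addrA subrK /d opprB addrC subrK.
exists ((Num.sqrt t)%:C *: (1 - y)); split.
- split.
    rewrite adjZr adjB adj_one; congr (_ *: (_ - _)).
    apply: (yD [set x | adj x = x]); first exact: nclosed_sa.
      exact: adj0.
    by move=> x /= xa; rewrite adjZr adjD cadjM xa dE adjZr adjB adj_sc ha.
  exists (Num.sqrt t); rewrite scalerBr opprB addrC subrK.
  rewrite nrmZr ger0_norm ?sqrtr_ge0// -[leRHS]mulr1 ler_wpM2l ?sqrtr_ge0//.
- rewrite -cscaleAl -cscaleAr sqr !scalerA -!rmorphM -expr2 sqr_sqrtr ?ltW//.
  by rewrite mulfV ?gt_eqF// scale1r.
- move=> x xh; rewrite -cscaleAl -cscaleAr mulrBr mulrBl mulr1 mul1r.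
  congr (_ *: (_ - _)).
  apply: (yD [set y | x * y = y * x]); first exact: nclosed_comm.
    by rewrite /= mulr0 mul0r.
  move=> z /= xz; rewrite -cscaleAl -cscaleAr mulrDr mulrDl.
  rewrite mulrA xz -mulrA xz mulrA; congr (_ *: (_ + _)).
  by rewrite /d mulrBr mulrBl -cscaleAl -cscaleAr xh mulr1 mul1r.
- move=> D Dc D1 DZ DD DM Dh.
  have DB x z : D x -> D z -> D (x - z).
    by move=> Dx Dz; apply: DD => //; rewrite -scaleN1r; exact: DZ.
  apply: (DZ); apply: (DB) => //; apply: yD => //.
    by rewrite -(subrr (1 : A)); exact: DB.
  by move=> x Dx; apply/DZ/DD; [apply/DB/DZ|exact: DM].
Qed.
End Positivity.

(** * Positivity of squares and of [adj a * a] *)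

Section Positivity2.
Context (R : realType) (A : cstarAlgType R).
Implicit Types (x y z h k p q s : A) (t : R).
Local Notation half := ((2^-1 : R)%:C).
Local Notation ii := ('i%C : R[i]).

Lemma conjc_ii : ii^*%C = - ii.
Proof. by apply/eqP; rewrite eq_complex /= oppr0 !eqxx. Qed.

Lemma scaleii x : ii *: (ii *: x) = - x.
Proof. by rewrite scalerA -expr2 sqr_i scaleN1r. Qed.

(** As h and s commute, h^2 + s^2 is [adj u * u] for u = h + i s, and h is the real part of u. *)
Lemma nrm_sa_sqr h s : adj h = h -> adj s = s -> h * s = s * h ->
  nrm h ^+ 2 <= nrm (h * h + s * s).
Proof.
move=> ha sa hs; pose u := h + ii *: s.
have uE : adj u = h - ii *: s.
  by rewrite adjD adjZ ha sa conjc_ii scaleNr.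
have <- : adj u * u = h * h + s * s.
  rewrite uE mulrDr !mulrBl -!cscaleAr -!cscaleAl -hs scaleii opprK.
  by rewrite -addrA; congr (_ + _); rewrite addrA addNr add0r.
rewrite nrm_adjM lerXn2r ?nnegrE ?nrm_ge0//.
have -> : h = half *: (u + adj u) by rewrite uE addrACA subrr addr0 half_addr.
by rewrite nrm_half ler_pdivrMr// (le_trans (nrmD _ _))// nrm_adj; lra.
Qed.

(** Apply [nrm_sa_sqr] to the root s of 1 - h^2: since s^2 + h^2 = 1, the norm of s is at most 1. *)
Lemma nrm_sqr_le1 h : adj h = h -> nrm h <= 1 -> nrm (1 - h * h) <= 1.
Proof.
move=> ha h1.
have p : pos (1 - h * h).
  rewrite -(sc1 A); apply: pos_scB; first by rewrite cadjM ha.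
  by apply: le_trans (nrmM _ _) _; rewrite -(mulr1 1) ler_pM ?nrm_ge0.
have [s [ps sE sc _]] := pos_sqrt p.
rewrite -sE; apply: le_trans (nrmM _ _) _; rewrite -expr2.
have hs : s * h = h * s by rewrite sc// mulrBr mulrBl mulr1 mul1r mulrA.
apply: le_trans (nrm_sa_sqr (pos_adj ps) ha hs) _.
by rewrite sE subrK nrm1_le1.
Qed.

(** Once h is scaled into the unit ball, [nrm_sqr_le1] is the definition of positivity with t = 1.
    The scale [nrm h + 1] is never 0. *)
Lemma pos_sqr h : adj h = h -> pos (h * h).
Proof.
move=> ha; pose t := nrm h + 1.
have t0 : 0 < t by rewrite ltr_wpDl ?nrm_ge0.
pose k := (t^-1)%:C *: h.
have hk : h * h = (t * t)%:C *: (k * k).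
  rewrite /k -cscaleAl -cscaleAr !scalerA -!rmorphM.
  have -> : t * t * t^-1 * t^-1 = 1 by field; rewrite gt_eqF.
  by rewrite scale1r.
have ka : adj k = k by rewrite adjZr ha.
rewrite hk; apply: posZ; first by rewrite mulr_ge0 ?ltW.
split; first by rewrite cadjM ka.
exists 1; rewrite sc1; apply: nrm_sqr_le1 => //.
rewrite nrmZr ger0_norm ?invr_ge0 1?(ltW t0)// mulrC ler_pdivrMr// mul1r.
by rewrite lerDl.
Qed.

Lemma pos_mul h k : pos h -> pos k -> h * k = k * h -> pos (h * k).
Proof.
move=> ph pk hk.
have [s [ps sE sC _]] := pos_sqrt ph; have [r [pr rE rC _]] := pos_sqrt pk.
have sr : s * r = r * s by apply: (rC); rewrite sC.
have -> : h * k = (s * r) * (s * r).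
  by rewrite -sE -rE -!mulrA; congr (_ * _); rewrite !mulrA sr.
by apply: pos_sqr; rewrite cadjM !pos_adj.
Qed.

(** With roots u of q and v of t - q, [nrm_sa_sqr] bounds the squared norm of u by the norm of u^2 +
    v^2 = t. *)
Lemma pos_le_nrm q t : 0 <= t -> pos q -> pos (sc A t - q) -> nrm q <= t.
Proof.
move=> t0 pq ptq.
have [u [pu uE uC _]] := pos_sqrt pq; have [v [pv vE vC _]] := pos_sqrt ptq.
have uv : u * v = v * u.
  by apply: (vC); rewrite mulrBr mulrBl sc_comm -uE mulrA.
have := nrm_sa_sqr (pos_adj pu) (pos_adj pv) uv.
rewrite uE vE addrC subrK => nu; rewrite -uE.
apply: le_trans (nrmM _ _) _; rewrite -expr2; apply: le_trans nu _.
by apply: le_trans (nrm_sc _ _) _; rewrite ger0_norm.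
Qed.

Lemma sa_inverse p z : adj p = p -> p * z = 1 -> z * p = 1 /\ adj z = z.
Proof.
move=> pa pz; have zp : adj z * p = 1 by rewrite -{1}pa -cadjM pz adj_one.
suff zE : adj z = z by rewrite -{1}zE.
by rewrite -[LHS]mulr1 -pz mulrA zp mul1r.
Qed.

Lemma pos_inverse p t : pos p -> 0 < t -> exists z, (sc A t + p) * z = 1.
Proof.
move=> [pa [s ps]] t0; have s0 : 0 <= s := le_trans (nrm_ge0 _) ps.
have st : 0 < s + t by rewrite ltr_wpDl.
have [|b] := @geometric_inverse _ _ (((s + t)^-1)%:C *: (sc A s - p)).
  rewrite nrmZr ger0_norm ?invr_ge0 1?(ltW st)// mulrC ltr_pdivrMr// mul1r.
  by apply: le_lt_trans ps _; rewrite ltrDl.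
have -> : 1 - ((s + t)^-1)%:C *: (sc A s - p) =
    ((s + t)^-1)%:C *: (sc A t + p).
  have {1}-> : 1 = ((s + t)^-1)%:C *: sc A (s + t).
    by rewrite scaleZsc mulVf ?sc1// gt_eqF.
  rewrite -scalerBr scD; congr (_ *: _).
  by rewrite opprB addrC addrA subrK addrC.
by rewrite -cscaleAl cscaleAr => bE; exists (((s + t)^-1)%:C *: b).
Qed.

(** An invertible positive p is bounded below: p - t = p (1 - t z) is a product of commuting
    positive elements as soon as t times the norm of z is at most 1. *)
Lemma pos_inv_ge p z : pos p -> p * z = 1 ->
  exists2 t, 0 < t & pos (p - sc A t).
Proof.
move=> pp pz; have [zp za] := sa_inverse (pos_adj pp) pz.
have n0 : 0 < nrm z + 1 by rewrite ltr_wpDl ?nrm_ge0.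
exists (nrm z + 1)^-1; first by rewrite invr_gt0.
have -> : p - sc A (nrm z + 1)^-1 = p * (sc A 1 - ((nrm z + 1)^-1)%:C *: z).
  by rewrite mulrBr sc1 mulr1 -cscaleAr pz.
apply: pos_mul => //.
  apply: pos_scB; first by rewrite adjZr za.
  rewrite nrmZr ger0_norm ?invr_ge0 1?(ltW n0)// mulrC ler_pdivrMr// mul1r.
  by rewrite lerDl.
by rewrite mulrBr mulrBl sc_comm -(cscaleAr _ p z) -(cscaleAl _ z p) zp pz.
Qed.

(** The norm of q is a spectral value: if [nrm q] minus q were invertible it would dominate some t >
    0, and the norm of q would drop below itself. *)
Lemma nrm_spectrum q z : pos q -> nrm q != 0 -> (sc A (nrm q) - q) * z <> 1.
Proof.
move=> pq q0 qz.
have pq' : pos (sc A (nrm q) - q) by apply: pos_scB => //; exact: pos_adj.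
have [t t0 pt] := pos_inv_ge pq' qz.
have n0 : 0 < nrm q by rewrite lt_neqAle eq_sym q0 nrm_ge0.
(* The minimum keeps [nrm q - s] nonnegative, as [pos_le_nrm] requires. *)
pose s := Num.min t (nrm q).
have : nrm q <= nrm q - s.
  apply: pos_le_nrm => //; first by rewrite subr_ge0 ge_min lexx orbT.
  have -> : sc A (nrm q - s) - q = (sc A (nrm q) - q - sc A t) + sc A (t - s).
    by rewrite !scB addrA subrK addrAC.
  by apply: posD => //; apply: pos_sc; rewrite subr_ge0 ge_min lexx.
by rewrite lerBrDr gerDl leNgt lt_min t0 n0.
Qed.

(** For y = [adj x], the elements h and g are up to sign the real and imaginary parts of x, so
    [x * adj x + adj x * x] is twice a sum of two self-adjoint squares. *)
Lemma sqr_re_im x y (h := half *: (x + y)) (g := half *: (ii *: (x - y))) :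
  h * h + g * g = half *: (x * y + y * x).
Proof.
rewrite /h /g; set w := ii *: (x - y).
have ww : w * w = - ((x - y) * (x - y)).
  by rewrite -cscaleAl -cscaleAr scaleii.
rewrite -!(cscaleAl half) -!(cscaleAr half) ww !scalerN -!scalerBr.
congr (_ *: _).
have -> : (x + y) * (x + y) - (x - y) * (x - y) = x * (y + y) + y * (x + x).
  have {1}-> : y + y = (x + y) - (x - y).
    by rewrite opprD opprK addrACA subrr add0r.
  have -> : x + x = (x + y) + (x - y) by rewrite addrACA subrr addr0.
  set p := x + y; set m := x - y.
  have -> : p * p = x * p + y * p by rewrite -mulrDl.
  have -> : m * m = x * m - y * m by rewrite -mulrBl.
  by clearbody p m; rewrite mulrBr mulrDr opprD opprK addrACA.
by rewrite !mulrDr addrACA half_addr.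
Qed.

(* Fukamiya-Kaplansky: if x_- is the negative part of x = a^* a and b = a x_-,
   then - b^* b is a square k^2 while b b^* is a sum of squares; as b^* b and
   b b^* have the same nonzero spectrum, k = 0. *)
Lemma negative_star b k : adj k = k -> adj b * b = - (k * k) -> b = 0.
Proof.
move=> ka bE; have pk := pos_sqr ka.
pose h := half *: (b + adj b); pose g := half *: (ii *: (b - adj b)).
have ha : adj h = h by rewrite adjZr adjD adjK addrC.
have ga : adj g = g.
  by rewrite adjZr adjZ conjc_ii adjB adjK scaleNr -scalerN opprB.
have pbb : pos (b * adj b).
  have := fixD (sqr_re_im b (adj b)); rewrite -/h -/g bE => hgE.
  rewrite -[b * adj b](subrK (k * k)) -hgE.
  by do !apply: posD => //; exact: pos_sqr.
apply/nrm0_eq0/eqP; rewrite -sqrf_eq0 -nrm_adjM bE nrmN; apply/negPn/negP => n0.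
have := nrm_ge0 (k * k); rewrite le_eqVlt eq_sym (negPf n0)/= => {}n0'.
have [z zE] := pos_inverse pbb n0'.
(* With c the norm of k^2 and z an inverse of [c + b * adj b], the product of [c + adj b * b] and
   [1 - adj b * z * b] is c. Thus c - k^2 has an inverse, which [nrm_spectrum] forbids. *)
apply: (@nrm_spectrum (k * k)
  (((nrm (k * k))^-1)%:C *: (1 - adj b * z * b))) => //.
rewrite -[- (k * k)]bE -cscaleAr.
have -> : (sc A (nrm (k * k)) + adj b * b) * (1 - adj b * z * b) =
    sc A (nrm (k * k)).
  set c := sc A _.
  have -> : (c + adj b * b) * (1 - adj b * z * b) =
      c + adj b * b - adj b * ((c + b * adj b) * z) * b.
    rewrite mulrBr mulr1; congr (_ - _).
    by rewrite [in RHS]mulrDl [in RHS]mulrDr [in RHS]mulrDl mulrDl !mulrA sc_comm.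
  by rewrite zE mulr1 addrK.
by rewrite scaleZsc mulVf// sc1.
Qed.

(** With x = [adj a * a] and k the root of x^2, m = k - x is twice the negative part of x. Since x m
    = - k m, the element b = a m satisfies [adj b * b] = - (r m)^2 where r^2 = k, so b = 0 by
    [negative_star]; then x m, k m and finally m^2 vanish. *)
Lemma star_pos (a : A) : pos (adj a * a).
Proof.
pose x := adj a * a.
have xa : adj x = x by rewrite cadjM adjK.
have [k [pk kE kC _]] := pos_sqrt (pos_sqr xa).
have xk : x * k = k * x by rewrite kC// mulrA.
have [r [pr rE rC _]] := pos_sqrt pk.
pose m := k - x.
have ma : adj m = m by rewrite adjB xa pos_adj.
have xm : x * m = - (k * m) by rewrite !mulrBr kE xk opprB.
have rm : r * m = m * r.
  by rewrite /m mulrBr mulrBl (rC x)//; congr (_ - _); rewrite -rE mulrA.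
have am0 : a * m = 0.
  apply: (@negative_star _ (r * m)); first by rewrite cadjM ma pos_adj.
  rewrite cadjM ma mulrA -(mulrA m) -/x -mulrA xm.
  by rewrite mulrN -rE; congr (- _); rewrite {1}rm -!mulrA.
have km0 : k * m = 0 by apply: oppr_inj; rewrite -xm /x -mulrA am0 mulr0 oppr0.
have mm0 : adj m * m = 0 by rewrite ma {1}/m mulrBl km0 xm km0 oppr0 subrr.
suff m0 : m = 0 by rewrite -/x; move/eqP: m0; rewrite subr_eq0 => /eqP<-.
by apply/nrm0_eq0/eqP; rewrite -sqrf_eq0 -nrm_adjM mm0 nrm0.
Qed.

Lemma pos_conj b h : pos h -> pos (adj b * h * b).
Proof.
move=> /pos_sqrt[s [ps <- _ _]].
have -> : adj b * (s * s) * b = adj (s * b) * (s * b).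
  by rewrite cadjM (pos_adj ps) !mulrA.
exact: star_pos.
Qed.

(** The operator inequality behind the boundedness of the GNS action of a. *)
Lemma pos_nrm_adjM (a x : A) :
  pos ((nrm a ^+ 2)%:C *: (adj x * x) - adj (a * x) * (a * x)).
Proof.
have -> : (nrm a ^+ 2)%:C *: (adj x * x) - adj (a * x) * (a * x) =
    adj x * (sc A (nrm a ^+ 2) - adj a * a) * x.
  by rewrite cadjM mulrBr mulrBl mul_scr -cscaleAl !mulrA.
by apply/pos_conj/pos_scB; rewrite ?nrm_adjM// cadjM adjK.
Qed.

End Positivity2.

(** * States and characters from maximal cones *)

(** Zorn's lemma is applied to the sets X for which the union of [A0] and X satisfies P. The empty
    chain is then covered by [P A0], so chains in the hypothesis may be assumed nonempty, and the
    maximal set contains [A0]. *)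
Lemma Zorn_above (T : Type) (P : set (set T)) (A0 : set T) : P A0 ->
  (forall F : set (set T), F !=set0 -> F `<=` P -> total_on F subset ->
    P (\bigcup_(X in F) X)) ->
  exists A, [/\ P A, A0 `<=` A & forall B, P B -> A `<=` B -> B `<=` A].
Proof.
move=> PA0 PU; have [F FP Ftot|A [PA Amax]] := @Zorn_bigcup T [set X | P (A0 `|` X)].
  have [->|F0] := eqVneq F set0; first by rewrite /= bigcup_set0 setU0.
  have -> : [set X | P (A0 `|` X)] (\bigcup_(X in F) X) =
      P (\bigcup_(X in [set A0 `|` X | X in F]) X).
    rewrite /=; congr P; apply/seteqP; split=> x.
      move=> [A0x|[X FX Xx]]; last by exists (A0 `|` X); [exists X|right].
      by have /set0P[X FX] := F0; exists (A0 `|` X); [exists X|left].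
    by move=> [_ [X FX <-] [A0x|Xx]]; [left|right; exists X].
  apply: PU.
  - by have /set0P[X FX] := F0; exists (A0 `|` X), X.
  - by move=> _ [X FX <-]; exact: FP.
  - move=> _ _ [X FX <-] [Y FY <-].
    by have [XY|YX] := Ftot X Y FX FY; [left|right]; exact: setUS.
exists (A0 `|` A); split=> // B PB AB x Bx.
right; apply: contrapT => nAx; apply: (Amax B).
  split; last by move=> /(_ _ Bx).
  by move=> y Ay; apply: AB; right.
rewrite /=; have -> : A0 `|` B = B; last by [].
by apply/setUidPr => y A0y; apply: AB; left.
Qed.

Section Cone.
Context (R : realType) (A : cstarAlgType R).
Implicit Types (x y z p q s : A) (t : R).
Local Notation half := ((2^-1 : R)%:C).
Local Notation ii := ('i%C : R[i]).

(** The scalars allowed to act on a cone. Nonnegative reals lead to states; all positive elements of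
    a commutative algebra lead to characters. *)
Definition multipliers (S : set A) := [/\ S `<=` @pos R A,
  forall t, 0 <= t -> S (sc A t),
  forall s s', S s -> S s' -> S (s + s'),
  forall s s', S s -> S s' -> S (s * s') &
  forall s x, S s -> s * x = x * s].

Lemma nneg_multipliers : multipliers [set sc A t | t in [set t : R | 0 <= t]].
Proof.
split.
- by move=> _ [t t0 <-]; exact: pos_sc.
- by move=> t t0; exists t.
- by move=> _ _ [t t0 <-] [t' t0' <-]; exists (t + t'); rewrite ?scD//= addr_ge0.
- by move=> _ _ [t t0 <-] [t' t0' <-]; exists (t * t'); rewrite ?scM//= mulr_ge0.
- by move=> _ x [t _ <-]; exact: sc_comm.
Qed.

Lemma pos_multipliers : commutative (@GRing.mul A) -> multipliers (@pos R A).
Proof.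
move=> AC; split; [by []|exact: pos_sc|exact: posD| |by move=> s x _].
by move=> s s' ps ps'; exact: pos_mul.
Qed.

Definition cone (S Q : set A) := [/\ forall x, Q x -> adj x = x,
  forall x y, Q x -> Q y -> Q (x + y),
  forall s x, S s -> Q x -> Q (s * x) & ~ Q (- 1)].

Context (S : set A) (S_mult : multipliers S).
Let S_pos : S `<=` @pos R A. Proof. by case: S_mult. Qed.
Let S_sc t : 0 <= t -> S (sc A t). Proof. by case: S_mult => _ + _ _ _; apply. Qed.
Let S_add s s' : S s -> S s' -> S (s + s').
Proof. by case: S_mult => _ _ + _ _; apply. Qed.
Let S_mul s s' : S s -> S s' -> S (s * s').
Proof. by case: S_mult => _ _ _ + _; apply. Qed.
Let S_central s x : S s -> s * x = x * s.
Proof. by case: S_mult => _ _ _ _; apply. Qed.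

(** If neither x nor -x is in Q, maximality puts -1 in both enlarged cones: -1 = q + s x = q' - s'
    x. Eliminating x gives -(s + s') = s' q + s q' in Q, hence -s is in Q. Then s x = s (nrm x + x)
    + nrm x (-s) is in Q, and so is -1. *)
Lemma maximal_cone_total (Q : set A) : cone S Q -> @pos R A `<=` Q ->
  (forall Q', cone S Q' -> Q `<=` Q' -> Q' `<=` Q) ->
  forall x, adj x = x -> Q x \/ Q (- x).
Proof.
move=> [Qa Qadd Qmul Qn1] Qpos Qmax.
have ext x : adj x = x -> ~ Q x ->
    exists q s, [/\ Q q, S s & -1 = q + s * x].
  move=> xa nQx; apply: contrapT => nex; apply: nQx.
  pose Q' := [set y | exists q s, [/\ Q q, S s & y = q + s * x]].
  have Q0 : Q 0 by apply/Qpos/pos0.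
  have QQ' : Q `<=` Q'.
    move=> y Qy; exists y, 0; split=> //; last by rewrite mul0r addr0.
    by rewrite -(sc0 A); apply: S_sc.
  apply: (Qmax Q') => //; last first.
    exists 0, 1; split=> //; last by rewrite mul1r add0r.
    by rewrite -(sc1 A); apply: S_sc.
  split.
  - move=> _ [q [s [Qq Ss ->]]].
    by rewrite adjD Qa// cadjM xa (pos_adj (S_pos Ss)) -(S_central _ Ss).
  - move=> _ _ [q [s [Qq Ss ->]]] [q' [s' [Qq' Ss' ->]]].
    exists (q + q'), (s + s'); rewrite mulrDl addrACA; split=> //.
      exact: Qadd.
    exact: S_add.
  - move=> s _ Ss [q' [s' [Qq' Ss' ->]]].
    exists (s * q'), (s * s'); rewrite mulrDr mulrA; split=> //.
      exact: Qmul.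
    exact: S_mul.
  - by move=> [q [s [Qq Ss e]]]; apply: nex; exists q, s.
move=> x xa; apply: contrapT => /not_orP[nx nNx].
have [q [s [Qq Ss e]]] := ext x xa nx.
have [|q' [s' [Qq' Ss' e']]] := ext (- x) _ nNx; first by rewrite adjN xa.
have Qss : Q (- (s + s')).
  have -> : - (s + s') = s' * q + s * q'.
    have -> : q = - 1 - s * x by rewrite e addrK.
    have -> : q' = - 1 + s' * x by rewrite e' -addrA mulrN addNr addr0.
    rewrite !mulrDr !mulrN !mulr1 !mulrA (S_central s' Ss).
    by rewrite addrACA addNr addr0 opprD addrC.
  by apply: (Qadd); exact: Qmul.
have QNs : Q (- s).
  have -> : - s = - (s + s') + s' by rewrite opprD subrK.
  by apply: (Qadd) => //; apply/Qpos/S_pos.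
apply: Qn1; rewrite e; apply: (Qadd) => //.
have -> : s * x = s * (sc A (nrm x) + x) + sc A (nrm x) * (- s).
  by rewrite mulrDr sc_comm mulNr addrAC subrr add0r.
apply: (Qadd); apply: (Qmul) => //; first exact/Qpos/pos_scD.
by apply: S_sc; exact: nrm_ge0.
Qed.

Section MaximalCone.
Context (Q : set A).
Hypotheses (coneQ : cone S Q) (posQ : @pos R A `<=` Q)
  (totQ : forall x, adj x = x -> Q x \/ Q (- x)).

Let Qa x : Q x -> adj x = x. Proof. by case: coneQ => + _ _ _; apply. Qed.
Let Qadd x y : Q x -> Q y -> Q (x + y). Proof. by case: coneQ => _ + _ _; apply. Qed.
Let Qmul s x : S s -> Q x -> Q (s * x). Proof. by case: coneQ => _ _ + _; apply. Qed.
Let Qn1 : ~ Q (- 1). Proof. by case: coneQ. Qed.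

Let Qscale t x : 0 <= t -> Q x -> Q (t%:C *: x).
Proof. by move=> t0 Qx; rewrite -mul_scl; apply/Qmul => //; exact: S_sc. Qed.

Let Qsc t : Q (sc A t) -> 0 <= t.
Proof.
move=> Qt; rewrite leNgt; apply/negP => t0; apply: Qn1.
have -> : - 1 = (- t^-1)%:C *: sc A t.
  by rewrite scaleZsc mulNr mulVf ?lt_eqF// scN sc1.
by apply: Qscale => //; rewrite oppr_ge0 invr_le0 ltW.
Qed.

(** The cut that x makes in the real scalars for the order of Q. As that order is total on
    self-adjoint elements and -1 is not in Q, it singles out one real number. *)
Definition cone_val x : R := sup [set t | Q (x - sc A t)].
Local Notation r := cone_val.

Let has_sup_val x : adj x = x -> has_sup [set t | Q (x - sc A t)].
Proof.
move=> xa; split.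
  exists (- nrm x); rewrite /= scN opprK addrC.
  by apply/posQ/pos_scD.
exists (nrm x) => t /= Qt; rewrite -subr_ge0; apply: Qsc.
rewrite scB -(subrKA x); apply: (Qadd) => //.
by apply/posQ/pos_scB.
Qed.

Let val_ge x t : adj x = x -> Q (x - sc A t) -> t <= r x.
Proof. by move=> /has_sup_val[_ h] Qt; apply: ub_le_sup. Qed.

Let val_lt x t : adj x = x -> t < r x -> Q (x - sc A t).
Proof.
move=> xa tx; have [t' /= Qt' tt'] := sup_gt (has_sup_val xa).1 tx.
have -> : x - sc A t = (x - sc A t') + sc A (t' - t) by rewrite scB addrA subrK.
by apply: (Qadd) => //; apply/posQ/pos_sc; rewrite subr_ge0 ltW.
Qed.

Let val_le x t : adj x = x -> Q (sc A t - x) -> r x <= t.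
Proof.
move=> xa Qt; rewrite leNgt; apply/negP => /midf_lt[t1 t2].
have := Qadd Qt (val_lt xa t2); rewrite subrKA -scB => /Qsc.
by rewrite subr_ge0 leNgt t1.
Qed.

Let val_gt x t : adj x = x -> r x < t -> Q (sc A t - x).
Proof.
move=> xa xt; have [|Qx|] := totQ (x := x - sc A t); first by rewrite adjB adj_sc xa.
  by have := val_ge xa Qx; rewrite leNgt xt.
by rewrite opprB.
Qed.

Let val_eqP x t : adj x = x -> (forall e, 0 < e -> Q (x - sc A (t - e))) ->
  (forall e, 0 < e -> Q (sc A (t + e) - x)) -> r x = t.
Proof.
move=> xa xl xg; apply/eqP; rewrite eq_le; apply/andP; split.
  by apply/ler_addgt0Pl => e e0; rewrite addrC; apply: val_le => //; exact: xg.
apply/ler_addgt0Pl => e e0; rewrite -lerBlDl; apply: val_ge => //.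
exact: xl.
Qed.

Lemma cone_val_ge0 x : Q x -> 0 <= r x.
Proof. by move=> Qx; apply: val_ge; rewrite ?sc0 ?subr0//; exact: Qa. Qed.

Lemma cone_val_sc t : r (sc A t) = t.
Proof.
apply: val_eqP => [|e e0|e e0]; first exact: adj_sc.
  by rewrite scB opprB addrCA subrr addr0; apply/posQ/pos_sc/ltW.
by rewrite scD addrAC subrr add0r; apply/posQ/pos_sc/ltW.
Qed.

Lemma cone_valD x y : adj x = x -> adj y = y -> r (x + y) = r x + r y.
Proof.
move=> xa ya; apply: val_eqP => [|e e0|e e0]; first by rewrite adjD xa ya.
  have -> : x + y - sc A (r x + r y - e) =
      (x - sc A (r x - e / 2)) + (y - sc A (r y - e / 2)).
    by rewrite addrACA -opprD -scD; congr (_ - sc A _); field.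
  by apply: (Qadd); apply: val_lt => //; rewrite gtrDl oppr_lt0 divr_gt0.
have -> : sc A (r x + r y + e) - (x + y) =
    (sc A (r x + e / 2) - x) + (sc A (r y + e / 2) - y).
  by rewrite addrACA -opprD -scD; congr (sc A _ - _); field.
by apply: (Qadd); apply: val_gt => //; rewrite ltrDl divr_gt0.
Qed.

Lemma cone_valN x : adj x = x -> r (- x) = - r x.
Proof.
move=> xa; apply/eqP; rewrite -addr_eq0 -cone_valD ?adjN ?xa//.
by rewrite addNr -(sc0 A) cone_val_sc.
Qed.

Let valZ_ge0 t x : 0 <= t -> adj x = x -> r (t%:C *: x) = t * r x.
Proof.
move=> t0 xa; move: (t0); rewrite le_eqVlt => /orP[/eqP<-|t1].
  by rewrite scale0r mul0r -(sc0 A) cone_val_sc.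
apply: val_eqP => [|e e0|e e0]; first by rewrite adjZr xa.
  have -> : t%:C *: x - sc A (t * r x - e) = t%:C *: (x - sc A (r x - e / t)).
    rewrite scalerBr scaleZsc; congr (_ - sc A _); field.
    by rewrite gt_eqF.
  by apply: Qscale => //; apply: val_lt => //; rewrite gtrDl oppr_lt0 divr_gt0.
have -> : sc A (t * r x + e) - t%:C *: x = t%:C *: (sc A (r x + e / t) - x).
  by rewrite scalerBr scaleZsc; congr (sc A _ - _); field; rewrite gt_eqF.
by apply: Qscale => //; apply: val_gt => //; rewrite ltrDl divr_gt0.
Qed.

Lemma cone_valZ t x : adj x = x -> r (t%:C *: x) = t * r x.
Proof.
move=> xa; have [|/ltW t0] := leP 0 t; first by move=> /valZ_ge0->.
rewrite -[t]opprK rmorphN scaleNr cone_valN ?adjZr ?xa//.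
by rewrite valZ_ge0 ?oppr_ge0// !mulNr.
Qed.

(** For t below the value of x, s (x - t) is in Q, so t times the value of s is at most the value of
    s x; the other inequality is dual. *)
Lemma cone_valM s x : S s -> adj x = x -> r (s * x) = r s * r x.
Proof.
move=> Ss xa; have sa := pos_adj (S_pos Ss).
have sxa : adj (s * x) = s * x by rewrite cadjM xa sa -(S_central _ Ss).
have rs0 : 0 <= r s by apply/cone_val_ge0/posQ/S_pos.
have valB y y' : adj y = y -> adj y' = y' -> Q (y - y') -> r y' <= r y.
  move=> ya ya' /cone_val_ge0; rewrite cone_valD ?adjN ?ya'// cone_valN//.
  by rewrite subr_ge0.
apply/eqP; rewrite eq_le; apply/andP; split; apply/ler_addgt0Pl => e e0;
  have d0 : 0 < e / (r s + 1) by rewrite divr_gt0// ltr_wpDl.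
1,2: have de : e / (r s + 1) * r s <= e
  by rewrite mulrAC ler_pdivrMr ?ltr_wpDl// mulrDr mulr1 lerDl ltW.
- have : r (s * x) <= r ((r x + e / (r s + 1))%:C *: s).
    apply: valB => //; first by rewrite adjZr sa.
    rewrite -mul_scr -mulrBr; apply: (Qmul) => //; apply: val_gt => //.
    by rewrite ltrDl.
  by rewrite cone_valZ//; lra.
- have : r ((r x - e / (r s + 1))%:C *: s) <= r (s * x).
    apply: valB => //; first by rewrite adjZr sa.
    rewrite -mul_scr -mulrBr; apply: (Qmul) => //; apply: val_lt => //.
    by rewrite gtrDl oppr_lt0.
  by rewrite cone_valZ//; lra.
Qed.

End MaximalCone.
End Cone.

Lemma conjc_ReIm (R : realType) (u v : R) :
  (u%:C + 'i%C * v%:C)^*%C = u%:C - 'i%C * v%:C.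
Proof. by apply/eqP; rewrite eq_complex /=; apply/andP; split; apply/eqP; ring. Qed.

Section ReIm.
Context (R : realType) (A : cstarAlgType R).
Implicit Types (a b : A) (t : R).
Local Notation half := ((2^-1 : R)%:C).
Local Notation ii := ('i%C : R[i]).

Definition re a : A := half *: (a + adj a).
Definition im a : A := half *: (ii *: (adj a - a)).

Lemma re_im a : a = re a + ii *: im a.
Proof.
rewrite /re /im (scalerA ii half) mulrC -scalerA scaleii opprB -scalerDr.
by rewrite addrACA addrN addr0 half_addr.
Qed.

Lemma adj_re a : adj (re a) = re a.
Proof. by rewrite adjZr adjD adjK addrC. Qed.

Lemma adj_im a : adj (im a) = im a.
Proof. by rewrite adjZr adjZ conjc_ii adjB adjK scaleNr -scalerN opprB. Qed.

Lemma reD a b : re (a + b) = re a + re b.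
Proof. by rewrite /re adjD addrACA scalerDr. Qed.

Lemma imD a b : im (a + b) = im a + im b.
Proof. by rewrite /im adjD opprD addrACA !scalerDr. Qed.

Lemma reZr t a : re (t%:C *: a) = t%:C *: re a.
Proof. by rewrite /re adjZr -scalerDr !scalerA mulrC. Qed.

Lemma imZr t a : im (t%:C *: a) = t%:C *: im a.
Proof. by rewrite /im adjZr -scalerBr !scalerA; congr (_ *: _); ring. Qed.

Lemma re_ii a : re (ii *: a) = - im a.
Proof.
by rewrite /re /im adjZ conjc_ii scaleNr -scalerBr -scalerN -scalerN opprB.
Qed.

Lemma im_ii a : im (ii *: a) = re a.
Proof.
rewrite /re /im adjZ conjc_ii scaleNr -opprD -scalerDr scalerN scaleii opprK.
by rewrite addrC.
Qed.

Lemma re_sa a : adj a = a -> re a = a.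
Proof. by rewrite /re => ->; rewrite half_addr. Qed.

Lemma im_sa a : adj a = a -> im a = 0.
Proof. by rewrite /im => ->; rewrite subrr !scaler0. Qed.

Lemma re_adj a : re (adj a) = re a.
Proof. by rewrite /re adjK addrC. Qed.

Lemma im_adj a : im (adj a) = - im a.
Proof. by rewrite /im adjK -scalerN -scalerN opprB. Qed.

Lemma re_central s a : adj s = s -> (forall x : A, s * x = x * s) ->
  re (s * a) = s * re a.
Proof. by move=> sa sx; rewrite /re cadjM sa -sx -mulrDr cscaleAr. Qed.

Lemma im_central s a : adj s = s -> (forall x : A, s * x = x * s) ->
  im (s * a) = s * im a.
Proof. by move=> sa sx; rewrite /im cadjM sa -sx -mulrBr !cscaleAr. Qed.

End ReIm.

Definition state (R : realType) (A : cstarAlgType R) (rho : A -> R[i]) :=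
  [/\ scalar rho, rho 1 = 1, forall a, rho (adj a) = (rho a)^*%C &
      forall p, pos p -> 0 <= rho p].

(** * States obtained from maximal cones *)

Section Functionals.
Context (R : realType) (A : cstarAlgType R).
Implicit Types (a b x p q s : A) (t : R).
Local Notation half := ((2^-1 : R)%:C).
Local Notation ii := ('i%C : R[i]).

Section ScalarTheory.
Context (rho : A -> R[i]) (rho_lin : scalar rho).

Lemma scalar_D a b : rho (a + b) = rho a + rho b.
Proof. by have := rho_lin 1 a b; rewrite scale1r mul1r. Qed.

Lemma scalar_0 : rho 0 = 0.
Proof. by apply: (addrI (rho 0)); rewrite -scalar_D !addr0. Qed.

Lemma scalar_Z c a : rho (c *: a) = c * rho a.
Proof. by have := rho_lin c a 0; rewrite scalar_0 !addr0. Qed.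

Lemma scalar_N a : rho (- a) = - rho a.
Proof. by rewrite -scaleN1r scalar_Z mulN1r. Qed.

Lemma scalar_B a b : rho (a - b) = rho a - rho b.
Proof. by rewrite scalar_D scalar_N. Qed.

End ScalarTheory.

Context (S : set A) (S_mult : multipliers S).
Let S_pos : S `<=` @pos R A. Proof. by case: S_mult. Qed.
Let S_sc t : 0 <= t -> S (sc A t). Proof. by case: S_mult => _ + _ _ _; apply. Qed.
Let S_add s s' : S s -> S s' -> S (s + s').
Proof. by case: S_mult => _ _ + _ _; apply. Qed.
Let S_mul s s' : S s -> S s' -> S (s * s').
Proof. by case: S_mult => _ _ _ + _; apply. Qed.
Let S_central s x : S s -> s * x = x * s.
Proof. by case: S_mult => _ _ _ _; apply. Qed.

(** On self-adjoint elements the functional is [cone_val] of a maximal cone above [Q0]; it is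
    extended through real and imaginary parts. Elements of S are self-adjoint and central, so
    multiplying by them respects this decomposition. *)
Lemma cone_functional (Q0 : set A) : cone S Q0 -> @pos R A `<=` Q0 ->
  exists rho : A -> R[i], [/\ state rho, forall q, Q0 q -> 0 <= rho q &
    forall s a, S s -> rho (s * a) = rho s * rho a].
Proof.
move=> cQ0 pQ0.
have [F [X FX] FP Ftot|Q [cQ Q0Q Qmax]] := @Zorn_above _ (cone S) _ cQ0.
  have Fmem x y : (\bigcup_(X in F) X) x -> (\bigcup_(X in F) X) y ->
      exists Z, [/\ F Z, Z x & Z y].
    move=> [Y FY Yx] [Z FZ Zy].
    by have [YZ|ZY] := Ftot _ _ FY FZ;
      [exists Z|exists Y]; split=> //; [exact: YZ|exact: ZY].
  split.
  - by move=> x [Y /FP[Ya _ _ _] /Ya].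
  - move=> x y /Fmem xF /xF[Z [FZ Zx Zy]]; exists Z => //.
    by have [_ Zadd _ _] := FP _ FZ; exact: Zadd.
  - move=> s x Ss [Y FY Yx]; exists Y => //.
    by have [_ _ Ymul _] := FP _ FY; exact: Ymul.
  - by move=> [Y /FP[_ _ _ nY]] /nY.
have pQ : @pos R A `<=` Q by move=> x /pQ0 /Q0Q.
have totQ := maximal_cone_total S_mult cQ pQ Qmax.
pose r := cone_val Q.
have rD := cone_valD S_mult cQ pQ totQ; have rZ := cone_valZ S_mult cQ pQ totQ.
have rN := cone_valN S_mult cQ pQ totQ; have r_sc := cone_val_sc S_mult cQ pQ.
have rM := cone_valM S_mult cQ pQ totQ.
have r0 := cone_val_ge0 S_mult cQ pQ.
pose rho a : R[i] := (r (re a))%:C + 'i%C * (r (im a))%:C.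
have rhoD a b : rho (a + b) = rho a + rho b.
  rewrite /rho reD imD /r !rD ?adj_re ?adj_im// !rmorphD mulrDr.
  by rewrite addrACA.
have rhoZr t a : rho (t%:C *: a) = t%:C * rho a.
  rewrite /rho reZr imZr /r (rZ _ _ (adj_re a)) (rZ _ _ (adj_im a)).
  by rewrite !rmorphM mulrDr [in RHS]mulrCA.
have rhoi a : rho ('i%C *: a) = 'i%C * rho a.
  rewrite /rho re_ii im_ii /r rN ?adj_im// rmorphN mulrDr mulrA -expr2 sqr_i.
  by rewrite mulN1r addrC.
have rho_sa x : adj x = x -> rho x = (r x)%:C.
  move=> xa; rewrite /rho re_sa// im_sa// -(sc0 A) /r r_sc.
  by rewrite rmorph0 mulr0 addr0.
exists rho; split.
- split.
  + move=> c a b; rewrite rhoD; congr (_ + _).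
    rewrite (complexE c) scalerDl rhoD rhoZr mulrDl; congr (_ + _).
    by rewrite -!scalerA rhoi rhoZr mulrA.
  + by rewrite rho_sa ?adj_one// -(sc1 A) /r r_sc.
  + move=> a; rewrite /rho re_adj im_adj /r rN ?adj_im// rmorphN mulrN.
    by rewrite conjc_ReIm.
  + by move=> p pp; rewrite rho_sa ?(pos_adj pp)// lecR r0//; exact: pQ.
- move=> q Q0q; have qa : adj q = q by case: cQ0 => + _ _ _; apply.
  by rewrite rho_sa// lecR r0//; exact: Q0Q.
- move=> s a Ss; have sa := pos_adj (S_pos Ss).
  have sC x : s * x = x * s by exact: S_central.
  rewrite (rho_sa s)// /rho re_central// im_central// /r !rM ?adj_re ?adj_im//.
  by rewrite !rmorphM mulrDr mulrCA.
Qed.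

(** The cone generated over S by the positive elements and w = q - [nrm q] omits -1: from -1 = p + s
    w it would follow that (nrm q - q) s = 1 + p, which is invertible, against [nrm_spectrum].
    Nonnegativity at w is the wanted bound. *)
Lemma norming_functional q : pos q -> nrm q != 0 ->
  exists rho : A -> R[i], [/\ state rho, (nrm q)%:C <= rho q &
    forall s a, S s -> rho (s * a) = rho s * rho a].
Proof.
move=> pq q0; pose w := q - sc A (nrm q).
have wa : adj w = w by rewrite adjB adj_sc pos_adj.
have S_pmul s p : S s -> pos p -> pos (s * p).
  by move=> Ss pp; apply: pos_mul => //; [exact: S_pos|exact: S_central].
have S1 : S 1 by rewrite -(sc1 A); exact: S_sc.
have S0 : S 0 by rewrite -(sc0 A); exact: S_sc.
pose Q0 := [set x | exists p s, [/\ pos p, S s & x = p + s * w]].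
have [| |rho [rho_st rhoQ rhoM]] := @cone_functional Q0.
- split.
  + move=> _ [p [s [pp Ss ->]]].
    by rewrite adjD cadjM wa (pos_adj (S_pos Ss)) (pos_adj pp) -(S_central _ Ss).
  + move=> _ _ [p [s [pp Ss ->]]] [p' [s' [pp' Ss' ->]]].
    exists (p + p'), (s + s'); rewrite mulrDl addrACA; split=> //.
      exact: posD.
    exact: S_add.
  + move=> s _ Ss [p' [s' [pp' Ss' ->]]].
    exists (s * p'), (s * s'); rewrite mulrDr mulrA; split=> //.
      exact: S_pmul.
    exact: S_mul.
  + move=> [p [s [pp Ss e]]].
    have [z] := pos_inverse pp (ltr01 : 0 < (1 : R)).
    have -> : sc A 1 + p = (sc A (nrm q) - q) * s.
      rewrite -(S_central _ Ss) -opprB -/w mulrN sc1 -[1]opprK e opprD.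
      by rewrite addrAC addNr add0r.
    by rewrite -mulrA; exact: nrm_spectrum.
- by move=> p pp; exists p, 0; rewrite mul0r addr0.
exists rho; split=> //; have : Q0 w.
  by exists 0, 1; rewrite mul1r add0r; split=> //; exact: pos0.
move=> /rhoQ; have [rl r1 _ _] := rho_st.
by rewrite (scalar_B rl) (scalar_Z rl) r1 mulr1 subr_ge0.
Qed.

End Functionals.

Lemma norming_state (R : realType) (A : cstarAlgType R) (a : A) : a != 0 ->
  exists2 rho : A -> R[i], state rho & rho (adj a * a) != 0.
Proof.
move=> a0; have n0 : 0 < nrm (adj a * a).
  rewrite nrm_adjM exprn_gt0// lt_neqAle nrm_ge0 andbT eq_sym.
  by apply: contra_neq a0; exact: nrm0_eq0.
have [||rho [rho_st rho_a _]] :=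
    norming_functional (nneg_multipliers A) (q := adj a * a).
- exact: star_pos.
- by rewrite gt_eqF.
exists rho => //; rewrite gt_eqF//; apply: lt_le_trans rho_a.
by rewrite ltcR.
Qed.

(** * Characters and the Gelfand norm *)

Section Characters.
Context (R : realType) (C : cstarAlgType R).
Implicit Types (c x p : C).

Section OneCharacter.
Context (chi : C -> R[i]) (chi_char : is_character chi).

Let chi_lin : scalar chi. Proof. by case: chi_char. Qed.
Let chi1 : chi 1 = 1. Proof. by case: chi_char => _ []. Qed.
Let chiM x y : chi (x * y) = chi x * chi y.
Proof. by case: chi_char => _ []. Qed.

Lemma character_sc t : chi (sc C t) = t%:C.
Proof. by rewrite (scalar_Z chi_lin) chi1 mulr1. Qed.

(* If chi x = u + i v with v <> 0, then chi vanishes on (x - u)^2 + v^2, which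
   is invertible. *)
Lemma character_sa x : adj x = x -> chi x = (complex.Re (chi x))%:C.
Proof.
move=> xa; set u := complex.Re (chi x); pose v := complex.Im (chi x).
have chix : chi x = u%:C + 'i%C * v%:C by rewrite -complexE.
have [v0|v0] := eqVneq v 0; first by rewrite chix v0 rmorph0 mulr0 addr0.
pose y := x - sc C u.
have ya : adj y = y by rewrite adjB adj_sc xa.
have v2 : 0 < v ^+ 2 by rewrite exprn_even_gt0.
have [z /(congr1 chi)] := pos_inverse (pos_sqr ya) v2.
rewrite chiM (scalar_D chi_lin) character_sc chiM (scalar_B chi_lin).
rewrite character_sc chix addrAC subrr add0r mulrACA -expr2 sqr_i.
rewrite mulN1r -expr2 -rmorphXn subrr mul0r chi1 => /eqP.
by rewrite eq_sym oner_eq0.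
Qed.

Lemma character_adj c : chi (adj c) = (chi c)^*%C.
Proof.
have ->: adj c = re c - 'i%C *: im c.
  by rewrite {1}(re_im (adj c)) re_adj im_adj scalerN.
rewrite [in RHS](re_im c) (scalar_B chi_lin) (scalar_D chi_lin).
rewrite (scalar_Z chi_lin _ (im c)) (character_sa (adj_re c)) (character_sa (adj_im c)).
by rewrite conjc_ReIm.
Qed.

Lemma character_ge0 p : pos p -> 0 <= chi p.
Proof.
move=> /pos_sqrt[s [/pos_adj sa <- _ _]].
by rewrite chiM (character_sa sa) -rmorphM lecR -expr2 sqr_ge0.
Qed.

End OneCharacter.

(** The nontrivial inequality in Gelfand's theorem. With all positive elements as multipliers, the
    norming functional of [adj c * c] is multiplicative against them; a self-adjoint x is the
    difference of nrm x + x and nrm x, so the functional is a character. *)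
Lemma nrm_le_gelfand c : commutative (@GRing.mul C) -> nrm c <= nrm (gelfand c).
Proof.
move=> CC; have [->|c0] := eqVneq c 0; first by rewrite nrm0 nrm_ge0.
have n0 : 0 < nrm c.
  by rewrite lt_neqAle nrm_ge0 andbT eq_sym; apply: contra_neq c0; exact: nrm0_eq0.
have [||chi [[chi_lin chi1 chi_adj chi_pos] chi_c chi_mul]] :=
    norming_functional (pos_multipliers CC) (q := adj c * c).
- exact: star_pos.
- by rewrite nrm_adjM expf_neq0// gt_eqF.
have chi_sa x y : adj x = x -> chi (x * y) = chi x * chi y.
  move=> xa; pose p := sc C (nrm x) + x.
  have -> : x = p - sc C (nrm x) by rewrite /p addrAC subrr add0r.
  rewrite mulrBl !(scalar_B chi_lin) mulrBl !chi_mul//.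
    by apply: pos_sc; exact: nrm_ge0.
  exact: pos_scD.
have chiM x y : chi (x * y) = chi x * chi y.
  rewrite (re_im x) mulrDl -cscaleAl !(scalar_D chi_lin).
  rewrite (scalar_Z chi_lin _ (im x)) (scalar_Z chi_lin _ (im x * y)).
  by rewrite !chi_sa ?adj_re ?adj_im// mulrDl mulrA.
have chi_char : is_character chi by split=> //; split.
have := linf_norm_ub (gelfand c) (exist _ chi chi_char).
rewrite -linf_normE nrmE => chi_le.
rewrite -lecR; apply: le_trans chi_le.
rewrite -ler_sqr ?nnegrE ?normr_ge0 ?lecR ?nrm_ge0// -rmorphXn -nrm_adjM.
by apply: le_trans chi_c _; rewrite chiM chi_adj -normCKC.
Qed.

End Characters.

(** The cone consists of the sums p + c with p positive in A and c self-adjoint in C, chi c >= 0. If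
    -1 = p + c, then -1 - c is positive and chi c <= -1, a contradiction. The state obtained is
    nonnegative at c - chi c and at its opposite, so it agrees with chi. *)
Lemma extend_character (R : realType) (A : cstarAlgType R) (C : cstarSubalg A)
  (chi : subalg_type C -> R[i]) : is_character chi ->
  exists2 rho : A -> R[i], state rho & forall c, rho (val c) = chi c.
Proof.
move=> chi_char; have [chi_lin [chi1 _]] := chi_char.
pose Q0 := [set x | exists p c, [/\ pos p, adj c = c, 0 <= chi c & x = p + val c]].
(* Positivity is phrased with norms and adjoints only, so it descends from A to C. *)
have posC (c : subalg_type C) : pos (val c) -> pos c.
  by move=> [ca ct]; split=> //; apply/val_inj.
have [||rho [rho_st rhoQ _]] := cone_functional (nneg_multipliers A) (Q0 := Q0).
- split.
  + move=> _ [p [c [pp ca _ ->]]].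
    by rewrite adjD (pos_adj pp) -[in RHS]ca.
  + move=> _ _ [p [c [pp ca c0 ->]]] [p' [c' [pp' ca' c0' ->]]].
    exists (p + p'), (c + c'); rewrite raddfD addrACA adjD ca ca'.
    by rewrite (scalar_D chi_lin) addr_ge0//; split=> //; exact: posD.
  + move=> _ _ [t t0 <-] [p [c [pp ca c0 ->]]].
    exists (t%:C *: p), (t%:C *: c); rewrite mul_scl scalerDr adjZr ca.
    rewrite (scalar_Z chi_lin) mulr_ge0 ?lecR//; split=> //.
    exact: posZ.
  + move=> [p [c [pp ca c0 e]]].
    have pE : p = val (- 1 - c).
      by apply/eqP; rewrite -[X in X == _](addrK (val c)) -e raddfB.
    have : 0 <= chi (- 1 - c).
      by apply: (character_ge0 chi_char); apply: posC; rewrite -pE.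
    rewrite (scalar_B chi_lin) (scalar_N chi_lin) chi1 subr_ge0 => /(le_trans c0).
    by rewrite oppr_ge0 ler10.
- move=> p pp; exists p, 0; rewrite addr0 adj0 (scalar_0 chi_lin).
  by split.
exists rho => //; have [rho_lin rho1 _ _] := rho_st.
have rho_ge c : adj c = c -> 0 <= chi c -> 0 <= rho (val c).
  by move=> ca c0; apply: rhoQ; exists 0, c; rewrite add0r; split=> //; exact: pos0.
have rho_sa (c : subalg_type C) : adj c = c -> rho (val c) = chi c.
  move=> ca; pose t := complex.Re (chi c).
  have chic : chi c = t%:C by exact: character_sa.
  pose d := c - sc _ t.
  have da : adj d = d by rewrite adjB adj_sc ca.
  have chid : chi d = 0.
    by rewrite (scalar_B chi_lin) character_sc// chic subrr.
  have vd : val d = val c - sc A t by [].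
  have rd : rho (val d) = rho (val c) - t%:C.
    by rewrite vd (scalar_B rho_lin) (scalar_Z rho_lin) rho1 mulr1.
  apply/eqP; rewrite chic eq_le; apply/andP; split; last first.
    by rewrite -subr_ge0 -rd rho_ge// chid.
  have := @rho_ge (- d); rewrite adjN da (scalar_N chi_lin) chid oppr0.
  by move=> /(_ erefl (lexx _)); rewrite raddfN (scalar_N rho_lin) rd opprB subr_ge0.
move=> c.
have -> : rho (val c) = rho (val (re c)) + 'i%C * rho (val (im c)).
  rewrite -(scalar_Z rho_lin) -(scalar_D rho_lin); congr rho.
  exact: (congr1 val (re_im c)).
rewrite (rho_sa _ (adj_re c)) (rho_sa _ (adj_im c)) [in RHS](re_im c).
by rewrite (scalar_D chi_lin) (scalar_Z chi_lin _ (im c)).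
Qed.

(** * Hilbert spaces and completions *)

Section Modulus.
Context (R : realType).
Implicit Types (z w : R[i]) (t : R).

Definition cabs z : R := complex.Re `|z|.

Lemma cabsE z : `|z| = (cabs z)%:C.
Proof. by rewrite /cabs RRe_real// normr_real. Qed.

Lemma cabs_ge0 z : 0 <= cabs z.
Proof. by rewrite -lecR -cabsE; exact: normr_ge0. Qed.

Lemma cabsD z w : cabs (z + w) <= cabs z + cabs w.
Proof. by rewrite -lecR rmorphD/= -!cabsE ler_normD. Qed.

Lemma cabsN z : cabs (- z) = cabs z.
Proof. by rewrite /cabs normrN. Qed.

Lemma cabsC z w : cabs (z - w) = cabs (w - z).
Proof. by rewrite -cabsN opprB. Qed.

Lemma cabs_triangle y z w : cabs (z - w) <= cabs (z - y) + cabs (y - w).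
Proof. by rewrite (le_trans _ (cabsD _ _))// subrKA. Qed.

Lemma cabsM z w : cabs (z * w) = cabs z * cabs w.
Proof.
apply: (fmorph_inj (@real_complex R)) => /=.
by rewrite rmorphM/= -!cabsE normrM.
Qed.

Lemma cabs_conj z : cabs z^*%C = cabs z.
Proof. by rewrite /cabs normcJ. Qed.

Lemma cabs0 : cabs 0 = 0. Proof. by rewrite /cabs normr0. Qed.
Lemma cabs1 : cabs 1 = 1. Proof. by rewrite /cabs normr1. Qed.

Lemma cabs_real t : cabs t%:C = `|t|.
Proof. by rewrite /cabs normc_def /= expr0n/= addr0 sqrtr_sqr. Qed.

Lemma cabs_sqr z : (cabs z ^+ 2)%:C = z * z^*%C.
Proof. by rewrite rmorphXn/= -cabsE normCK. Qed.

Lemma cabs_eq0 z : cabs z = 0 -> z = 0.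
Proof. by move=> z0; apply/normr0_eq0; rewrite cabsE z0. Qed.

Lemma cabs_small_eq0 z : (forall e, 0 < e -> cabs z <= e) -> z = 0.
Proof.
move=> ze; apply/cabs_eq0/eqP; rewrite eq_le cabs_ge0 andbT.
by apply/ler_addgt0Pl => e /ze; rewrite addr0.
Qed.

Lemma cabs_Re z : `|complex.Re z| <= cabs z.
Proof. by rewrite -lecR -cabsE normc_ge_Re. Qed.

Lemma cabs_Im z : `|complex.Im z| <= cabs z.
Proof. by rewrite -lecR -cabsE normc_ge_Im. Qed.

Lemma complex_cauchy (u : nat -> R[i]) :
  (forall e, 0 < e -> exists N, forall n m, (N <= n)%N -> (N <= m)%N ->
    cabs (u n - u m) < e) ->
  exists l, forall e, 0 < e -> exists N, forall n, (N <= n)%N -> cabs (u n - l) < e.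
Proof.
move=> uc.
have Ree (e : R[i]) : 0 < e -> 0 < complex.Re e /\ e = (complex.Re e)%:C.
  move=> e0; have eE : e = (complex.Re e)%:C by rewrite RRe_real// gtr0_real.
  by split=> //; rewrite -ltcR -eE.
have Fu : ProperFilter (u @ \oo) by exact: fmap_proper_filter.
have [e /Ree[e0 ->]|l ul] := complex_complete Fu.
  have [N uN] := uc _ e0; exists (u N).
  by exists N => // n /= Nn; rewrite cabsE ltcR uN.
exists l => e e0; have [|N _ uN] := ul e%:C; first by rewrite ltcR.
by exists N => n Nn; have := uN n Nn; rewrite /= cabsE ltcR cabsC.
Qed.

End Modulus.

(** The form may be degenerate and the space incomplete; [completion] removes both defects at
    once. *)
Record preip (R : realType) := PreIp {
  preip_car :> lmodType R[i];
  ip : preip_car -> preip_car -> R[i];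
  ip_linear : forall z, scalar (ip^~ z);
  ip_conj : forall x y, ip y x = (ip x y)^*%C;
  ip_ge0 : forall x, 0 <= ip x x
}.
Arguments ip {R p}.

Section PreInner.
Context (R : realType) (V : preip R).
Implicit Types (x y z : V) (a : R[i]) (t : R).

Lemma ipDl x y z : ip (x + y) z = ip x z + ip y z.
Proof. by have := ip_linear z 1 x y; rewrite scale1r mul1r. Qed.
Lemma ip0l z : ip (0 : V) z = 0.
Proof. by apply: (addrI (ip 0 z)); rewrite -ipDl !addr0. Qed.
Lemma ipZl a x z : ip (a *: x) z = a * ip x z.
Proof. by have := ip_linear z a x 0; rewrite ip0l !addr0. Qed.
Lemma ipNl x z : ip (- x) z = - ip x z.
Proof. by rewrite -scaleN1r ipZl mulN1r. Qed.
Lemma ipBl x y z : ip (x - y) z = ip x z - ip y z.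
Proof. by rewrite ipDl ipNl. Qed.
Lemma ipDr x y z : ip z (x + y) = ip z x + ip z y.
Proof. by rewrite ip_conj ipDl rmorphD/= -!ip_conj. Qed.
Lemma ipZr a x z : ip z (a *: x) = a^*%C * ip z x.
Proof. by rewrite ip_conj ipZl rmorphM/= -!ip_conj. Qed.
Lemma ipNr x z : ip z (- x) = - ip z x.
Proof. by rewrite ip_conj ipNl rmorphN/= -!ip_conj. Qed.
Lemma ipBr x y z : ip z (x - y) = ip z x - ip z y.
Proof. by rewrite ipDr ipNr. Qed.
Lemma ip0r z : ip z (0 : V) = 0.
Proof. by rewrite ip_conj ip0l rmorph0. Qed.

Definition hn x : R := Num.sqrt (complex.Re (ip x x)).

Lemma hn_ge0 x : 0 <= hn x. Proof. exact: sqrtr_ge0. Qed.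

Lemma ip_hn x : ip x x = (hn x ^+ 2)%:C.
Proof.
have xx : ip x x = (complex.Re (ip x x))%:C by rewrite RRe_real// ger0_real// ip_ge0.
by rewrite {1}xx sqr_sqrtr// -lecR -xx ip_ge0.
Qed.

Lemma hn_sqr x : hn x ^+ 2 = complex.Re (ip x x).
Proof. by rewrite ip_hn. Qed.

Lemma cauchy_schwarz x y : cabs (ip x y) <= hn x * hn y.
Proof.
rewrite -ler_sqr ?nnegrE ?cabs_ge0 ?mulr_ge0 ?hn_ge0// exprMn.
set a := hn x ^+ 2; set b := hn y ^+ 2; set m := cabs _ ^+ 2.
have mE : m%:C = ip x y * (ip x y)^*%C by exact: cabs_sqr.
(* Expansion of the squared norm of x - t (ip x y) y for real t. *)
have quad t : 0 <= a - 2 * t * m + t ^+ 2 * m * b.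
  have conj_t : (t%:C * ip x y)^*%C = t%:C * (ip x y)^*%C.
    by rewrite rmorphM; congr (_ * _); exact: conjc_real.
  have := ip_ge0 (x - (t%:C * ip x y) *: y).
  rewrite ipBl !ipBr !ipZl !ipZr !ip_hn -/a -/b (ip_conj x y) conj_t => h.
  rewrite -lecR; apply: le_trans h _; rewrite le_eqVlt; apply/orP; left.
  apply/eqP; transitivity (a%:C - 2 * t%:C * (ip x y * (ip x y)^*%C)
    + t%:C ^+ 2 * (ip x y * (ip x y)^*%C) * b%:C); first by ring.
  by rewrite -mE; ring.
have m0 : 0 <= m by rewrite exprn_ge0// cabs_ge0.
have a0 : 0 <= a by rewrite exprn_ge0// hn_ge0.
have b0 : 0 <= b by rewrite exprn_ge0// hn_ge0.
move: b0; rewrite le_eqVlt => /orP[/eqP b0|b0]; last first.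
  have := quad b^-1.
  have -> : a - 2 * b^-1 * m + b^-1 ^+ 2 * m * b = a - m / b.
    by field; rewrite gt_eqF.
  by rewrite subr_ge0 ler_pdivrMr.
rewrite -b0 mulr0 leNgt; apply/negP => m1.
(* For a null vector y the quadratic is affine in t, and this t gives it the value -1. *)
have := quad ((a + 1) / (2 * m)); rewrite -b0 mulr0 addr0.
have -> : a - 2 * ((a + 1) / (2 * m)) * m = -1 by field; rewrite gt_eqF.
by rewrite oppr_ge0 ler10.
Qed.

Lemma hnD x y : hn (x + y) <= hn x + hn y.
Proof.
rewrite -ler_sqr ?nnegrE ?addr_ge0 ?hn_ge0//.
rewrite hn_sqr ipDl !ipDr !raddfD/= -!hn_sqr sqrrD.
have := cauchy_schwarz x y; have := cauchy_schwarz y x.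
have := ler_norm (complex.Re (ip x y)); have := ler_norm (complex.Re (ip y x)).
have := cabs_Re (ip x y); have := cabs_Re (ip y x).
by lra.
Qed.

Lemma hnZ a x : hn (a *: x) = cabs a * hn x.
Proof.
apply/eqP; rewrite -(@eqrXn2 _ 2)// ?mulr_ge0 ?cabs_ge0 ?hn_ge0//; apply/eqP.
apply: (fmorph_inj (@real_complex R)) => /=.
by rewrite -ip_hn ipZl ipZr exprMn rmorphM/= cabs_sqr -ip_hn mulrA.
Qed.

Lemma hn0 : hn 0 = 0.
Proof. by rewrite -(scale0r (0 : V)) hnZ cabs0 mul0r. Qed.

Lemma hnN x : hn (- x) = hn x.
Proof. by rewrite -scaleN1r hnZ cabsN cabs1 mul1r. Qed.

Lemma hnC x y : hn (x - y) = hn (y - x).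
Proof. by rewrite -hnN opprB. Qed.

Lemma hn_triangle y x z : hn (x - z) <= hn (x - y) + hn (y - z).
Proof. by rewrite (le_trans _ (hnD _ _))// subrKA. Qed.

Definition hcauchy (u : nat -> V) :=
  forall e, 0 < e -> exists N, forall n m, (N <= n)%N -> (N <= m)%N ->
    hn (u n - u m) < e.

Definition hcvg (u : nat -> V) (l : V) :=
  forall e, 0 < e -> exists N, forall n, (N <= n)%N -> hn (u n - l) < e.

End PreInner.

Record hilbert (R : realType) := Hilbert {
  hilb_pre :> preip R;
  hilb_def : forall x : hilb_pre, ip x x = 0 -> x = 0;
  hilb_complete : forall u : nat -> hilb_pre, hcauchy u -> exists l, hcvg u l
}.

(** * Forms approximated by vectors, and limits of their inner products *)

Section Approximation.
Context (R : realType) (V : preip R).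
Implicit Types (x y z : V) (a : R[i]) (d e t : R) (f g : V -> R[i]).

(* f is within d of <x, _> in the dual norm *)
Definition approximates f d x := forall y, cabs (f y - ip x y) <= d * hn y.

Lemma approx_ip x d : 0 <= d -> approximates (ip x) d x.
Proof. by move=> d0 y; rewrite subrr cabs0 mulr_ge0 ?hn_ge0. Qed.

Lemma approx_le f d d' x : d <= d' -> approximates f d x -> approximates f d' x.
Proof.
by move=> dd' fx y; apply: le_trans (fx y) _; rewrite ler_wpM2r ?hn_ge0.
Qed.

Lemma approxD f g d d' x y :
  approximates f d x -> approximates g d' y -> approximates (f \+ g) (d + d') (x + y).
Proof.
move=> fx gy z; rewrite ipDl opprD addrACA mulrDl.
by apply: le_trans (cabsD _ _) _; exact: lerD.
Qed.

Lemma approxZ f d a x : approximates f d x -> approximates (a \*: f) (cabs a * d) (a *: x).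
Proof.
move=> fx z; rewrite ipZl /= -mulrBr cabsM -mulrA.
by rewrite ler_wpM2l ?cabs_ge0.
Qed.

Lemma hn_le_of_ip x d : 0 <= d -> (forall y, cabs (ip x y) <= d * hn y) ->
  hn x <= d.
Proof.
move=> d0 /(_ x); rewrite ip_hn cabs_real ger0_norm ?exprn_ge0 ?hn_ge0//.
have := hn_ge0 x; rewrite le_eqVlt => /orP[/eqP<- //|x0].
by rewrite expr2 ler_pM2r.
Qed.

Lemma approx_diff f d d' x x' : 0 <= d -> 0 <= d' ->
  approximates f d x -> approximates f d' x' -> hn (x - x') <= d + d'.
Proof.
move=> d0 d0' fx fx'; apply: hn_le_of_ip => [|y]; first exact: addr_ge0.
rewrite ipBl -(subrKA (f y)) mulrDl.
apply: le_trans (cabsD _ _) _; apply: lerD => //.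
by rewrite cabsC.
Qed.

Definition approximable f := forall d, 0 < d -> exists x, approximates f d x.

(** The inner product that the forms f and g must have: the common limit over all their
    approximants. *)
Definition ip_limit f g (s : R[i]) := forall e, 0 < e ->
  exists2 d, 0 < d & forall x y, approximates f d x -> approximates g d y ->
    cabs (ip x y - s) <= e.

Lemma ip_limit_exists f g : approximable f -> approximable g ->
  exists s, ip_limit f g s.
Proof.
move=> fa ga; have [x0 fx0] := fa 1 ltr01; have [y0 gy0] := ga 1 ltr01.
(* Approximants within d <= 1 have norm at most [hn x0 + 2], respectively [hn y0 + 2]; [K] is the
   sum of these bounds. *)
pose K := hn x0 + hn y0 + 4.
have K0 : 0 < K by rewrite ltr_wpDl ?addr_ge0 ?hn_ge0.
have close d x y x' y' : 0 < d -> d <= 1 -> approximates f d x -> approximates g d y ->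
    approximates f d x' -> approximates g d y' -> cabs (ip x y - ip x' y') <= 2 * d * K.
  move=> d0 d1 fx gy fx' gy'.
  have dx := approx_diff (ltW d0) (ltW d0) fx fx'.
  have dy := approx_diff (ltW d0) (ltW d0) gy gy'.
  have := approx_diff (ltW d0) ler01 gy gy0; have := hnD (y - y0) y0.
  have := approx_diff (ltW d0) ler01 fx' fx0; have := hnD (x' - x0) x0.
  rewrite !subrK => hx' hx'' hy hy''.
  have -> : ip x y - ip x' y' = ip (x - x') y + ip x' (y - y').
    by rewrite ipBl ipBr addrA subrK.
  apply: le_trans (cabsD _ _) _.
  have := cauchy_schwarz (x - x') y; have := cauchy_schwarz x' (y - y').
  have : hn (x - x') * hn y <= 2 * d * hn y.
    by rewrite ler_wpM2r ?hn_ge0//; lra.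
  have : hn x' * hn (y - y') <= hn x' * (2 * d).
    by rewrite ler_wpM2l ?hn_ge0//; lra.
  have : 2 * d * (hn x' + hn y) <= 2 * d * K.
    by rewrite ler_wpM2l ?mulr_ge0 ?(ltW d0)// /K; lra.
  by lra.
pose d n : R := n.+1%:R^-1.
have d0 : forall n, 0 < d n := @invnS_gt0 R.
have dN : forall n m, (n <= m)%N -> d m <= d n := @invnS_le R.
have d1 n : d n <= 1 by rewrite invf_le1 ?ltr0n// ler1n.
have small e : 0 < e -> exists N, 2 * d N * K <= e.
  move=> e0; have [|N NK] := @invnS_small R (e / (2 * K)).
    by rewrite divr_gt0 ?mulr_gt0.
  exists N; move: NK; rewrite ltr_pdivlMr ?mulr_gt0// mulrCA mulrA.
  exact: ltW.
have /choice[x fx] n := fa _ (d0 n).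
have /choice[y gy] n := ga _ (d0 n).
have [e e0|s us] := @complex_cauchy R (fun n => ip (x n) (y n)).
  have e2 : 0 < e / 2 by rewrite divr_gt0.
  have [N NK] := small _ e2; exists N => n m Nn Nm.
  apply: (@le_lt_trans _ _ (e / 2)); last by lra.
  apply: le_trans NK; apply: close => //;
    by [apply: approx_le (dN _ _ Nn) _|apply: approx_le (dN _ _ Nm) _].
exists s => e e0.
have e2 : 0 < e / 2 by rewrite divr_gt0.
have [N NK] := small _ e2; have [M uM] := us _ e2.
exists (d N) => // x' y' fx' gy'.
pose n := maxn N M; have Nn : (N <= n)%N by exact: leq_maxl.
apply: le_trans (cabs_triangle (ip (x n) (y n)) _ _) _.
have := uM n (leq_maxr _ _).
have : cabs (ip x' y' - ip (x n) (y n)) <= 2 * d N * K.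
  by apply: close => //; apply: approx_le (dN _ _ Nn) _.
by lra.
Qed.

End Approximation.

Definition cpl_pred (R : realType) (V : preip R) : {pred V -> R[i]} :=
  fun f => `[< approximable f >].

(* The elements of the completion are encoded as the conjugate-linear forms on
   V lying in the closure of the forms <x, _>. *)
Record cpl (R : realType) (V : preip R) := Cpl {
  cpl_fun :> V -> R[i];
  _ : cpl_pred cpl_fun
}.

(** * The completion of a pre-inner product space *)

Section Completion.
Context (R : realType) (V : preip R).
Implicit Types (x y z : V) (a : R[i]) (d e t : R).
Local Notation T := (cpl V).

HB.instance Definition _ := [isSub for @cpl_fun R V].
HB.instance Definition _ := [Choice of T by <:].

Fact cpl_submod : GRing.subsemimod_closed (@cpl_pred R V).
Proof.
split=> [|a f /asboolP fa]; last first.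
  apply/asboolP => d d0; have a0 : 0 < cabs a + 1 by rewrite ltr_wpDl ?cabs_ge0.
  have [|x fx] := fa (d / (cabs a + 1)); first by rewrite divr_gt0.
  exists (a *: x); apply: approx_le (approxZ a fx).
  rewrite mulrA ler_pdivrMr// mulrDr mulr1 mulrC lerDl; exact: ltW.
split=> [|f g /asboolP fa /asboolP ga]; apply/asboolP => d d0.
  by exists 0 => y; rewrite ip0l subrr cabs0 mulr_ge0 ?hn_ge0// ltW.
have d2 : 0 < d / 2 by rewrite divr_gt0.
have [x fx] := fa _ d2; have [y gy] := ga _ d2.
by exists (x + y); rewrite [d]splitr; exact: approxD.
Qed.

HB.instance Definition _ :=
  GRing.SubChoice_isSubLmodule.Build R[i] (V -> R[i]) _ T cpl_submod.

Lemma cplP (f g : T) : (forall x, f x = g x) -> f = g.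
Proof. by move=> fg; apply/val_inj/funext. Qed.

Lemma cpl_approx (f : T) : approximable f.
Proof. by case: f => f /= /asboolP. Qed.

Lemma cplDE (f g : T) x : (f + g) x = f x + g x. Proof. by []. Qed.
Lemma cplZE a (f : T) x : (a *: f) x = a * f x. Proof. by []. Qed.
Lemma cplBE (f g : T) x : (f - g) x = f x - g x.
Proof. by rewrite -scaleN1r cplDE cplZE mulN1r. Qed.

Fact cpl_embed_subproof x : cpl_pred (ip x).
Proof. by apply/asboolP => d /ltW d0; exists x; exact: approx_ip. Qed.
(** Null vectors are sent to 0, so no quotient has to be formed beforehand. *)
Definition cpl_embed x : T := Cpl (cpl_embed_subproof x).

Definition cpl_ip (f g : T) : R[i] :=
  sval (cid (ip_limit_exists (cpl_approx f) (cpl_approx g))).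

Lemma cpl_ipP (f g : T) : ip_limit f g (cpl_ip f g).
Proof. exact: (svalP (cid (ip_limit_exists _ _))). Qed.

(** The limit may be computed along any family of arbitrarily good approximants. *)
Lemma cpl_ip_eq (f g : T) s :
  (forall e d, 0 < e -> 0 < d -> exists x y,
    [/\ approximates f d x, approximates g d y & cabs (ip x y - s) <= e]) ->
  cpl_ip f g = s.
Proof.
move=> H; apply/eqP; rewrite -subr_eq0; apply/eqP/cabs_small_eq0 => e e0.
have e2 : 0 < e / 2 by rewrite divr_gt0.
have [d d0 fgd] := cpl_ipP f g e2.
have [x [y [fx gy xy]]] := H _ _ e2 d0.
apply: le_trans (cabs_triangle (ip x y) _ _) _.
by have := fgd x y fx gy; rewrite (cabsC (cpl_ip f g)); lra.
Qed.

Lemma cpl_ip_conj f g : cpl_ip g f = (cpl_ip f g)^*%C.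
Proof.
apply: cpl_ip_eq => e d e0 d0.
have [d' d0' fgd] := cpl_ipP f g e0.
have m0 : 0 < Num.min d d' by rewrite lt_min d0.
have [x fx] := cpl_approx f m0; have [y gy] := cpl_approx g m0.
exists y, x; split.
- by apply: approx_le gy; rewrite ge_min lexx.
- by apply: approx_le fx; rewrite ge_min lexx.
- rewrite (ip_conj x y) -rmorphB cabs_conj; apply: fgd.
    by apply: approx_le fx; rewrite ge_min lexx orbT.
  by apply: approx_le gy; rewrite ge_min lexx orbT.
Qed.

Lemma cpl_ip_linear g : scalar (cpl_ip^~ g).
Proof.
move=> a f f' /=; apply: cpl_ip_eq => e d e0 d0.
have K0 : 0 < cabs a + 1 by rewrite ltr_wpDl ?cabs_ge0.
have e1 : 0 < e / (cabs a + 1) by rewrite divr_gt0.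
have [d1 d10 fg] := cpl_ipP f g e1; have [d2 d20 fg'] := cpl_ipP f' g e1.
pose m := Num.min (d / (cabs a + 1)) (Num.min d (Num.min d1 d2)).
have m0 : 0 < m by rewrite !lt_min divr_gt0 ?d0 ?d10.
have md : m <= d / (cabs a + 1) by rewrite ge_min lexx.
have [md' [md1 md2]] : m <= d /\ m <= d1 /\ m <= d2.
  by rewrite /m !ge_min !lexx !orbT.
have [x fx] := cpl_approx f m0; have [x' fx'] := cpl_approx f' m0.
have [y gy] := cpl_approx g m0.
exists (a *: x + x'), y; split.
- apply: approx_le (approxD (approxZ a fx) fx').
  by move: md; rewrite ler_pdivlMr//; lra.
- exact: approx_le gy.
- have -> : ip (a *: x + x') y - (a * cpl_ip f g + cpl_ip f' g) =
      a * (ip x y - cpl_ip f g) + (ip x' y - cpl_ip f' g).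
    by rewrite ipDl ipZl; ring.
  apply: le_trans (cabsD _ _) _; rewrite cabsM.
  have h1 : cabs (ip x y - cpl_ip f g) <= e / (cabs a + 1).
    by apply: fg; [exact: approx_le fx|exact: approx_le gy].
  have h2 : cabs (ip x' y - cpl_ip f' g) <= e / (cabs a + 1).
    by apply: fg'; [exact: approx_le fx'|exact: approx_le gy].
  have h3 := ler_wpM2l (cabs_ge0 a) h1.
  have : e = cabs a * (e / (cabs a + 1)) + e / (cabs a + 1).
    by field; rewrite gt_eqF.
  by lra.
Qed.

Lemma cpl_ip_ge0 f : 0 <= cpl_ip f f.
Proof.
have near e : 0 < e -> exists2 r : R, 0 <= r & cabs (r%:C - cpl_ip f f) <= e.
  move=> e0; have [d d0 fd] := cpl_ipP f f e0; have [x fx] := cpl_approx f d0.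
  by exists (hn x ^+ 2); rewrite ?exprn_ge0 ?hn_ge0// -ip_hn fd.
rewrite lecE /=; apply/andP; split.
  apply/eqP/eqP; rewrite -normr_eq0 eq_le normr_ge0 andbT.
  apply/ler_addgt0Pl => e /near[r r0]; rewrite addr0; apply: le_trans.
  by apply: le_trans (cabs_Im _); rewrite raddfB/= sub0r normrN.
apply/ler_addgt0Pl => e /near[r r0 re].
have := le_trans (cabs_Re _) re; rewrite raddfB/= ler_norml => /andP[_].
by lra.
Qed.

Definition cpl_preip : preip R := PreIp cpl_ip_linear cpl_ip_conj cpl_ip_ge0.
Local Notation H := cpl_preip.

Lemma ip_cpl_embed x y : ip (cpl_embed x : H) (cpl_embed y) = ip x y.
Proof.
apply: cpl_ip_eq => e d e0 d0; exists x, y.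
by split; [exact/approx_ip/ltW|exact/approx_ip/ltW|rewrite subrr cabs0 ltW].
Qed.

Lemma hn_cpl_embed x : hn (cpl_embed x : H) = hn x.
Proof. by rewrite /hn ip_cpl_embed. Qed.

(** The reproducing property: inner products with vectors of V are evaluations of forms. *)
Lemma ip_embedr (f : H) z : ip f (cpl_embed z) = f z.
Proof.
apply: cpl_ip_eq => e d e0 d0.
have K0 : 0 < hn z + 1 by rewrite ltr_wpDl ?hn_ge0.
have m0 : 0 < Num.min d (e / (hn z + 1)) by rewrite lt_min d0 divr_gt0.
have [x fx] := cpl_approx f m0; exists x, z; split.
- by apply: approx_le fx; rewrite ge_min lexx.
- exact/approx_ip/ltW.
- rewrite cabsC; apply: le_trans (fx z) _.
  apply: (@le_trans _ _ (e / (hn z + 1) * hn z)).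
    by rewrite ler_wpM2r ?hn_ge0// ge_min lexx orbT.
  by rewrite mulrAC ler_pdivrMr// mulrDr mulr1 lerDl ltW.
Qed.

Lemma cabs_le_hn (f : H) z : cabs (f z) <= hn f * hn z.
Proof. by rewrite -ip_embedr -(hn_cpl_embed z); exact: cauchy_schwarz. Qed.

(** With [cabs_le_hn], this identifies the norm of the completion with the dual norm over V. *)
Lemma hn_le_of_cabs (f : H) c : 0 <= c ->
  (forall z, cabs (f z) <= c * hn z) -> hn f <= c.
Proof.
move=> c0 fc; rewrite -ler_sqr ?nnegrE ?hn_ge0//; apply/ler_addgt0Pl => e e0.
have e2 : 0 < e / 2 by rewrite divr_gt0.
have [d d0 fd] := cpl_ipP f f e2.
have K0 : 0 < 2 * c + 1 by rewrite ltr_wpDl ?mulr_ge0.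
(* As m <= 1, (c + m)^2 is at most c^2 + m (2 c + 1); the last bound on [m] makes the excess at most
   e/2. *)
pose m := Num.min (Num.min d 1) (e / 2 / (2 * c + 1)).
have m0 : 0 < m by rewrite !lt_min d0 ltr01 divr_gt0.
have [md [m1 me]] : m <= d /\ m <= 1 /\ m <= e / 2 / (2 * c + 1).
  by rewrite /m !ge_min !lexx !orbT.
have [x fx] := cpl_approx f m0.
have hx : hn x <= c + m.
  apply: hn_le_of_ip => [|y]; first by rewrite addr_ge0// ltW.
  have -> : ip x y = f y - (f y - ip x y) by rewrite opprB addrC subrK.
  apply: le_trans (cabsD _ _) _; rewrite cabsN mulrDl; exact: lerD.
have := fd x x (approx_le md fx) (approx_le md fx).
rewrite ip_hn cabsC => /(le_trans (cabs_Re _)).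
rewrite raddfB/= ler_norml -[complex.Re (cpl_ip f f)]/(complex.Re (ip (f : H) f)).
rewrite -hn_sqr => /andP[_ h].
have : hn x ^+ 2 <= (c + m) ^+ 2 by rewrite ler_sqr ?nnegrE ?hn_ge0 ?addr_ge0// ltW.
have : m ^+ 2 <= m by rewrite expr2 ler_piMl// ltW.
move: me; rewrite ler_pdivlMr// sqrrD.
by lra.
Qed.

Lemma cpl_def (f : H) : ip f f = 0 -> f = 0.
Proof.
rewrite ip_hn => f0; apply: cplP => z; apply/cabs_eq0/eqP.
rewrite eq_le cabs_ge0 andbT; apply: le_trans (cabs_le_hn f z) _.
have : hn f ^+ 2 = 0 by apply: (fmorph_inj (@real_complex R)).
by move=> /eqP; rewrite sqrf_eq0 => /eqP->; rewrite mul0r.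
Qed.

(** The limit is taken pointwise. It is still approximable by vectors, since an approximant of a
    late term serves for it. *)
Lemma cpl_complete (u : nat -> H) : hcauchy u -> exists l, hcvg u l.
Proof.
move=> uc; have pt n m z : cabs (u n z - u m z) <= hn (u n - u m) * hn z.
  by rewrite -cplBE; exact: cabs_le_hn.
have /choice[g ug] z : exists s, forall e, 0 < e -> exists N, forall n,
    (N <= n)%N -> cabs (u n z - s) < e.
  apply: complex_cauchy => e e0.
  have K0 : 0 < hn z + 1 by rewrite ltr_wpDl ?hn_ge0.
  have [|N uN] := uc (e / (hn z + 1)); first by rewrite divr_gt0.
  exists N => n m Nn Nm; apply: le_lt_trans (pt n m z) _.
  have := ltW (uN n m Nn Nm) => /(ler_wpM2r (hn_ge0 z))/le_lt_trans; apply.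
  by rewrite mulrAC ltr_pdivrMr// mulrDr mulr1 ltrDl.
have ulim e N : (forall n m, (N <= n)%N -> (N <= m)%N -> hn (u n - u m) < e) ->
    forall n z, (N <= n)%N -> cabs (u n z - g z) <= e * hn z.
  move=> uN n z Nn; apply/ler_addgt0Pl => e' /(ug z)[M uM].
  pose k := maxn N M; apply: le_trans (cabs_triangle (u k z) _ _) _.
  rewrite addrC; apply: lerD; first by rewrite ltW// uM// leq_maxr.
  apply: le_trans (pt _ _ _) _; rewrite ler_wpM2r ?hn_ge0// ltW//.
  by rewrite uN// leq_maxl.
have gP : cpl_pred g.
  apply/asboolP => d d0; have d2 : 0 < d / 2 by rewrite divr_gt0.
  have [N /ulim uN] := uc _ d2; have [x ux] := cpl_approx (u N) d2.
  exists x => y; rewrite [d]splitr mulrDl.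
  apply: le_trans (cabs_triangle (u N y) _ _) _; apply: lerD => //.
  by rewrite cabsC uN.
exists (Cpl gP) => e e0; have e2 : 0 < e / 2 by rewrite divr_gt0.
have [N /ulim uN] := uc _ e2; exists N => n Nn.
apply: (@le_lt_trans _ _ (e / 2)); last by lra.
by apply: hn_le_of_cabs => [|z]; [exact: ltW|rewrite cplBE uN].
Qed.

Definition completion : hilbert R := Hilbert cpl_def cpl_complete.

End Completion.

(** A Cauchy filter is tracked by a sequence: x n is the centre of a ball of radius 1/(n + 1) that
    belongs to the filter. *)
Lemma ncauchy_complete (R : realType) (V : normedModType R[i]) :
  (forall u : nat -> V, ncauchy u -> exists l, ncvg u l) ->
  forall F : set_system V, ProperFilter F -> cauchy F -> cvg F.
Proof.
move=> Vc F FF /cauchyP Fc.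
pose d n : R := n.+1%:R^-1.
have d0 : forall n, 0 < d n := @invnS_gt0 R.
have dN : forall n m, (n <= m)%N -> d m <= d n := @invnS_le R.
have small : forall e, 0 < e -> exists N, d N < e := @invnS_small R.
have /choice[x Fx] n : exists x, F [set y | nrm (x - y) < d n].
  have [|x Fx] := Fc (d n)%:C; first by rewrite ltcR.
  exists x; apply: filterS Fx => y; rewrite -ball_normE /= nrmE ltcR.
  by [].
have close n m : nrm (x n - x m) < d n + d m.
  have [y /= [xn xm]] := filter_ex (filterI (Fx n) (Fx m)).
  apply: le_lt_trans (nrm_triangle y _ _) _.
  by rewrite (nrmC y) ltrD.
have [e e0|l xl] := Vc x.
  have [|N Ne] := small (e / 2); first by rewrite divr_gt0.
  exists N => n m Nn Nm; apply: lt_le_trans (close n m) _.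
  by have := dN _ _ Nn; have := dN _ _ Nm; lra.
apply/cvg_ex; exists l; apply/fcvgrPdist_lt => e e0.
have eE : e = (complex.Re e)%:C by rewrite RRe_real// gtr0_real.
move: e0; rewrite eE ltcR => e0.
have e2 : 0 < complex.Re e / 2 by rewrite divr_gt0.
have [N Ne] := small _ e2; have [M xM] := xl _ e2.
pose n := maxn N M; apply: filterS (Fx n) => y /= xy.
rewrite nrmE ltcR; apply: le_lt_trans (nrm_triangle (x n) _ _) _.
have := xM n (leq_maxr _ _); have := dN _ _ (leq_maxl N M); rewrite (nrmC l) -/n.
by lra.
Qed.

(** * Closed subspaces and orthogonal projection *)

Section HilbertSpace.
Context (R : realType) (H : hilbert R).
Implicit Types (x y z v w : H) (a : R[i]) (t : R).

Lemma ip_inj x y : (forall z, ip x z = ip y z) -> x = y.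
Proof.
move=> xy; apply/eqP; rewrite -subr_eq0; apply/eqP/hilb_def.
by rewrite ipBl xy subrr.
Qed.

Lemma hn_eq0 x : hn x = 0 -> x = 0.
Proof. by move=> x0; apply: hilb_def; rewrite ip_hn x0 expr0n. Qed.

Lemma parallelogram x y :
  hn (x + y) ^+ 2 + hn (x - y) ^+ 2 = 2 * (hn x ^+ 2 + hn y ^+ 2).
Proof.
by rewrite !hn_sqr ipDl ipBl !ipDr !ipNr !(raddfB, raddfD, raddfN)/=; ring.
Qed.

Record closed_subspace (W : set H) : Prop := ClosedSubspace {
  subspace_lin : forall a x y, W x -> W y -> W (a *: x + y);
  subspace_0 : W 0;
  subspace_closed : forall l,
    (forall e, 0 < e -> exists2 x, W x & hn (l - x) < e) -> W l
}.

(** The parallelogram law makes a minimizing sequence Cauchy, because the midpoint of two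
    near-minimizers is again in W. *)
Lemma nearest_point (W : set H) v : closed_subspace W ->
  exists2 p, W p & forall w, W w -> hn (v - p) <= hn (v - w).
Proof.
move=> [Wl W0 Wc]; pose D := [set hn (v - w) ^+ 2 | w in W].
have Dinf : has_inf D.
  split; first by exists (hn (v - 0) ^+ 2), 0.
  by exists 0 => _ [w _ <-]; rewrite exprn_ge0// hn_ge0.
have D_le w : W w -> inf D <= hn (v - w) ^+ 2.
  by move=> Ww; apply: ge_inf; [exact: Dinf.2|exists w].
have D0 : 0 <= inf D.
  apply: lb_le_inf; first exact: Dinf.1.
  by move=> _ [w _ <-]; rewrite exprn_ge0// hn_ge0.
have close w w' t : W w -> W w' -> hn (v - w) ^+ 2 <= inf D + t ->
    hn (v - w') ^+ 2 <= inf D + t -> hn (w - w') ^+ 2 <= 4 * t.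
  move=> Ww Ww' wt wt'.
  have := parallelogram (v - w) (v - w').
  have -> : v - w - (v - w') = - (w - w').
    by rewrite !opprB addrC addrA subrK.
  rewrite hnN.
  pose m := (2^-1 : R)%:C *: (w + w').
  have -> : v - w + (v - w') = 2%:C *: (v - m).
    rewrite scalerBr /m scalerA -rmorphM mulfV// scale1r addrACA -opprD.
    by congr (_ - _); rewrite rmorphD rmorph1 scalerDl scale1r.
  rewrite hnZ cabs_real exprMn ger0_norm//.
  have : inf D <= hn (v - m) ^+ 2.
    apply: D_le; rewrite /m -[_ *: _]addr0; apply: (Wl) => //.
    by rewrite -[w]scale1r; exact: Wl.
  by lra.
pose d n : R := n.+1%:R^-1.
have d0 : forall n, 0 < d n := @invnS_gt0 R.
have dN : forall n m, (n <= m)%N -> d m <= d n := @invnS_le R.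
have small : forall e, 0 < e -> exists N, d N < e := @invnS_small R.
have /choice[w Dw] n : exists w, W w /\ hn (v - w) ^+ 2 <= inf D + d n.
  by have [_ [w Ww <-] /ltW h] := inf_adherent (d0 n) Dinf; exists w.
have [e e0|p wp] := @hilb_complete _ H w.
  have [|N Ne] := small (e ^+ 2 / 4); first by rewrite divr_gt0// exprn_gt0.
  exists N => n m Nn Nm; rewrite -ltr_sqr ?nnegrE ?hn_ge0 ?(ltW e0)//.
  apply: (@le_lt_trans _ _ (4 * d N)); last by lra.
  have [[Wn hwn] [Wm hwm]] := (Dw n, Dw m).
  by apply: close => //; have := dN _ _ Nn; have := dN _ _ Nm; lra.
exists p.
  apply: Wc => e /wp[N /(_ N (leqnn N)) h]; exists (w N); last by rewrite hnC.
  by case: (Dw N).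
move=> w' Ww'; rewrite -ler_sqr ?nnegrE ?hn_ge0//.
apply: le_trans (D_le _ Ww').
have hp0 := hn_ge0 (v - p).
apply/ler_addgt0Pl => e e0.
have K0 : 0 < 2 * hn (v - p) + 1 by rewrite ltr_wpDl ?mulr_ge0.
have e1 : 0 < e / 2 / (2 * hn (v - p) + 1) by rewrite !divr_gt0.
have e2 : 0 < e / 2 by rewrite divr_gt0.
have [N wN] := wp _ e1; have [M dM] := small _ e2.
pose n := maxn N M.
have := wN n (leq_maxl _ _); have := dN _ _ (leq_maxr N M); rewrite -/n.
have [Wn] := Dw n; have := hn_triangle (w n) v p.
set h := hn (v - p) in hp0 K0 e1 wN *; set k := hn (v - w n).
set l := hn (w n - p); have k0 : 0 <= k := hn_ge0 _; have l0 : 0 <= l := hn_ge0 _.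
move=> hkl hk dn ln.
have : l * (2 * h + 1) < e / 2 by rewrite -ltr_pdivlMr.
(* The inequality h - l <= k may be squared only when h - l is nonnegative; otherwise h^2 <= l h is
   already small. *)
have [hl|lh] := leP h l.
  have : h * h <= l * h by rewrite ler_wpM2r.
  by rewrite expr2; have := mulr_ge0 l0 hp0; lra.
have : (h - l) ^+ 2 <= k ^+ 2.
  by rewrite ler_sqr ?nnegrE ?subr_ge0 ?(ltW lh)//; lra.
rewrite sqrrB; have := sqr_ge0 l.
by lra.
Qed.

(** With c the inner product in question, minimality against the vectors t c w reads 2 t m <= t^2 m
    b, where m is the squared modulus of c and b the squared norm of w. The choice t = 1/(b + 1)
    yields 2 m <= m. *)
Lemma nearest_orthogonal (W : set H) v p : closed_subspace W -> W p ->
  (forall w, W w -> hn (v - p) <= hn (v - w)) ->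
  forall w, W w -> ip (v - p) w = 0.
Proof.
move=> [Wl W0 _] Wp pmin w Ww.
have xW a : hn (v - p) <= hn (v - p - a *: w).
  by rewrite -addrA -opprD [p + _]addrC; apply/pmin/Wl.
move: (v - p) xW => x xW; set c := ip x w.
set m := cabs c ^+ 2; set b := hn w ^+ 2.
have mE : m%:C = c * c^*%C by exact: cabs_sqr.
have quad t : 2 * t * m <= t ^+ 2 * m * b.
  have h : hn x ^+ 2 <= hn (x - (t%:C * c) *: w) ^+ 2.
    by rewrite ler_sqr ?nnegrE ?hn_ge0.
  have conj_t : (t%:C * c)^*%C = t%:C * c^*%C.
    by rewrite rmorphM; congr (_ * _); exact: conjc_real.
  have : (hn (x - (t%:C * c) *: w) ^+ 2)%:C =
      (hn x ^+ 2 - 2 * t * m + t ^+ 2 * m * b)%:C.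
    rewrite -ip_hn ipBl !ipBr !ipZl !ipZr !ip_hn -/b (ip_conj x w) -/c conj_t.
    transitivity ((hn x ^+ 2)%:C - 2 * t%:C * (c * c^*%C)
      + t%:C ^+ 2 * (c * c^*%C) * b%:C); first by ring.
    by rewrite -mE; ring.
  by move=> /(fmorph_inj (@real_complex R)) e; move: h; rewrite e; lra.
have b0 : 0 <= b by rewrite exprn_ge0// hn_ge0.
have b1 : 0 < b + 1 by rewrite ltr_wpDl.
have m0 : 0 <= m by rewrite exprn_ge0// cabs_ge0.
have := quad (b + 1)^-1.
have -> : (b + 1)^-1 ^+ 2 * m * b = (b + 1)^-1 * (m * (b / (b + 1))) by field; rewrite gt_eqF.
have -> : 2 * (b + 1)^-1 * m = (b + 1)^-1 * (2 * m) by ring.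
rewrite ler_pM2l ?invr_gt0// => h.
have : m * (b / (b + 1)) <= m * 1.
  by rewrite ler_wpM2l// ler_pdivrMr// mul1r lerDl.
move=> h'; apply: cabs_eq0; apply/eqP; rewrite -sqrf_eq0 -/m eq_le m0 andbT.
by lra.
Qed.

End HilbertSpace.

(** * The C*-algebra of bounded operators *)

Definition adjoints (R : realType) (V : preip R) (T S : V -> V) :=
  forall v w, ip (T v) w = ip v (S w).

(** Requiring an adjoint spares the Riesz representation theorem; it also forces linearity, as
    [bop_lin] shows. *)
Definition bop_pred (R : realType) (H : hilbert R) : {pred H -> H} :=
  fun T => `[< (exists K, forall v, hn (T v) <= K * hn v) /\
               exists S, adjoints T S >].

Record bop (R : realType) (H : hilbert R) := Bop {
  bop_fun :> H -> H;
  _ : bop_pred bop_fun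
}.

Section BoundedOperators.
Context (R : realType) (H : hilbert R).
Implicit Types (v w : H) (a : R[i]).
Local Notation B := (bop H).

HB.instance Definition _ := [isSub for @bop_fun R H].
HB.instance Definition _ := [Choice of B by <:].

Fact bop_submod : GRing.subsemimod_closed (@bop_pred R H).
Proof.
split=> [|a T /asboolP[[K TK] [S TS]]]; last first.
  apply/asboolP; split.
    exists (cabs a * K) => v; rewrite hnZ -mulrA ler_wpM2l ?cabs_ge0//.
  exists (fun w => a^*%C *: S w) => v w.
  by rewrite ipZl ipZr TS conjcK.
split=> [|T T' /asboolP[[K TK] [S TS]] /asboolP[[K' TK'] [S' TS']]].
  apply/asboolP; split; first by exists 0 => v; rewrite hn0 mul0r.
  by exists (fun=> 0) => v w; rewrite ip0l ip0r.
apply/asboolP; split.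
  exists (K + K') => v; rewrite mulrDl; apply: le_trans (hnD _ _) _.
  exact: lerD.
by exists (fun w => S w + S' w) => v w; rewrite ipDl ipDr TS TS'.
Qed.

HB.instance Definition _ :=
  GRing.SubChoice_isSubLmodule.Build R[i] (H -> H) _ B bop_submod.

Lemma bopP (T S : B) : (forall v, T v = S v) -> T = S.
Proof. by move=> TS; apply/val_inj/funext. Qed.

Lemma bopDE (T S : B) v : (T + S) v = T v + S v. Proof. by []. Qed.
Lemma bopZE a (T : B) v : (a *: T) v = a *: T v. Proof. by []. Qed.
Lemma bopBE (T S : B) v : (T - S) v = T v - S v.
Proof. by rewrite -[- S]scaleN1r bopDE bopZE scaleN1r. Qed.

Lemma bop_lin (T : B) a v w : T (a *: v + w) = a *: T v + T w.
Proof.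
case: T => T /= /asboolP[_ [S TS]]; apply: ip_inj => z.
by rewrite TS !ipDl !ipZl !TS.
Qed.

Lemma bop_0 (T : B) : T 0 = 0.
Proof. by have := bop_lin T (-1) 0 0; rewrite scaler0 addr0 scaleN1r addNr. Qed.
Lemma bop_Z (T : B) a v : T (a *: v) = a *: T v.
Proof. by have := bop_lin T a v 0; rewrite bop_0 !addr0. Qed.
Lemma bop_D (T : B) v w : T (v + w) = T v + T w.
Proof. by have := bop_lin T 1 v w; rewrite !scale1r. Qed.
Lemma bop_B (T : B) v w : T (v - w) = T v - T w.
Proof. by rewrite bop_D -scaleN1r bop_Z scaleN1r. Qed.

Definition opn (T : B) : R := sup [set hn (T v) | v in [set v | hn v <= 1]].

Let opn_has_sup (T : B) : has_sup [set hn (T v) | v in [set v | hn v <= 1]].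
Proof.
split; first by exists (hn (T 0)), 0 => //=; rewrite hn0 ler01.
case: T => T /= /asboolP[[K TK] _]; exists `|K| => _ [v /= v1 <-].
apply: le_trans (TK v) _; apply: le_trans (ler_wpM2r (hn_ge0 v) (ler_norm K)) _.
by rewrite ler_piMr.
Qed.

Lemma opn_ge0 T : 0 <= opn T.
Proof.
apply: le_trans (hn_ge0 (T 0)) _; apply: ub_le_sup; first exact: (opn_has_sup T).2.
by exists 0 => //=; rewrite hn0 ler01.
Qed.

Lemma hn_bop (T : B) v : hn (T v) <= opn T * hn v.
Proof.
have [v0|v0] := eqVneq (hn v) 0; first by rewrite (hn_eq0 v0) bop_0 hn0 mulr0.
have v1 : 0 < hn v by rewrite lt_neqAle eq_sym v0 hn_ge0.
rewrite -ler_pdivrMr// mulrC.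
have -> : (hn v)^-1 * hn (T v) = hn (T ((hn v)^-1%:C *: v)).
  by rewrite bop_Z hnZ cabs_real ger0_norm// invr_ge0 hn_ge0.
apply: ub_le_sup; first exact: (opn_has_sup T).2.
exists ((hn v)^-1%:C *: v) => //=.
by rewrite hnZ cabs_real ger0_norm ?invr_ge0 ?hn_ge0// mulVf.
Qed.

Lemma opn_le (T : B) K : 0 <= K -> (forall v, hn (T v) <= K * hn v) -> opn T <= K.
Proof.
move=> K0 TK; apply: ge_sup; first exact: (opn_has_sup T).1.
move=> _ [v /= v1 <-]; apply: le_trans (TK v) _.
by rewrite ler_piMr.
Qed.

Definition bop_norm (T : B) : R[i] := (opn T)%:C.

Fact bop_ler_normD (T S : B) : bop_norm (T + S) <= bop_norm T + bop_norm S.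
Proof.
rewrite -rmorphD lecR; apply: opn_le => [|v]; first by rewrite addr_ge0 ?opn_ge0.
rewrite bopDE mulrDl; apply: le_trans (hnD _ _) _.
by apply: lerD; exact: hn_bop.
Qed.

Fact bop_normrZ a (T : B) : bop_norm (a *: T) = `|a| * bop_norm T.
Proof.
have le b (S : B) : opn (b *: S) <= cabs b * opn S.
  apply: opn_le => [|v]; first by rewrite mulr_ge0 ?cabs_ge0 ?opn_ge0.
  by rewrite bopZE hnZ -mulrA ler_wpM2l ?cabs_ge0 ?hn_bop.
rewrite cabsE /bop_norm -rmorphM; congr (_%:C); apply/eqP; rewrite eq_le le /=.
have [->|a0] := eqVneq a 0; first by rewrite cabs0 mul0r opn_ge0.
have a1 : 0 < cabs a by rewrite -ltcR -cabsE normr_gt0.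
have := ler_wpM2l (cabs_ge0 a) (le a^-1 (a *: T)).
by rewrite scalerA mulVf// scale1r mulrA -cabsM mulfV// cabs1 mul1r.
Qed.

Fact bop_normr0_eq0 (T : B) : bop_norm T = 0 -> T = 0.
Proof.
move=> T0; apply: bopP => v; apply: hn_eq0; apply/eqP.
rewrite eq_le hn_ge0 andbT; apply: le_trans (hn_bop T v) _.
have -> : opn T = 0 by apply: (fmorph_inj (@real_complex R)).
by rewrite mul0r.
Qed.

HB.instance Definition _ := Lmodule_isNormed.Build R[i] B
  bop_ler_normD bop_normrZ bop_normr0_eq0.

Lemma nrm_bop (T : B) : nrm T = opn T.
Proof. by []. Qed.

Lemma bop_adj_exists (T : B) : exists S : B, adjoints T S.
Proof.
have [S TS] : exists S, adjoints T S by case: T => T /= /asboolP[].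
suff Sb : bop_pred S by exists (Bop Sb).
apply/asboolP; split; last first.
  by exists T => v w; rewrite ip_conj -TS -ip_conj.
exists (opn T) => w; have := hn_ge0 (S w); rewrite le_eqVlt => /orP[/eqP<-|Sw].
  by rewrite mulr_ge0 ?opn_ge0 ?hn_ge0.
rewrite -(ler_pM2l Sw); apply: (@le_trans _ _ (cabs (ip (T (S w)) w))).
  by rewrite TS ip_hn cabs_real ger0_norm ?exprn_ge0 ?hn_ge0.
apply: le_trans (cauchy_schwarz _ _) _.
by rewrite mulrA (mulrC (hn (S w))) ler_wpM2r ?hn_ge0 ?hn_bop.
Qed.

Definition bop_adj (T : B) : B := sval (cid (bop_adj_exists T)).

Lemma bop_adjP (T : B) v w : ip (T v) w = ip v (bop_adj T w).
Proof. exact: (svalP (cid (bop_adj_exists T))). Qed.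

Lemma bop_adj_unique (T S : B) : adjoints T S -> bop_adj T = S.
Proof.
move=> TS; apply: bopP => w; apply: ip_inj => v.
by rewrite ip_conj -bop_adjP TS -ip_conj.
Qed.

Fact bop_adjK : involutive bop_adj.
Proof.
move=> T; apply: bop_adj_unique => v w.
by rewrite ip_conj -bop_adjP -ip_conj.
Qed.

Fact bop_adjD : {morph bop_adj : T S / T + S}.
Proof.
move=> T S; apply: bop_adj_unique => v w.
by rewrite !bopDE ipDl ipDr !bop_adjP.
Qed.

Fact bop_adjZ a (T : B) : bop_adj (a *: T) = a^*%C *: bop_adj T.
Proof.
apply: bop_adj_unique => v w.
by rewrite !bopZE ipZl ipZr bop_adjP conjcK.
Qed.

Lemma bop_adjB (T S : B) : bop_adj (T - S) = bop_adj T - bop_adj S.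
Proof.
by rewrite -[- S]scaleN1r bop_adjD bop_adjZ rmorphN rmorph1 scaleN1r.
Qed.

Lemma opn_adj_le (T : B) : opn (bop_adj T) <= opn T.
Proof.
apply: opn_le => [|w]; first exact: opn_ge0.
have := hn_ge0 (bop_adj T w); rewrite le_eqVlt => /orP[/eqP<-|Sw].
  by rewrite mulr_ge0 ?opn_ge0 ?hn_ge0.
rewrite -(ler_pM2l Sw); apply: (@le_trans _ _ (cabs (ip (T (bop_adj T w)) w))).
  by rewrite bop_adjP ip_hn cabs_real ger0_norm ?exprn_ge0 ?hn_ge0.
apply: le_trans (cauchy_schwarz _ _) _.
by rewrite mulrA (mulrC (hn (bop_adj T w))) ler_wpM2r ?hn_ge0 ?hn_bop.
Qed.

Lemma ncauchy_pointwise (u : nat -> B) : ncauchy u -> exists T : H -> H,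
  forall e, 0 < e -> exists N, forall n v, (N <= n)%N ->
    hn (u n v - T v) <= e * hn v.
Proof.
move=> uc; have pt n m v : hn (u n v - u m v) <= nrm (u n - u m) * hn v.
  by rewrite -bopBE nrm_bop hn_bop.
have uhc v : hcauchy (fun n => u n v).
  move=> e e0; have K0 : 0 < hn v + 1 by rewrite ltr_wpDl ?hn_ge0.
  have [|N uN] := uc (e / (hn v + 1)); first by rewrite divr_gt0.
  exists N => n m Nn Nm; apply: le_lt_trans (pt n m v) _.
  have := ltW (uN n m Nn Nm) => /(ler_wpM2r (hn_ge0 v))/le_lt_trans; apply.
  by rewrite mulrAC ltr_pdivrMr// mulrDr mulr1 ltrDl.
have /choice[T uT] v := hilb_complete (uhc v).
exists T => e /uc[N uN]; exists N => n v Nn; apply/ler_addgt0Pl => e' /(uT v)[M uM].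
pose k := maxn N M; apply: le_trans (hn_triangle (u k v) _ _) _.
rewrite addrC; apply: lerD; first by rewrite ltW// uM// leq_maxr.
apply: le_trans (pt _ _ _) _; rewrite ler_wpM2r ?hn_ge0// ltW//.
by rewrite uN// leq_maxl.
Qed.

(** The adjoints form a Cauchy sequence too, and their pointwise limit is an adjoint of the
    pointwise limit of [u]. *)
Fact bop_seq_complete (u : nat -> B) : ncauchy u -> exists T, ncvg u T.
Proof.
move=> uc; have [T uT] := ncauchy_pointwise uc.
have [|S uS] := @ncauchy_pointwise (bop_adj \o u).
  move=> e /uc[N uN]; exists N => n m Nn Nm /=.
  by rewrite -bop_adjB; apply: le_lt_trans (opn_adj_le _) (uN n m Nn Nm).
have TP : bop_pred T.
  apply/asboolP; split.
    have [N uN] := uT 1 ltr01; exists (opn (u N) + 1) => v.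
    rewrite -[T v](subrK (u N v)) addrC mulrDl; apply: le_trans (hnD _ _) _.
    by apply: lerD; [exact: hn_bop|rewrite hnC uN].
  exists S => v w; apply/eqP; rewrite -subr_eq0; apply/eqP/cabs_small_eq0 => e e0.
  pose K := 2 * hn v * hn w + 1.
  have K0 : 0 < K by rewrite ltr_wpDl// !mulr_ge0 ?hn_ge0.
  have e1 : 0 < e / K by rewrite divr_gt0.
  have [N uN] := uT _ e1; have [M uM] := uS _ e1; pose n := maxn N M.
  have -> : ip (T v) w - ip v (S w) =
      - ip (u n v - T v) w + ip v (bop_adj (u n) w - S w).
    by rewrite ipBl ipBr bop_adjP opprB subrKA.
  apply: le_trans (cabsD _ _) _; rewrite cabsN.
  have := cauchy_schwarz (u n v - T v) w.
  have := cauchy_schwarz v (bop_adj (u n) w - S w).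
  have := ler_wpM2r (hn_ge0 w) (uN n v (leq_maxl _ _)).
  have := ler_wpM2l (hn_ge0 v) (uM n w (leq_maxr _ _)).
  have : e / K * (2 * hn v * hn w) <= e.
    by rewrite mulrAC ler_pdivrMr// /K mulrDr mulr1 lerDl ltW.
  rewrite /=; lra.
exists (Bop TP) => e e0; have e2 : 0 < e / 2 by rewrite divr_gt0.
have [N uN] := uT _ e2; exists N => n Nn; rewrite nrm_bop.
apply: (@le_lt_trans _ _ (e / 2)); last by lra.
by apply: opn_le => [|v]; [exact: ltW|rewrite bopBE uN].
Qed.

Fact bop_complete (F : set_system B) : ProperFilter F -> cauchy F -> cvg F.
Proof. exact: (ncauchy_complete bop_seq_complete). Qed.

HB.instance Definition _ := Uniform_isComplete.Build B bop_complete.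

Fact bop_one_subproof : bop_pred (fun v : H => v).
Proof.
apply/asboolP; split; first by exists 1 => v; rewrite mul1r.
by exists id.
Qed.
Definition bop_one : B := Bop bop_one_subproof.

Fact bop_mul_subproof (T S : B) : bop_pred (fun v : H => T (S v)).
Proof.
apply/asboolP; split.
  exists (opn T * opn S) => v; rewrite -mulrA.
  by apply: le_trans (hn_bop _ _) _; rewrite ler_wpM2l ?opn_ge0 ?hn_bop.
by exists (fun w => bop_adj S (bop_adj T w)) => v w; rewrite !bop_adjP.
Qed.
Definition bop_mul (T S : B) : B := Bop (bop_mul_subproof T S).

Fact bop_mulA : associative bop_mul.
Proof. by move=> T S U; apply: bopP. Qed.
Fact bop_mul1x : left_id bop_one bop_mul.
Proof. by move=> T; apply: bopP. Qed.
Fact bop_mulx1 : right_id bop_one bop_mul.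
Proof. by move=> T; apply: bopP. Qed.
Fact bop_mulDl : left_distributive bop_mul +%R.
Proof. by move=> T S U; apply: bopP. Qed.
Fact bop_mulDr : right_distributive bop_mul +%R.
Proof. by move=> T S U; apply: bopP => v /=; exact: bop_D. Qed.
Fact bop_scaleAl a (T S : B) : a *: bop_mul T S = bop_mul (a *: T) S.
Proof. by apply: bopP. Qed.
Fact bop_scaleAr a (T S : B) : a *: bop_mul T S = bop_mul T (a *: S).
Proof. by apply: bopP => v; rewrite [RHS]bop_Z. Qed.
Fact bop_adjM (T S : B) : bop_adj (bop_mul T S) = bop_mul (bop_adj S) (bop_adj T).
Proof. by apply: bop_adj_unique => v w; rewrite /= !bop_adjP. Qed.
Fact bop_normM (T S : B) : `|bop_mul T S| <= `|T| * `|S|.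
Proof.
rewrite !nrmE -rmorphM lecR; apply: opn_le => [|v].
  by rewrite mulr_ge0 ?nrm_ge0.
rewrite -mulrA; apply: le_trans (hn_bop T (S v)) _.
by rewrite ler_wpM2l ?opn_ge0 ?hn_bop.
Qed.
Fact bop_identity (T : B) : `|bop_mul (bop_adj T) T| = `|T| ^+ 2.
Proof.
apply/eqP; rewrite eq_le; apply/andP; split.
  apply: le_trans (bop_normM _ _) _; rewrite expr2 ler_wpM2r//.
  by rewrite !nrmE lecR; exact: opn_adj_le.
rewrite !nrmE -rmorphXn lecR; set m := nrm (bop_mul _ _).
have m0 : 0 <= m by exact: nrm_ge0.
rewrite -[leRHS]sqr_sqrtr// ler_sqr ?nnegrE ?sqrtr_ge0 ?nrm_ge0//.
apply: opn_le => [|v]; first exact: sqrtr_ge0.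
rewrite -ler_sqr ?nnegrE ?mulr_ge0 ?sqrtr_ge0 ?hn_ge0// exprMn (sqr_sqrtr m0).
have : cabs (ip v (bop_mul (bop_adj T) T v)) <= hn v * hn (bop_mul (bop_adj T) T v).
  exact: cauchy_schwarz.
rewrite /= -bop_adjP ip_hn cabs_real ger0_norm ?exprn_ge0 ?hn_ge0// => h.
apply: le_trans h _; rewrite [leRHS]mulrC expr2 -mulrA ler_wpM2l ?hn_ge0//.
by rewrite mulrC; exact: (hn_bop (bop_mul (bop_adj T) T)).
Qed.

HB.instance Definition _ := NormedModule_isCStarAlgebra.Build R B
  bop_mulA bop_mul1x bop_mulx1 bop_mulDl bop_mulDr
  bop_scaleAl bop_scaleAr bop_adjK bop_adjD bop_adjZ
  bop_adjM bop_normM bop_identity.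

Definition bop_alg : cstarAlgType R := B.

Lemma bopME (T S : bop_alg) v : bop_fun (T * S) v = bop_fun T (bop_fun S v).
Proof. by []. Qed.
Lemma adj_bopP (T : bop_alg) v w :
  ip (bop_fun T v) w = ip v (bop_fun (adj T) w).
Proof. exact: bop_adjP. Qed.
Lemma adj_bop_unique (T S : bop_alg) :
  adjoints (bop_fun T) (bop_fun S) -> adj T = S.
Proof. exact: bop_adj_unique. Qed.

Lemma projection_exists (W : set H) : closed_subspace W -> exists q : bop_alg,
  [/\ adj q = q, forall v, W (bop_fun q v) &
      forall v w, W w -> ip (v - bop_fun q v) w = 0].
Proof.
move=> Ws; have /choice[q qP] v : exists p, W p /\ forall w, W w -> ip (v - p) w = 0.
  have [p Wp pmin] := nearest_point v Ws.
  by exists p; split=> //; exact: nearest_orthogonal pmin.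
have ipq v w : W w -> ip v w = ip (q v) w.
  move=> Ww; have [_ /(_ w Ww)] := qP v.
  by rewrite ipBl => /eqP; rewrite subr_eq0 => /eqP.
have Wq v : W (q v) by case: (qP v).
have qa : adjoints q q.
  by move=> v w; rewrite (ipq v _ (Wq w)) ip_conj (ipq w _ (Wq v)) -ip_conj.
have qB : bop_pred q.
  apply/asboolP; split; last by exists q.
  exists 1 => v; rewrite mul1r; have := hn_ge0 (q v).
  rewrite le_eqVlt => /orP[/eqP<-|qv]; first exact: hn_ge0.
  rewrite -(ler_pM2r qv) -expr2; have := cauchy_schwarz v (q v).
  by rewrite (ipq v _ (Wq v)) ip_hn cabs_real ger0_norm ?exprn_ge0 ?hn_ge0.
exists (Bop qB); split=> //; first exact: adj_bop_unique.
by move=> v w Ww /=; case: (qP v) => _; apply.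
Qed.

End BoundedOperators.

(** * Extension of representations of a commutative C*-algebra *)

Lemma mul_continuous_nrm (R : realType) (A : cstarAlgType R) (x y : A) (e : R) :
  0 < e -> exists2 d, 0 < d & forall x' y' : A,
    nrm (x - x') < d -> nrm (y - y') < d -> nrm (x * y - x' * y') < e.
Proof.
move=> e0; pose K := nrm x + nrm y + 2.
have K0 : 0 < K by rewrite ltr_wpDl ?addr_ge0 ?nrm_ge0.
exists (Num.min 1 (e / K)); first by rewrite lt_min ltr01 divr_gt0.
move=> x' y'; rewrite !lt_min => /andP[x1 xe] /andP[y1 ye].
have -> : x * y - x' * y' = (x - x') * y + x' * (y - y').
  by rewrite mulrBl mulrBr addrA subrK.
apply: le_lt_trans (nrmD _ _) _.
have := nrmM (x - x') y; have := nrmM x' (y - y').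
have := nrmD (x' - x) x; rewrite subrK (nrmC x').
have := ler_wpM2r (nrm_ge0 y) (ltW xe) => h1 h2.
have : nrm x' * nrm (y - y') <= (nrm x + 1) * (e / K).
  by rewrite ler_pM ?nrm_ge0 ?(ltW ye)//; lra.
have : e = (nrm x + nrm y + 2) * (e / K) by rewrite -/K mulrC divfK// gt_eqF.
have : 0 < e / K by rewrite divr_gt0.
by lra.
Qed.

Section StarHom.
Context (R : realType) (A B : cstarAlgType R) (f : A -> B).
Hypothesis f_hom : star_hom f.

Lemma star_hom_lin a x y : f (a *: x + y) = a *: f x + f y.
Proof. by case: f_hom => /(_ a x y). Qed.
Lemma star_homD x y : f (x + y) = f x + f y.
Proof. by have := star_hom_lin 1 x y; rewrite !scale1r. Qed.
Lemma star_hom0 : f 0 = 0.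
Proof. by apply: (addrI (f 0)); rewrite -star_homD !addr0. Qed.
Lemma star_homZ a x : f (a *: x) = a *: f x.
Proof. by have := star_hom_lin a x 0; rewrite star_hom0 !addr0. Qed.
Lemma star_homB x y : f (x - y) = f x - f y.
Proof. by rewrite -[- y]scaleN1r star_homD star_homZ scaleN1r. Qed.
Lemma star_hom1 : f 1 = 1.
Proof. by case: f_hom => _ []. Qed.
Lemma star_homM x y : f (x * y) = f x * f y.
Proof. by case: f_hom => _ []. Qed.
Lemma star_hom_adj x : f (adj x) = adj (f x).
Proof. by case: f_hom. Qed.

Lemma star_hom_pos x : pos x -> pos (f x).
Proof.
move=> /pos_sqrt[s [ps <- _ _]]; rewrite star_homM; apply: pos_sqr.
by rewrite -star_hom_adj pos_adj.
Qed.

(** Contractivity comes from order: f preserves positivity because positive elements are squares,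
    and [nrm x ^+ 2] minus [adj x * x] is positive. *)
Lemma star_hom_nrm x : nrm (f x) <= nrm x.
Proof.
rewrite -ler_sqr ?nnegrE ?nrm_ge0// -nrm_adjM -star_hom_adj -star_homM.
apply: pos_le_nrm; first by rewrite exprn_ge0// nrm_ge0.
  exact/star_hom_pos/star_pos.
have -> : sc B (nrm x ^+ 2) = f (sc A (nrm x ^+ 2)).
  by rewrite star_homZ star_hom1.
rewrite -star_homB; apply: star_hom_pos; apply: pos_scB; rewrite ?nrm_adjM//.
by rewrite cadjM adjK.
Qed.

End StarHom.

(** * Bounded functions: positivity, indicators and truncation *)

Section LinfFacts.
Context (R : realType) (X : Type).

Definition linf_alg : cstarAlgType R := linf R X.
Implicit Types (f g : linf_alg) (x : X).

Lemma linfME f g x : linf_fun (f * g) x = linf_fun f x * linf_fun g x.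
Proof. by []. Qed.
Lemma linf1E x : linf_fun (1 : linf_alg) x = 1. Proof. by []. Qed.
Lemma linfadjE f x : linf_fun (adj f) x = (linf_fun f x)^*%C. Proof. by []. Qed.
Lemma linfaddE f g x : linf_fun (f + g) x = linf_fun f x + linf_fun g x.
Proof. by []. Qed.
Lemma linfscaleE a f x : linf_fun (a *: f) x = a * linf_fun f x.
Proof. by []. Qed.
Lemma linfsubE f g x : linf_fun (f - g) x = linf_fun f x - linf_fun g x.
Proof. by rewrite -[- g]scaleN1r linfaddE linfscaleE mulN1r. Qed.
Lemma linfscE t x : linf_fun (sc linf_alg t) x = t%:C.
Proof. by rewrite linfscaleE linf1E mulr1. Qed.

Lemma cabs_linf f x : cabs (linf_fun f x) <= nrm f.
Proof. by rewrite -lecR -cabsE -nrmE; exact: linf_norm_ub. Qed.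

Lemma nrm_linf_le f t : 0 <= t -> (forall x, cabs (linf_fun f x) <= t) -> nrm f <= t.
Proof.
move=> t0 ft; rewrite -lecR -nrmE; apply: linf_norm_lub; first by rewrite lecR.
by move=> x; rewrite cabsE lecR.
Qed.

Lemma linf_sa f x : adj f = f -> linf_fun f x = (complex.Re (linf_fun f x))%:C.
Proof.
move=> fa; have := linfadjE f x; rewrite fa.
case: (linf_fun f x) => a b /= [] /eqP; rewrite -addr_eq0 -mulr2n mulrn_eq0/=.
by move=> /eqP->.
Qed.

Lemma linf_pos f x : pos f -> 0 <= linf_fun f x.
Proof.
move=> /pos_sqrt[s [/pos_adj sa <- _ _]].
by rewrite linfME (linf_sa _ sa) -rmorphM lecR -expr2 sqr_ge0.
Qed.

Fact indicator_subproof (E : set X) :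
  linf_bounded (fun x => (x \in E)%:R : R[i]).
Proof.
by apply/asboolP; exists 1 => x; case: (x \in E); rewrite ?normr1 ?normr0.
Qed.
Definition indicator (E : set X) : linf_alg := Linf (indicator_subproof E).

Lemma indicator_in E x : E x -> linf_fun (indicator E) x = 1.
Proof. by move=> Ex; rewrite /= mem_set. Qed.
Lemma indicator_out E x : ~ E x -> linf_fun (indicator E) x = 0.
Proof. by move=> Ex; rewrite /= memNset. Qed.

Definition subalgebra (D : set linf_alg) := [/\ nclosed D, D 1,
  forall a f g, D f -> D g -> D (a *: f + g) &
  forall f g, D f -> D g -> D (f * g)].

(** m is the minimum of f and t, written as (f + t - |f - t|)/2. The modulus is the root of (f -
    t)^2, which [pos_sqrt] keeps inside D. *)
Lemma subalgebra_truncate (D : set linf_alg) f t : subalgebra D -> pos f ->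
  D f -> 0 <= t -> exists m, [/\ D m, nrm m <= t &
    forall x, linf_fun f x <= t%:C -> linf_fun m x = linf_fun f x].
Proof.
move=> [Dc D1 Dl Dm] pf Df t0; have fa := pos_adj pf.
have DD g g' : D g -> D g' -> D (g + g') by rewrite -{2}[g]scale1r; exact: Dl.
have D0 : D 0 by have := Dl (-1) _ _ D1 D1; rewrite scaleN1r addNr.
have DZ a g : D g -> D (a *: g) by move=> Dg; rewrite -[_ *: _]addr0; exact: Dl.
pose h := f - sc linf_alg t.
have ha : adj h = h by rewrite adjB adj_sc fa.
have Dh : D h by rewrite /h -scN; apply: DD => //; exact: DZ.
have [s [ps sE _ sD]] := pos_sqrt (pos_sqr ha).
have Ds : D s by apply: sD => //; [move=> g Dg; exact: Dm|exact: Dm].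
have sx x : linf_fun s x = `|linf_fun f x - t%:C|.
  have s0 := linf_pos x ps.
  have : linf_fun s x ^+ 2 = (linf_fun f x - t%:C) ^+ 2.
    by rewrite !expr2 -linfME sE linfME !linfsubE linfscE.
  have fr : linf_fun f x - t%:C = (complex.Re (linf_fun f x) - t)%:C.
    by rewrite (linf_sa x fa) -rmorphB.
  rewrite fr -[X in _ = X](@real_normK _ (complex.Re (linf_fun f x) - t)%:C); last first.
    by apply/complex_realP; eexists.
  by move=> /eqP; rewrite eqrXn2// => /eqP.
pose m := (2^-1)%:C *: (f + sc linf_alg t - s).
have fr x : linf_fun f x = (complex.Re (linf_fun f x))%:C by exact: linf_sa.
have mx x : linf_fun m x =
    ((complex.Re (linf_fun f x) + t - `|complex.Re (linf_fun f x) - t|) / 2)%:C.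
  rewrite /m linfscaleE linfsubE linfaddE linfscE sx fr -rmorphB.
  by rewrite cabsE cabs_real mulrC !(rmorphM, rmorphB, rmorphD).
exists m; split.
- apply: (DZ); rewrite -scaleN1r addrC; apply: Dl => //.
  by apply: DD => //; exact: DZ.
- apply: nrm_linf_le => // x; rewrite mx cabs_real ler_norml.
  have : 0 <= complex.Re (linf_fun f x) by rewrite -lecR -fr; exact: linf_pos.
  by case: (ger0P (complex.Re (linf_fun f x) - t)) => ? ?; apply/andP; split; lra.
- move=> x; rewrite mx fr lecR /= => ft; congr (_%:C).
  by rewrite ler0_norm ?subr_le0//; field.
Qed.

End LinfFacts.

Lemma Spec_inj (R : realType) (C : cstarAlgType R) (chi chi' : Spec C) :
  sval chi = sval chi' -> chi = chi'.
Proof. by case: chi chi' => [f fP] [g gP] /= fg; exact: eq_exist. Qed.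

(** * Contractive graphs extending the representation *)

Section Extension.
Context (R : realType) (H : hilbert R) (C : cstarAlgType R).
Context (pi : C -> bop_alg H).
Hypotheses (C_comm : commutative (@GRing.mul C)) (pi_hom : star_hom pi).
Local Notation X := (Spec C).
Local Notation L := (linf_alg R X).
Local Notation B := (bop_alg H).
Implicit Types (f g : L) (T S : B) (chi : X) (v w : H) (E : set X).

Definition joint_eigen chi v := forall c, bop_fun (pi c) v = sval chi c *: v.

Lemma joint_eigen_orthogonal chi chi' v v' : chi <> chi' ->
  joint_eigen chi v -> joint_eigen chi' v' -> ip v v' = 0.
Proof.
move=> chichi' ev ev'; apply: contrapT => n0; apply: chichi'.
apply: Spec_inj; apply/funext => c; apply/eqP.
have : sval chi c * ip v v' = sval chi' c * ip v v'.
  rewrite -ipZl -ev adj_bopP -(star_hom_adj pi_hom) ev' ipZr.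
  by rewrite (character_adj (svalP chi')) conjcK.
by move=> /eqP; rewrite -subr_eq0 -mulrBl mulf_eq0 subr_eq0 => /orP[//|/eqP].
Qed.

(* Graphs of partial *-homomorphisms extending c^ |-> pi c. *)
Record good (G : set (L * B)) : Prop := Good {
  good_lin : forall a f g T S, G (f, T) -> G (g, S) -> G (a *: f + g, a *: T + S);
  good_mul : forall f g T S, G (f, T) -> G (g, S) -> G (f * g, T * S);
  good_adj : forall f T, G (f, T) -> G (adj f, adj T);
  good_nrm : forall f T, G (f, T) -> nrm T <= nrm f;
  good_eigen : forall f T chi v, G (f, T) -> joint_eigen chi v ->
    bop_fun T v = linf_fun f chi *: v;
  good_gelfand : forall c, G (gelfand c, pi c)
}.

(** Contractivity is [nrm (pi c) <= nrm c <= nrm (gelfand c)]; commutativity of C enters in the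
    second inequality. *)
Lemma good_gelfand_graph : good [set p | exists c, p = (gelfand c : L, pi c)].
Proof.
split.
- move=> a _ _ _ _ [c [-> ->]] [c' [-> ->]]; exists (a *: c + c').
  rewrite (star_hom_lin pi_hom); congr (_, _); apply: linfP => chi /=.
  by have [chi_lin _] := svalP chi; rewrite chi_lin.
- move=> _ _ _ _ [c [-> ->]] [c' [-> ->]]; exists (c * c').
  rewrite (star_homM pi_hom); congr (_, _); apply: linfP => chi /=.
  by have [_ [_ chiM]] := svalP chi; rewrite chiM.
- move=> _ _ [c [-> ->]]; exists (adj c).
  rewrite (star_hom_adj pi_hom); congr (_, _); apply: linfP => chi /=.
  by rewrite (character_adj (svalP chi)).
- move=> _ _ [c [-> ->]]; apply: le_trans (nrm_le_gelfand _ C_comm).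
  exact: star_hom_nrm.
- by move=> _ _ chi v [c [-> ->]] ev; exact: ev.
- by move=> c; exists c.
Qed.

Lemma good_bigcup (F : set (set (L * B))) : F !=set0 ->
  (forall G, F G -> good G) -> total_on F subset -> good (\bigcup_(G in F) G).
Proof.
move=> [G0 FG0] FP Ftot.
have both p q : (\bigcup_(G in F) G) p -> (\bigcup_(G in F) G) q ->
    exists2 G, F G & G p /\ G q.
  move=> [G FG Gp] [G' FG' Gq].
  by have [GG'|G'G] := Ftot _ _ FG FG';
    [exists G'|exists G] => //; split=> //; [exact: GG'|exact: G'G].
split.
- move=> a f g T S /both h /h[G FG [Gf Gg]]; exists G => //.
  exact: (good_lin (FP _ FG)).
- move=> f g T S /both h /h[G FG [Gf Gg]]; exists G => //.
  exact: (good_mul (FP _ FG)).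
- by move=> f T [G FG Gf]; exists G => //; exact: (good_adj (FP _ FG)).
- by move=> f T [G FG Gf]; exact: (good_nrm (FP _ FG)).
- by move=> f T chi v [G FG Gf]; exact: (good_eigen (FP _ FG)).
- by move=> c; exists G0 => //; exact: (good_gelfand (FP _ FG0)).
Qed.

Definition graph_closure (G : set (L * B)) : set (L * B) :=
  [set p | forall e, 0 < e ->
    exists f T, [/\ G (f, T), nrm (p.1 - f) < e & nrm (p.2 - T) < e]].

Lemma graph_closure_sub G : G `<=` graph_closure G.
Proof.
move=> [f T] GfT e e0; exists f, T.
by rewrite /= !subrr !nrm0.
Qed.

(** All clauses survive limits in norm; consequently a maximal good graph is closed. *)
Lemma good_closure G : good G -> good (graph_closure G).
Proof.
move=> Gg; split.
- move=> a f g T S clf clg e e0.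
  have K0 : 0 < cabs a + 1 by rewrite ltr_wpDl ?cabs_ge0.
  have e1 : 0 < e / (cabs a + 1) by rewrite divr_gt0.
  have [f' [T' [G1 ff' TT']]] := clf _ e1; have [g' [S' [G2 gg' SS']]] := clg _ e1.
  exists (a *: f' + g'), (a *: T' + S'); split=> /=; first exact: (good_lin Gg).
    rewrite opprD addrACA -scalerBr; apply: le_lt_trans (nrmD _ _) _.
    rewrite nrmZ -/(cabs a); have := ler_wpM2l (cabs_ge0 a) (ltW ff').
    have : e = (cabs a + 1) * (e / (cabs a + 1)) by rewrite mulrC divfK// gt_eqF.
    by move: gg' => /=; lra.
  rewrite opprD addrACA -scalerBr; apply: le_lt_trans (nrmD _ _) _.
  rewrite nrmZ -/(cabs a); have := ler_wpM2l (cabs_ge0 a) (ltW TT').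
  have : e = (cabs a + 1) * (e / (cabs a + 1)) by rewrite mulrC divfK// gt_eqF.
  by move: SS' => /=; lra.
- move=> f g T S clf clg e e0.
  have [d d0 fg] := mul_continuous_nrm f g e0.
  have [d' d0' TS] := mul_continuous_nrm T S e0.
  have m0 : 0 < Num.min d d' by rewrite lt_min d0.
  have [f' [T' [G1 + +]]] := clf _ m0; have [g' [S' [G2 + +]]] := clg _ m0.
  rewrite !lt_min => /andP[gd _] /andP[_ Sd] /andP[fd _] /andP[_ Td].
  exists (f' * g'), (T' * S'); split; first exact: (good_mul Gg).
    exact: fg.
  exact: TS.
- move=> f T clf e /clf[f' [T' [Gf ff' TT']]].
  exists (adj f'), (adj T'); split; first exact: (good_adj Gg).
    by rewrite -adjB nrm_adj.
  by rewrite -adjB nrm_adj.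
- move=> f T clf; apply/ler_addgt0Pl => e e0.
  have [|f' [T' [Gf ff' TT']]] := clf (e / 2); first by rewrite divr_gt0.
  have := good_nrm Gg Gf; have := nrmD (f' - f) f; have := nrmD (T - T') T'.
  rewrite !subrK (nrmC f'); move: ff' TT' => /=.
  by lra.
- move=> f T chi v clf ev; apply/eqP; rewrite -subr_eq0; apply/eqP/hn_eq0/eqP.
  rewrite eq_le hn_ge0 andbT; apply/ler_addgt0Pl => e e0; rewrite addr0.
  have K0 : 0 < hn v * 2 + 1 by rewrite ltr_wpDl// mulr_ge0 ?hn_ge0.
  have [|f' [T' [Gf ff' TT']]] := clf (e / (hn v * 2 + 1)); first by rewrite divr_gt0.
  apply: le_trans (hn_triangle (bop_fun T' v) _ _) _.
  rewrite (good_eigen Gg Gf ev) -scalerBl hnZ -(good_eigen Gg Gf ev).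
  have -> : bop_fun T v - bop_fun T' v = bop_fun (T - T') v.
    by rewrite [RHS]bopBE.
  have := hn_bop (T - T') v; rewrite -nrm_bop.
  have := ler_wpM2r (hn_ge0 v) (ltW TT').
  have : cabs (linf_fun (f' - f) chi) <= e / (hn v * 2 + 1).
    by apply: le_trans (cabs_linf _ _) _; rewrite nrmC; exact: ltW.
  rewrite linfsubE => /(ler_wpM2r (hn_ge0 v)).
  have : e / (hn v * 2 + 1) * (hn v * 2) <= e.
    by rewrite mulrAC ler_pdivrMr// ler_wpM2l ?lerDl// ltW.
  by move=> /=; lra.
- by move=> c; apply: graph_closure_sub; exact: (good_gelfand Gg).
Qed.

Section GoodTheory.
Context (G : set (L * B)) (Gg : good G).

Lemma good_1 : G (1, 1).
Proof.
have := good_gelfand Gg 1; rewrite (star_hom1 pi_hom).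
suff -> : gelfand (1 : C) = (1 : L) by [].
by apply: linfP => chi /=; have [_ [chi1 _]] := svalP chi; exact: chi1.
Qed.

Lemma good_0 : G (0, 0).
Proof. by have := good_lin Gg (-1) good_1 good_1; rewrite !scaleN1r !addNr. Qed.

Lemma good_Z a f T : G (f, T) -> G (a *: f, a *: T).
Proof. by move=> Gf; have := good_lin Gg a Gf good_0; rewrite !addr0. Qed.

Lemma good_D f g T S : G (f, T) -> G (g, S) -> G (f + g, T + S).
Proof. by move=> Gf Gh; have := good_lin Gg 1 Gf Gh; rewrite !scale1r. Qed.

Lemma good_B f g T S : G (f, T) -> G (g, S) -> G (f - g, T - S).
Proof.
by move=> Gf Gh; rewrite -(scaleN1r g) -(scaleN1r S); apply/good_D/good_Z.
Qed.

Lemma good_eq0 T : G (0, T) -> T = 0.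
Proof.
move=> /(good_nrm Gg); rewrite nrm0 => T0; apply/nrm0_eq0/eqP.
by rewrite eq_le T0 nrm_ge0.
Qed.

Lemma good_fun f T S : G (f, T) -> G (f, S) -> T = S.
Proof.
move=> GT GS; have := good_B GT GS; rewrite subrr => /good_eq0/eqP.
by rewrite subr_eq0 => /eqP.
Qed.

Hypothesis G_closed : graph_closure G `<=` G.

(** If functions of the domain converge, contractivity makes their operators Cauchy, and closedness
    of the graph pairs the two limits. *)
Lemma good_domain : subalgebra [set f | exists T, G (f, T)].
Proof.
split; [|by exists 1; exact: good_1| |].
- move=> f fD /=; pose d n : R := n.+1%:R^-1.
  have d0 : forall n, 0 < d n := @invnS_gt0 R.
  have dN : forall n m, (n <= m)%N -> d m <= d n := @invnS_le R.
  have small : forall e, 0 < e -> exists N, d N < e := @invnS_small R.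
  have /choice[u uP] n : exists p : L * B, G p /\ nrm (f - p.1) < d n.
    by have [g [T GT] fg] := fD _ (d0 n); exists (g, T).
  have [|T uT] := @ncauchy_ncvg R B (fun n => (u n).2).
    move=> e e0; have e2 : 0 < e / 2 by rewrite divr_gt0.
    have [N Ne] := small _ e2; exists N => n m Nn Nm.
    have [Gn fn] := uP n; have [Gm fm] := uP m.
    move: Gn Gm fn fm; case: (u n) => g S; case: (u m) => g' S' /= Gn Gm fn fm.
    apply: le_lt_trans (good_nrm Gg (good_B Gn Gm)) _.
    apply: le_lt_trans (nrm_triangle f _ _) _; rewrite (nrmC g).
    by have := dN _ _ Nn; have := dN _ _ Nm; lra.
  exists T; apply: G_closed => e e0; have [N Ne] := small _ e0.
  have [M uM] := uT _ e0; pose n := maxn N M.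
  have [Gn fn] := uP n; exists (u n).1, (u n).2; split=> /=.
  + by move: Gn; case: (u n).
  + by have := dN _ _ (leq_maxl N M); rewrite -/n; lra.
  + by rewrite nrmC uM// leq_maxr.
- by move=> a f g [T Gf] [S Gh]; exists (a *: T + S); exact: (good_lin Gg).
- by move=> f g [T Gf] [S Gh]; exists (T * S); exact: (good_mul Gg).
Qed.

End GoodTheory.
End Extension.

(** The orthogonal idempotents p and r move past b and b', so the cross terms vanish. *)
Lemma mul_corner (R : realType) (A : cstarAlgType R) (p r a a' b b' : A) :
  p * p = p -> r * r = r -> p * r = 0 -> r * p = 0 ->
  p * b = b * p -> p * b' = b' * p -> r * b = b * r -> r * b' = b' * r ->
  (a * p + a' * r) * (b * p + b' * r) = a * b * p + a' * b' * r.
Proof.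
move=> pp rr pr rp pb pb' rb rb'.
rewrite mulrDl !mulrDr -!mulrA (mulrA p b) (mulrA p b') (mulrA r b) (mulrA r b').
rewrite pb pb' rb rb' -!(mulrA b) -!(mulrA b') pp rr pr rp !mulr0.
by rewrite addr0 add0r.
Qed.

(** * Adjoining a projection for one set of characters *)

Section OneStep.
Context (R : realType) (H : hilbert R) (C : cstarAlgType R).
Context (pi : C -> bop_alg H) (pi_hom : star_hom pi).
Local Notation X := (Spec C).
Local Notation L := (linf_alg R X).
Local Notation B := (bop_alg H).
Implicit Types (f g : L) (T S : B) (chi : X) (v w : H).
Context (G : set (L * B)) (Gg : good pi G) (G_closed : graph_closure G `<=` G).
Context (E : set X).

(* The range of the projection that will represent the indicator of E. *)
Definition range_of : set H := [set w |
  (forall f T, G (f, T) -> (forall chi, E chi -> linf_fun f chi = 0) ->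
    bop_fun T w = 0) /\
  (forall chi v, ~ E chi -> joint_eigen pi chi v -> ip w v = 0)].

Lemma range_of_subspace : closed_subspace range_of.
Proof.
split.
- move=> a x y [xT xe] [yT ye]; split.
    by move=> f T Gf fE; rewrite bop_lin (xT f)// (yT f)// scaler0 addr0.
  by move=> chi v nE ev; rewrite ipDl ipZl (xe chi)// (ye chi)// mulr0 addr0.
- by split=> [f T _ _|chi v _ _]; rewrite ?bop_0 ?ip0l.
- move=> l lW; split.
    move=> f T Gf fE; apply/hn_eq0/eqP; rewrite eq_le hn_ge0 andbT.
    apply/ler_addgt0Pl => e e0; rewrite addr0.
    have K0 : 0 < opn T + 1 by rewrite ltr_wpDl ?opn_ge0.
    have [|x [xT _] lx] := lW (e / (opn T + 1)); first by rewrite divr_gt0.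
    have -> : bop_fun T l = bop_fun T (l - x) by rewrite bop_B (xT f)// subr0.
    apply: le_trans (hn_bop _ _) _; have := ler_wpM2l (opn_ge0 T) (ltW lx).
    move=> /le_trans; apply; rewrite mulrA ler_pdivrMr// mulrC ler_wpM2l ?(ltW e0)//.
    by rewrite lerDl.
  move=> chi v nE ev; apply/cabs_small_eq0 => e e0.
  have K0 : 0 < hn v + 1 by rewrite ltr_wpDl ?hn_ge0.
  have [|x [_ xe] lx] := lW (e / (hn v + 1)); first by rewrite divr_gt0.
  have -> : ip l v = ip (l - x) v by rewrite ipBl (xe chi)// subr0.
  apply: le_trans (cauchy_schwarz _ _) _; have := ler_wpM2r (hn_ge0 v) (ltW lx).
  move=> /le_trans; apply; rewrite mulrAC ler_pdivrMr// ler_wpM2l ?(ltW e0)//.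
  by rewrite lerDl.
Qed.

Lemma range_of_stable f T w : G (f, T) -> range_of w -> range_of (bop_fun T w).
Proof.
move=> Gf [wT we]; split.
  move=> g S Gh gE; rewrite -bopME; apply: (wT (g * f)); first exact: (good_mul Gg).
  by move=> chi Echi; rewrite linfME gE// mul0r.
move=> chi v nE ev; rewrite adj_bopP (good_eigen Gg (good_adj Gg Gf) ev).
by rewrite ipZr (we chi)// mulr0.
Qed.

Lemma eigen_in_range chi v : E chi -> joint_eigen pi chi v -> range_of v.
Proof.
move=> Echi ev; split.
  by move=> f T Gf fE; rewrite (good_eigen Gg Gf ev) fE// scale0r.
move=> chi' v' nE ev'; apply: joint_eigen_orthogonal ev ev' => // chichi'.
by apply: nE; rewrite -chichi'.
Qed.

Context (q : B) (q_adj : adj q = q) (q_range : forall v, range_of (bop_fun q v))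
  (q_orth : forall v w, range_of w -> ip (v - bop_fun q v) w = 0).

Lemma q_unique v p : range_of p -> (forall w, range_of w -> ip (v - p) w = 0) ->
  bop_fun q v = p.
Proof.
move=> Wp pv; apply/eqP; rewrite -subr_eq0; apply/eqP/hilb_def.
have Wd : range_of (bop_fun q v - p).
  rewrite addrC -scaleN1r; apply: (subspace_lin range_of_subspace) => //.
have {1}-> : bop_fun q v - p = (v - p) - (v - bop_fun q v).
  by rewrite opprB [RHS]addrC addrA subrK.
by rewrite ipBl pv// q_orth// subr0.
Qed.

Lemma q_idem : q * q = q.
Proof.
apply: bopP => v; rewrite [LHS]bopME; apply: q_unique => // w _.
by rewrite subrr ip0l.
Qed.

(** The range is stable under both T and [adj T], hence reduces T. *)
Lemma q_comm f T : G (f, T) -> q * T = T * q.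
Proof.
move=> Gf; apply: bopP => v; rewrite [LHS]bopME [RHS]bopME.
apply: q_unique; first exact: range_of_stable Gf _.
move=> w Ww; rewrite -bop_B adj_bopP q_orth//.
exact: range_of_stable (good_adj Gg Gf) _.
Qed.

Lemma range_kills f T : G (f, T) -> (forall chi, E chi -> linf_fun f chi = 0) ->
  T * q = 0.
Proof.
by move=> Gf fE; apply: bopP => v; rewrite [LHS]bopME; exact: (q_range v).1 f T Gf fE.
Qed.

(** The vectors [adj T] u lie in the range of q, so (1 - q) v is orthogonal to them. Indeed, if (g,
    S) is in G with g zero on E, then g times the conjugate of f is 0, whence [S * adj T = 0] by
    contractivity; and f vanishes at the characters outside E. *)
Lemma corange_kills f T : G (f, T) ->
  (forall chi, ~ E chi -> linf_fun f chi = 0) -> T * (1 - q) = 0.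
Proof.
move=> Gf fE; apply: bopP => v; rewrite [LHS]bopME [bop_fun (1 - q) v]bopBE.
apply: ip_inj => u; rewrite adj_bopP ip0l q_orth//; split.
  move=> g S Gh gE; rewrite -bopME.
  have -> : S * adj T = 0; last by [].
  apply: (good_eq0 Gg); have := good_mul Gg Gh (good_adj Gg Gf).
  congr (G (_, _)); apply: linfP => chi; rewrite linfME linfadjE.
  have [Echi|nEchi] := pselect (E chi); first by rewrite gE// mul0r.
  by rewrite fE// conjc0 mulr0.
move=> chi v' nE ev'; rewrite adj_bopP.
by rewrite adjK (good_eigen Gg Gf ev') fE// scale0r ip0r.
Qed.

Let q' : B := 1 - q.

Lemma q'_idem : q' * q' = q'.
Proof. by rewrite /q' mulrBr mulr1 mulrBl mul1r q_idem subrr subr0. Qed.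
Lemma qq' : q * q' = 0.
Proof. by rewrite /q' mulrBr mulr1 q_idem subrr. Qed.
Lemma q'q : q' * q = 0.
Proof. by rewrite /q' mulrBl mul1r q_idem subrr. Qed.
Lemma q'_comm f T : G (f, T) -> q' * T = T * q'.
Proof. by move=> Gf; rewrite /q' mulrBl mulrBr mul1r mulr1 (q_comm Gf). Qed.
Lemma q'_adj : adj q' = q'.
Proof. by rewrite /q' adjB adj_one q_adj. Qed.

Let e : L := indicator R E.
Let e' : L := 1 - e.

Let eE chi : E chi -> linf_fun e chi = 1 /\ linf_fun e' chi = 0.
Proof. by move=> Echi; rewrite linfsubE linf1E indicator_in// subrr. Qed.
Let eNE chi : ~ E chi -> linf_fun e chi = 0 /\ linf_fun e' chi = 1.
Proof. by move=> Echi; rewrite linfsubE linf1E indicator_out// subr0. Qed.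

Let mix_in f f' chi : E chi -> linf_fun (f * e + f' * e') chi = linf_fun f chi.
Proof.
move=> /eE[e1 e0]; rewrite linfaddE [in LHS]linfME (linfME f' e') e1 e0.
by rewrite mulr1 mulr0 addr0.
Qed.
Let mix_out f f' chi : ~ E chi -> linf_fun (f * e + f' * e') chi = linf_fun f' chi.
Proof.
move=> /eNE[e0 e1]; rewrite linfaddE [in LHS]linfME (linfME f' e') e1 e0.
by rewrite mulr1 mulr0 add0r.
Qed.

(** Functions glued from f on E and f' off E are paired with operators glued from T on the range of
    q and T' on its orthogonal complement. *)
Definition adjoin : set (L * B) := [set p | exists f f' T T',
  [/\ G (f, T), G (f', T') & p = (f * e + f' * e', T * q + T' * q')]].

(** Let t be the squared norm of the glued function. On E the function [adj f * f] is at most t, so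
    truncating it at t changes it only off E, and by [range_kills] the product [adj T * T * q] is
    unchanged. The truncated operator has norm at most t, which bounds T q; [corange_kills] does the
    same for T' q'. The two parts have orthogonal values, so the bounds add up. *)
Lemma adjoin_nrm f f' T T' : G (f, T) -> G (f', T') ->
  nrm (T * q + T' * q') <= nrm (f * e + f' * e').
Proof.
move=> Gf Gf'; set F := f * e + f' * e'; pose t := nrm F ^+ 2.
have t0 : 0 <= t by rewrite exprn_ge0// nrm_ge0.
have Gff := good_mul Gg (good_adj Gg Gf) Gf.
have Gff' := good_mul Gg (good_adj Gg Gf') Gf'.
have sq (g : L) chi : linf_fun g chi = linf_fun F chi ->
    linf_fun (adj g * g) chi <= t%:C.
  move=> gF; rewrite linfME linfadjE mulrC -cabs_sqr lecR gF.
  by rewrite ler_sqr ?nnegrE ?cabs_ge0 ?nrm_ge0// cabs_linf.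
have dom := good_domain pi_hom Gg G_closed.
have bound g S r : G (adj g * g, adj S * S) -> r * r = r -> adj r = r ->
    (forall m M, G (m, M) ->
      (forall chi, linf_fun g chi = linf_fun F chi ->
        linf_fun m chi = linf_fun (adj g * g) chi) -> adj S * S * r = M * r) ->
    forall v, hn (bop_fun (S * r) v) ^+ 2 <= t * hn (bop_fun r v) ^+ 2.
  move=> GS rr ra MS v.
  (* The truncation is still in the domain of G because the domain is a closed subalgebra; [M] is
     its operator. *)
  have [||m [[M GM] mt mE]] := @subalgebra_truncate _ _ _ (adj g * g) t dom _ _ t0.
  - exact: star_pos.
  - by exists (adj S * S).
  have {}MS : adj S * S * r = M * r by apply: (MS m) => // chi /sq; exact: mE.
  have -> : hn (bop_fun (S * r) v) ^+ 2 =
      cabs (ip (bop_fun r v) (bop_fun (M * r) v)).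
    rewrite -MS -mulrA [bop_fun (adj S * _) v]bopME -adj_bopP -bopME.
    by rewrite ip_hn cabs_real ger0_norm// exprn_ge0// hn_ge0.
  apply: le_trans (cauchy_schwarz _ _) _; rewrite [bop_fun (M * r) v]bopME.
  rewrite mulrC expr2 mulrA ler_wpM2r ?hn_ge0//.
  apply: le_trans (hn_bop M _) _; rewrite ler_wpM2r ?hn_ge0//.
  by apply: le_trans mt; exact: (good_nrm Gg GM).
have b1 := bound f T q Gff q_idem q_adj.
have b2 := bound f' T' q' Gff' q'_idem q'_adj.
have {}b1 : forall v, hn (bop_fun (T * q) v) ^+ 2 <= t * hn (bop_fun q v) ^+ 2.
  apply: b1 => m M GM mE; apply/eqP; rewrite -subr_eq0 -mulrBl.
  apply/eqP; apply: (range_kills (good_B pi_hom Gg Gff GM)) => chi Echi.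
  by rewrite linfsubE mE ?subrr// /F mix_in.
have {}b2 : forall v, hn (bop_fun (T' * q') v) ^+ 2 <= t * hn (bop_fun q' v) ^+ 2.
  apply: b2 => m M GM mE; apply/eqP; rewrite -subr_eq0 -mulrBl.
  apply/eqP; apply: (corange_kills (good_B pi_hom Gg Gff' GM)) => chi Echi.
  by rewrite linfsubE mE ?subrr// /F mix_out.
have pyth (v w : H) : ip v w = 0 -> hn (v + w) ^+ 2 = hn v ^+ 2 + hn w ^+ 2.
  move=> vw; rewrite !hn_sqr ipDl !ipDr vw (ip_conj v w) vw conjc0.
  by rewrite addr0 add0r raddfD.
apply: opn_le => [|v]; first exact: nrm_ge0.
rewrite -ler_sqr ?nnegrE ?mulr_ge0 ?hn_ge0 ?nrm_ge0// exprMn -/t.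
rewrite [bop_fun _ v]bopDE pyth; last first.
  rewrite -(q_comm Gf) -(q'_comm Gf') [bop_fun (q * T) v]bopME.
  rewrite [bop_fun (q' * T') v]bopME adj_bopP q_adj -bopME qq'.
  exact: ip0r.
have -> : hn v ^+ 2 = hn (bop_fun q v) ^+ 2 + hn (bop_fun q' v) ^+ 2.
  rewrite -pyth; last by rewrite adj_bopP q_adj -bopME qq'; exact: ip0r.
  by rewrite -[bop_fun q v + _]bopDE /q' addrC subrK.
by rewrite [leRHS]mulrDr; apply: lerD; [exact: b1|exact: b2].
Qed.

Lemma adjoin_sub : G `<=` adjoin.
Proof.
move=> [f T] Gf; exists f, f, T, T; split=> //.
by rewrite -!mulrDr /e' /q' ![_ + (1 - _)]addrC !subrK !mulr1.
Qed.

Lemma adjoin_indicator : adjoin (e, q).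
Proof.
exists 1, 0, 1, 0; split; [exact: (good_1 pi_hom Gg)|exact: (good_0 pi_hom Gg)|].
by rewrite !mul1r !mul0r !addr0.
Qed.

Lemma good_adjoin : good pi adjoin.
Proof.
split.
- move=> a _ _ _ _ [f [f' [T [T' [Gf Gf' [-> ->]]]]]] [g [g' [S [S' [Gh Gh' [-> ->]]]]]].
  exists (a *: f + g), (a *: f' + g'), (a *: T + S), (a *: T' + S'); split.
  + exact: (good_lin Gg).
  + exact: (good_lin Gg).
  + by rewrite !mulrDl !scalerDr !cscaleAl; congr (_, _); rewrite addrACA.
- move=> _ _ _ _ [f [f' [T [T' [Gf Gf' [-> ->]]]]]] [g [g' [S [S' [Gh Gh' [-> ->]]]]]].
  exists (f * g), (f' * g'), (T * S), (T' * S'); split.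
  + exact: (good_mul Gg).
  + exact: (good_mul Gg).
  + congr (_, _).
      apply: linfP => chi; rewrite linfME.
      by have [Ec|Ec] := pselect (E chi);
        [rewrite !mix_in//|rewrite !mix_out//]; rewrite linfME.
    by apply: mul_corner; rewrite ?q_idem ?q'_idem ?qq' ?q'q//;
      [exact: q_comm Gh|exact: q_comm Gh'|exact: q'_comm Gh|exact: q'_comm Gh'].
- move=> _ _ [f [f' [T [T' [Gf Gf' [-> ->]]]]]].
  exists (adj f), (adj f'), (adj T), (adj T'); split.
  + exact: (good_adj Gg).
  + exact: (good_adj Gg).
  + congr (_, _).
      apply: linfP => chi; rewrite linfadjE.
      by have [Ec|Ec] := pselect (E chi); [rewrite !mix_in|rewrite !mix_out].
    rewrite adjD !cadjM q_adj q'_adj.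
    by rewrite (q_comm (good_adj Gg Gf)) (q'_comm (good_adj Gg Gf')).
- by move=> _ _ [f [f' [T [T' [Gf Gf' [-> ->]]]]]]; exact: adjoin_nrm.
- move=> _ _ chi v [f [f' [T [T' [Gf Gf' [-> ->]]]]]] ev.
  rewrite [LHS]bopDE (bopME T q) (bopME T' q') [bop_fun q' v]bopBE.
  (* q fixes v when chi is in E, by orthogonality of joint eigenvectors, and kills v otherwise, by
     the second condition in [range_of]. *)
  have [Echi|nEchi] := pselect (E chi).
    have -> : bop_fun q v = v.
      apply: q_unique; first exact: eigen_in_range ev.
      by move=> w _; rewrite subrr ip0l.
    by rewrite mix_in// subrr bop_0 addr0; exact: (good_eigen Gg).
  have -> : bop_fun q v = 0.
    apply: q_unique; first exact: subspace_0 range_of_subspace.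
    by move=> w [_ we]; rewrite subr0 ip_conj (we chi)// conjc0.
  by rewrite mix_out// bop_0 subr0 add0r; exact: (good_eigen Gg).
- by move=> c; apply: adjoin_sub; exact: (good_gelfand Gg).
Qed.

End OneStep.

(** Functions with values in [0, 1] are uniform limits of dyadic combinations of indicators;
    rescaling and splitting into real and imaginary parts give the rest. *)
Lemma subalgebra_indicators (R : realType) (X : Type) (D : set (linf_alg R X)) :
  subalgebra D -> (forall E, D (indicator R E)) -> forall f, D f.
Proof.
move=> [Dc D1 Dl Dm] DE.
have DD (f g : linf_alg R X) : D f -> D g -> D (f + g) by rewrite -{2}[f]scale1r; exact: Dl.
have D0 : D 0 by have := Dl (-1) _ _ D1 D1; rewrite scaleN1r addNr.
have DZ a (f : linf_alg R X) : D f -> D (a *: f).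
  by move=> Df; rewrite -[_ *: _]addr0; exact: Dl.
have real01 (c : R) : 0 <= c -> c <= 1 -> 0 <= c%:C <= 1.
  by move=> c0 c1; apply/andP; split;
    [exact: (etrans (lecR 0 c) c0)|exact: (etrans (lecR c 1) c1)].
pose h : R[i] := (2^-1 : R)%:C.
(* Binary expansion: 2 f - 1_{f >= 1/2} again takes its values in [0, 1]. *)
have unit_approx n (f : linf_alg R X) : (forall x, 0 <= linf_fun f x <= 1) ->
    exists2 g, D g & nrm (f - g) <= 2^-1 ^+ n.
  elim: n f => [|n IH] f f01.
    exists 0 => //; rewrite subr0 expr0; apply: nrm_linf_le => // x.
    by have /andP[f0 f1] := f01 x; rewrite -lecR -cabsE ger0_norm.
  pose E := [set x | h <= linf_fun f x].
  pose f1 : linf_alg R X := f + f - indicator R E.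
  have [x|g Dg fg] := IH f1.
    have /andP[f0 f1'] := f01 x; rewrite linfsubE linfaddE.
    pose y := complex.Re (linf_fun f x).
    have fr : linf_fun f x = y%:C by rewrite RRe_real// ger0_real.
    have y0 : 0 <= y by rewrite -lecR -fr.
    have y1 : y <= 1 by rewrite -lecR -fr.
    have [Ex|nEx] := pselect (E x).
      have hy : 2^-1 <= y by rewrite -lecR -fr.
      rewrite indicator_in// fr -rmorphD -(rmorph1 (@real_complex R)) -rmorphB.
      by apply: real01; lra.
    have hy : y < 2^-1.
      by rewrite ltNge; apply/negP; rewrite -lecR -fr.
    rewrite indicator_out// subr0 fr -rmorphD.
    by apply: real01; lra.
  exists (h *: (indicator R E + g)); first by apply/DZ/DD.
  have -> : f - h *: (indicator R E + g) = h *: (f1 - g).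
    have {1}-> : f = h *: (f + f) by rewrite half_addr.
    by rewrite -scalerBr opprD addrA.
  by rewrite nrm_half exprS mulrC ler_wpM2l ?invr_ge0.
have Dunit (f : linf_alg R X) : (forall x, 0 <= linf_fun f x <= 1) -> D f.
  move=> f01; apply: Dc => e e0.
  have : (fun n => (2^-1 : R) ^+ n) @ \oo --> (0 : R).
    apply: cvg_expr; rewrite ger0_norm ?invr_ge0//; lra.
  move=> /cvgrPdist_lt/(_ _ e0)[N _ /(_ N (leqnn N))/=].
  rewrite sub0r normrN ger0_norm ?exprn_ge0 ?invr_ge0// => Ne.
  have [g Dg fg] := unit_approx N f f01; exists g => //.
  exact: le_lt_trans fg Ne.
have Dsa (f : linf_alg R X) : adj f = f -> D f.
  move=> fa; pose K := nrm f + 1.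
  have K0 : 0 < K by rewrite ltr_wpDl ?nrm_ge0.
  (* As [K] exceeds the norm of f, the rescaled function takes its values in [0, 1]. *)
  pose g : linf_alg R X := ((2 * K)^-1)%:C *: (f + sc _ K).
  have -> : f = (2 * K)%:C *: g - sc _ K.
    by rewrite /g scalerA -rmorphM mulfV ?scale1r ?addrK// gt_eqF// mulr_gt0.
  rewrite -scN; apply: DD; last exact: DZ.
  apply/DZ/Dunit => x; rewrite /g linfscaleE linfaddE linfscE (linf_sa x fa).
  have := le_trans (cabs_Re _) (cabs_linf f x); rewrite ler_norml => /andP[fl fu].
  rewrite -rmorphD -rmorphM mulrC; apply: real01.
    by rewrite divr_ge0 ?mulr_ge0 ?(ltW K0)//; rewrite /K; lra.
  by rewrite ler_pdivrMr ?mulr_gt0// /K; lra.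
move=> f; rewrite (re_im f); apply: DD; [|apply: DZ]; apply: Dsa.
  exact: adj_re.
exact: adj_im.
Qed.

(** The last conjunct recovers f(chi) from [psi f] whenever chi has a nonzero joint eigenvector;
    injectivity will rest on it. *)
Theorem star_hom_extension (R : realType) (H : hilbert R) (C : cstarAlgType R)
  (pi : C -> bop_alg H) : commutative (@GRing.mul C) -> star_hom pi ->
  exists psi : linf_alg R (Spec C) -> bop_alg H, [/\ star_hom psi,
    forall c, psi (gelfand c) = pi c &
    forall f (chi : Spec C) v, joint_eigen pi chi v ->
      bop_fun (psi f) v = linf_fun f chi *: v].
Proof.
move=> C_comm pi_hom.
have [F F0 FP Ftot|G [Gg _ Gmax]] :=
    Zorn_above (P := good pi) (good_gelfand_graph C_comm pi_hom).
  exact: good_bigcup.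
have G_closed : graph_closure G `<=` G.
  by apply: Gmax; [exact: good_closure|exact: graph_closure_sub].
have dom := good_domain pi_hom Gg G_closed.
have GE E : exists q, G (indicator R E, q).
  have [q [qa qW q_orth]] := projection_exists (range_of_subspace pi G E).
  (* Maximality forces the enlarged graph, and with it the indicator of E, back into [G]. *)
  exists q; apply: (Gmax (adjoin G E q)).
  - exact: good_adjoin.
  - exact: adjoin_sub.
  - exact: (adjoin_indicator pi_hom Gg).
have /choice[psi psiP] := subalgebra_indicators dom GE.
exists psi; split.
- split.
  + move=> a f g; apply: (good_fun pi_hom Gg (psiP _)).
    exact: (good_lin Gg).
  + split; first exact: (good_fun pi_hom Gg (psiP _) (good_1 pi_hom Gg)).
    move=> f g; apply: (good_fun pi_hom Gg (psiP _)).
    exact: (good_mul Gg).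
  + move=> f; apply: (good_fun pi_hom Gg (psiP _)).
    exact: (good_adj Gg).
- by move=> c; apply: (good_fun pi_hom Gg (psiP _)); exact: (good_gelfand Gg).
- by move=> f chi v; exact: (good_eigen Gg).
Qed.

(** * The universal GNS representation *)

(** All GNS spaces share the underlying module A and differ only in their forms, so their algebraic
    sum can be taken as finitely supported functions into one fixed module. *)
Definition dsum_pred (T : choiceType) (W : nmodType) : {pred T -> W} :=
  fun x => `[< exists r : seq T, forall i, i \notin r -> x i = 0 >].

Record dsum (T : choiceType) (W : nmodType) := Dsum {
  dsum_fun :> T -> W;
  _ : dsum_pred dsum_fun
}.

(** * Algebraic direct sums of pre-inner products *)

Section DirectSum.
Context (R : realType) (T : choiceType) (W : lmodType R[i]).
Context (b : T -> W -> W -> R[i]).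
Hypotheses (b_lin : forall i z, scalar ((b i)^~ z))
  (b_conj : forall i x y, b i y x = (b i x y)^*%C)
  (b_ge0 : forall i x, 0 <= b i x x).
Local Notation V := (dsum T W).

HB.instance Definition _ := [isSub for @dsum_fun T W].
HB.instance Definition _ := [Choice of V by <:].

Fact dsum_submod : GRing.subsemimod_closed (@dsum_pred T W).
Proof.
split=> [|a x /asboolP[r xr]]; last first.
  by apply/asboolP; exists r => i /xr xi; rewrite /= fctE xi scaler0.
split=> [|x y /asboolP[r xr] /asboolP[s ys]]; apply/asboolP; first by exists [::].
exists (r ++ s) => i; rewrite mem_cat negb_or => /andP[/xr xi /ys yi].
by rewrite /= fctE xi yi addr0.
Qed.

HB.instance Definition _ :=
  GRing.SubChoice_isSubLmodule.Build R[i] (T -> W) _ V dsum_submod.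

Lemma dsumP (x y : V) : (forall i, x i = y i) -> x = y.
Proof. by move=> xy; apply/val_inj/funext. Qed.

Lemma dsum_linE a (x y : V) i : (a *: x + y) i = a *: x i + y i.
Proof. by []. Qed.

Lemma dsum_support (x : V) : exists2 r : seq T, uniq r & forall i, i \notin r -> x i = 0.
Proof.
case: x => x /= /asboolP[r xr]; exists (undup r); first exact: undup_uniq.
by move=> i; rewrite mem_undup; exact: xr.
Qed.

Definition dsum_ip (x y : V) : R[i] := \sum_(i \in [set: T]) b i (x i) (y i).

Let b0l i y : b i 0 y = 0.
Proof. by have := b_lin i y (-1) 0 0; rewrite scaler0 addr0 mulN1r addNr. Qed.

(** A list covering the support of x alone will do, so several vectors can be summed over one common
    list. *)
Lemma dsum_ipE (r : seq T) (x y : V) : uniq r ->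
  (forall i, i \notin r -> x i = 0) ->
  dsum_ip x y = \sum_(i <- r) b i (x i) (y i).
Proof.
move=> ru xr; have TE : [set: T] = [set` predT] by apply/seteqP.
by rewrite /dsum_ip TE -(bigfs _ ru)// => i _ /xr ->; exact: b0l.
Qed.

Fact dsum_ip_linear z : scalar (dsum_ip^~ z).
Proof.
move=> a x y /=; have [r ru xr] := dsum_support x; have [s su ys] := dsum_support y.
have tu : uniq (undup (r ++ s)) by exact: undup_uniq.
have rt i : i \notin undup (r ++ s) -> x i = 0 /\ y i = 0.
  by rewrite mem_undup mem_cat negb_or => /andP[/xr ? /ys ?].
rewrite !(dsum_ipE _ tu); first last.
- by move=> i /rt[xi yi]; rewrite dsum_linE xi yi scaler0 addr0.
- by move=> i /rt[].
- by move=> i /rt[].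
rewrite mulr_sumr -big_split; apply: eq_bigr => i _.
by rewrite dsum_linE b_lin.
Qed.

Fact dsum_ip_conj x y : dsum_ip y x = (dsum_ip x y)^*%C.
Proof.
have [r ru xr] := dsum_support x; have [s su ys] := dsum_support y.
have tu : uniq (undup (r ++ s)) by exact: undup_uniq.
have rt i : i \notin undup (r ++ s) -> x i = 0 /\ y i = 0.
  by rewrite mem_undup mem_cat negb_or => /andP[/xr ? /ys ?].
rewrite !(dsum_ipE _ tu); [|by move=> i /rt[]..].
by rewrite rmorph_sum; apply: eq_bigr => i _; exact: b_conj.
Qed.

Fact dsum_ip_ge0 x : 0 <= dsum_ip x x.
Proof.
have [r ru xr] := dsum_support x; rewrite (dsum_ipE _ ru)//.
by apply: sumr_ge0 => i _; exact: b_ge0.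
Qed.

Definition dsum_preip : preip R := PreIp dsum_ip_linear dsum_ip_conj dsum_ip_ge0.

Lemma dsum_map_subproof (f : T -> W -> W) (x : V) : (forall i, f i 0 = 0) ->
  dsum_pred (fun i => f i (x i)).
Proof.
move=> f0; have [r _ xr] := dsum_support x; apply/asboolP; exists r => i /xr->.
exact: f0.
Qed.

Fact dsum_single_subproof i w : dsum_pred (fun j : T => if j == i then w else 0 : W).
Proof. by apply/asboolP; exists [:: i] => j; rewrite inE => /negPf->. Qed.
Definition dsum_single i w : V := Dsum (dsum_single_subproof i w).

Lemma ip_dsum_single i w (y : V) : dsum_ip (dsum_single i w) y = b i w (y i).
Proof.
rewrite (@dsum_ipE [:: i])//; first by rewrite big_seq1 /= eqxx.
by move=> j; rewrite inE /= => /negPf->.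
Qed.

End DirectSum.

(** * Extending bounded operators to a completion *)

Section Lift.
Context (R : realType) (V : preip R).
Local Notation H := (completion V).

Lemma cpl_embed_lin a (x y : V) :
  cpl_embed (a *: x + y) = a *: cpl_embed x + cpl_embed y.
Proof. by apply: cplP => z; rewrite cplDE cplZE /= ipDl ipZl. Qed.

Lemma cpl_conj_lin (f : cpl V) a (x y : V) : f (a *: x + y) = a^*%C * f x + f y.
Proof.
rewrite -(ip_embedr (f : cpl_preip V)) cpl_embed_lin.
by rewrite [LHS](ipDr (V := cpl_preip V)) ipZr !ip_embedr.
Qed.

Definition bounded_adjoints (K : R) (M M' : V -> V) := [/\ 0 <= K, adjoints M M',
  forall x, hn (M x) <= K * hn x & forall x, hn (M' x) <= K * hn x].

Lemma bounded_adjoints_sym K M M' :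
  bounded_adjoints K M M' -> bounded_adjoints K M' M.
Proof.
move=> [K0 MM' MK M'K]; split=> // v w.
by rewrite ip_conj -MM' -ip_conj.
Qed.

(** The form of M x is the form of x composed with M', so on forms M acts by precomposition with M'.
    The denominator is K + 1 because K may be 0. *)
Lemma lift_approximates K M M' (f : V -> R[i]) d x : bounded_adjoints K M M' ->
  0 <= d -> approximates f (d / (K + 1)) x ->
  approximates (f \o M') d (M x).
Proof.
move=> [K0 MM' _ M'K] d0 fx y; rewrite /= MM'; apply: le_trans (fx _) _.
have K1 : 0 < K + 1 by rewrite ltr_wpDl.
have d1 : 0 <= d / (K + 1) by rewrite divr_ge0// ltW.
apply: le_trans (ler_wpM2l d1 (M'K y)) _; rewrite mulrA ler_wpM2r ?hn_ge0//.
by rewrite mulrAC ler_pdivrMr// ler_wpM2l// lerDl.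
Qed.

Lemma cpl_pred_lift K M M' (f : cpl V) : bounded_adjoints K M M' ->
  cpl_pred (f \o M').
Proof.
move=> KM; apply/asboolP => d d0; have [K0 _ _ _] := KM.
have [|x fx] := cpl_approx f (d := d / (K + 1)); first by rewrite divr_gt0// ltr_wpDl.
by exists (M x); apply: (lift_approximates KM) => //; exact: ltW.
Qed.

Lemma cpl_ip_lift K M M' (f g f' g' : cpl_preip V) : bounded_adjoints K M M' ->
  (forall y, f' y = f (M' y)) -> (forall y, g' y = g (M y)) -> ip f' g = ip f g'.
Proof.
move=> KM f'E g'E; have [K0 MM' _ _] := KM.
have K1 : 0 < K + 1 by rewrite ltr_wpDl.
apply: cpl_ip_eq => e d e0 d0.
have [d1 d10 fgd] := cpl_ipP f g' e0.
pose m := Num.min (Num.min d d1) (Num.min (d / (K + 1)) (d1 / (K + 1))).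
have m0 : 0 < m by rewrite !lt_min d0 d10 !divr_gt0.
have [md [md1 [mK mK1]]] : m <= d /\ m <= d1 /\ m <= d / (K + 1) /\ m <= d1 / (K + 1).
  by rewrite /m !ge_min !lexx !orbT.
have [x fx] := cpl_approx f m0; have [y gy] := cpl_approx g m0.
exists (M x), y; split.
- have -> : cpl_fun f' = f \o M' by apply/funext.
  by apply: (lift_approximates KM); [exact: ltW|exact: approx_le fx].
- exact: approx_le gy.
- rewrite MM'; apply: fgd; first exact: approx_le fx.
  have -> : cpl_fun g' = g \o M by apply/funext.
  apply: (lift_approximates (bounded_adjoints_sym KM)); first exact: ltW.
  exact: approx_le gy.
Qed.

Lemma bop_pred_lift K M M' : bounded_adjoints K M M' ->
  exists T : bop_alg H, forall (f : H) y, cpl_fun (bop_fun T f) y = cpl_fun f (M' y).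
Proof.
move=> KM; have [K0 _ _ M'K] := KM.
pose T (f : H) : H := Cpl (cpl_pred_lift f KM).
pose S (f : H) : H := Cpl (cpl_pred_lift f (bounded_adjoints_sym KM)).
suff TP : bop_pred T by exists (Bop TP).
apply/asboolP; split; last by exists S => f g; exact: (cpl_ip_lift KM).
exists K => f; apply: hn_le_of_cabs => [|z]; first by rewrite mulr_ge0 ?hn_ge0.
apply: le_trans (cabs_le_hn f (M' z)) _.
by rewrite [K * _]mulrC -mulrA ler_wpM2l ?hn_ge0.
Qed.

End Lift.

(** * The representation on the sum over all states *)

Section GNS.
Context (R : realType) (A : cstarAlgType R).
Local Notation T := {classic {rho : A -> R[i] | state rho}}.

Definition gns_form (i : T) (x y : A) : R[i] := sval i (adj y * x).

Fact gns_form_linear i z : scalar ((gns_form i)^~ z).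
Proof.
move=> a x y; rewrite /gns_form; have [rho_lin _ _ _] := svalP i.
by rewrite mulrDr -cscaleAr rho_lin.
Qed.

Fact gns_form_conj i x y : gns_form i y x = (gns_form i x y)^*%C.
Proof.
rewrite /gns_form; have [_ _ <- _] := svalP i.
by rewrite cadjM adjK.
Qed.

Fact gns_form_ge0 i x : 0 <= gns_form i x x.
Proof. by have [_ _ _ rho_pos] := svalP i; apply/rho_pos/star_pos. Qed.

Definition gns_preip : preip R :=
  dsum_preip gns_form_linear gns_form_conj gns_form_ge0.
Local Notation V := gns_preip.
Local Notation H := (completion V).

Fact gns_act_subproof (a : A) (x : dsum T A) : dsum_pred (fun i => a * x i).
Proof. by apply: (dsum_map_subproof (f := fun _ w => a * w)) => i; rewrite mulr0. Qed.
Definition gns_act (a : A) (x : V) : V := Dsum (gns_act_subproof a x).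

Lemma gns_act_adjoint a : adjoints (gns_act a) (gns_act (adj a)).
Proof.
move=> x y; rewrite /= /dsum_ip; apply: eq_fsbigr => i _.
by rewrite /gns_form /= cadjM adjK mulrA.
Qed.

(** Summand by summand, this is nonnegativity of the state on the element of [pos_nrm_adjM]. *)
Lemma gns_act_le a x : hn (gns_act a x) <= nrm a * hn x.
Proof.
rewrite -ler_sqr ?nnegrE ?mulr_ge0 ?hn_ge0 ?nrm_ge0// exprMn -lecR.
have -> : (nrm a ^+ 2 * hn x ^+ 2)%:C = (nrm a ^+ 2)%:C * ip x x.
  by rewrite ip_hn rmorphM.
rewrite -ip_hn /=; have [r ru xr] := dsum_support x.
rewrite !(dsum_ipE gns_form_linear _ ru)//; last first.
  by move=> i /xr xi; rewrite /= xi mulr0.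
rewrite mulr_sumr; apply: ler_sum => i _.
have [rho_lin _ _ rho_pos] := svalP i.
rewrite -subr_ge0 /gns_form -(scalar_Z rho_lin) -(scalar_B rho_lin).
by apply: rho_pos; exact: pos_nrm_adjM.
Qed.

Lemma gns_bounded_adjoints a :
  bounded_adjoints (nrm a) (gns_act a) (gns_act (adj a)).
Proof.
split=> [||x|x]; [exact: nrm_ge0|exact: gns_act_adjoint|exact: gns_act_le|].
by rewrite -(nrm_adj a); exact: gns_act_le.
Qed.

Definition gns (a : A) : bop_alg H :=
  sval (cid (bop_pred_lift (gns_bounded_adjoints a))).

Lemma gnsE a (f : H) y :
  cpl_fun (bop_fun (gns a) f) y = cpl_fun f (gns_act (adj a) y).
Proof. exact: (svalP (cid (bop_pred_lift _))). Qed.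

Lemma gns_ext (S S' : bop_alg H) :
  (forall f y, cpl_fun (bop_fun S f) y = cpl_fun (bop_fun S' f) y) -> S = S'.
Proof. by move=> SS'; apply: bopP => f; apply: cplP => y. Qed.

Lemma gns_star_hom : star_hom gns.
Proof.
split.
- move=> c a b; apply: gns_ext => f y; rewrite gnsE.
  have -> : gns_act (adj (c *: a + b)) y =
      c^*%C *: gns_act (adj a) y + gns_act (adj b) y.
    apply: dsumP => i; rewrite [RHS]dsum_linE /=.
    by rewrite adjD adjZ mulrDl cscaleAl.
  rewrite cpl_conj_lin conjcK.
  transitivity (c * cpl_fun (bop_fun (gns a) f) y + cpl_fun (bop_fun (gns b) f) y).
    by rewrite (gnsE a) (gnsE b).
  by rewrite [bop_fun (_ + _) f]bopDE [bop_fun (_ *: _) f]bopZE.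
- split.
    apply: gns_ext => f y; rewrite gnsE; congr (cpl_fun f _).
    by apply: dsumP => i /=; rewrite adj_one mul1r.
  move=> a b; apply: gns_ext => f y; rewrite bopME !gnsE; congr (cpl_fun f _).
  by apply: dsumP => i /=; rewrite cadjM mulrA.
- move=> a; apply: esym; apply: adj_bop_unique => f g.
  by apply: (cpl_ip_lift (gns_bounded_adjoints a)) => y; rewrite gnsE ?adjK.
Qed.

Definition gns_vector (i : T) (x : A) : H := cpl_embed (dsum_single i x : V).

Lemma gns_vectorE a i x : bop_fun (gns a) (gns_vector i x) = gns_vector i (a * x).
Proof.
apply: cplP => y; rewrite gnsE.
change (ip (dsum_single i x : V) (gns_act (adj a) y) =
  ip (dsum_single i (a * x) : V) y).
rewrite -gns_act_adjoint; congr (ip _ y).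
by apply: dsumP => j /=; case: eqP => // _; rewrite mulr0.
Qed.

Lemma gns_vector_lin i a x y :
  gns_vector i (a *: x + y) = a *: gns_vector i x + gns_vector i y.
Proof.
rewrite -cpl_embed_lin; congr cpl_embed; apply: dsumP => j.
by rewrite [RHS]dsum_linE /=; case: eqP => // _; rewrite scaler0 addr0.
Qed.

Lemma ip_gns_vector i x y : ip (gns_vector i x) (gns_vector i y) = sval i (adj y * x).
Proof.
rewrite ip_cpl_embed /= ip_dsum_single; last exact: gns_form_linear.
by rewrite /= eqxx.
Qed.

(** For a distinct from b, some state is nonzero on the product of [adj (a - b)] and a - b; its
    vector at 1 then separates the two operators. *)
Lemma gns_inj : injective gns.
Proof.
move=> a b ab; apply/eqP; rewrite -subr_eq0; apply/negPn/negP => ab0.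
have [rho rho_st /eqP] := norming_state ab0; apply.
pose i : T := exist _ rho rho_st.
have ab_vec : gns_vector i (a - b) = 0.
  by rewrite -[a - b]mulr1 -gns_vectorE (star_homB gns_star_hom) ab subrr.
by have := ip_gns_vector i (a - b) (a - b); rewrite ab_vec ip0l => ->.
Qed.

End GNS.

(** Let rho be a state extending chi and d = c - chi c. The squared norm of the vector of d is rho
    of [adj d * d], that is chi (adj d) chi d = 0; so c acts on the vector of 1 as chi c. *)
Lemma gns_joint_eigen (R : realType) (A : cstarAlgType R) (C : cstarSubalg A)
  (chi : Spec (subalg_type C)) :
  exists2 v, v != 0 & joint_eigen (fun c : subalg_type C => gns (val c)) chi v.
Proof.
have [rho rho_st rhoE] := extend_character (svalP chi).
have [rho_lin rho1 _ _] := rho_st; have [chi_lin [chi1 chiM]] := svalP chi.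
pose i : {classic _} := exist _ rho rho_st.
exists (gns_vector i 1).
  apply/eqP => v0; have := ip_gns_vector i 1 1; rewrite v0 ip0l mulr1 adj_one /= rho1.
  by move=> /esym/eqP; rewrite oner_eq0.
move=> c; pose d : subalg_type C := (- sval chi c) *: subalg_one C + c.
have chid : sval chi d = 0.
  by rewrite (scalar_D chi_lin) (scalar_Z chi_lin) [sval chi (subalg_one C)]chi1 mulr1 addNr.
have : gns_vector i (val d) = 0.
  apply: hilb_def; rewrite ip_gns_vector /=.
  have -> : adj (val d) * val d = val (subalg_mul (subalg_star d) d) by [].
  have := chiM (adj d) d; rewrite chid mulr0 => <-.
  exact: rhoE.
have -> : val d = (- sval chi c) *: (1 : A) + val c by [].
rewrite gns_vector_lin scaleNr addrC => /eqP; rewrite subr_eq0 => /eqP <-.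
by rewrite gns_vectorE mulr1.
Qed.

Theorem proposition2p3 (R : realType) (A : cstarAlgType R) :
  exists (M : cstarAlgType R) (phi : A -> M), faithful_cstar_discretization phi.
Proof.
exists (bop_alg (completion (gns_preip A))), (@gns R A).
have ext (C : cstarSubalg A) : commutative_subalg C ->
    exists2 phiC, @factors_through R A _ (@gns R A) C phiC & injective phiC.
  move=> C_comm.
  have [|| psi [psi_hom psi_ext psi_eigen]] := @star_hom_extension R _
      (subalg_type C) (fun c : subalg_type C => gns (val c)).
  - by move=> x y; apply: val_inj; exact: (C_comm _ _ (valP x) (valP y)).
  - have [gl [g1 gM] ga] := gns_star_hom A.
    split; [by move=> a x y; exact: gl|split|by move=> x; exact: ga].
      exact: g1.
    by move=> x y; exact: gM.
  exists psi; first by [].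
  (* f(chi) and g(chi) are eigenvalues of one and the same operator at a nonzero joint eigenvector
     for chi. *)
  move=> f g fg; apply: linfP => chi.
  have [v v0 ev] := gns_joint_eigen chi.
  have := psi_eigen f chi v ev; rewrite fg (psi_eigen g chi v ev) => /eqP.
  by rewrite -subr_eq0 -scalerBl scaler_eq0 (negPf v0) orbF subr_eq0 => /eqP.
split; [split; first exact: gns_star_hom|exact: gns_inj|exact: ext].
by move=> C /ext[phiC fac _]; exists phiC.
Qed.
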